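(* Let $n \in \mathbb{N}\setminus\{0,1\}$, let $E$ and $F$ be finite-dimensional vector spaces, and let $L(\mathrm{D})$ be a homogeneous constant coefficient differential operator from $E$ to $F$ on $\mathbb{R}^n$. There exists a constant $C \in (0,+\infty)$ such that for every $f \in C^\infty(\mathbb{R}^n,E)\cap L^1(\mathbb{R}^n,E)$ that satisfies $L(\mathrm{D})f = 0$ and every $\varphi \in C^\infty_c(\mathbb{R}^n,E)$, $$\Big|\int_{\mathbb{R}^n} \langle f,\varphi\rangle\Big| \le C \int_{\mathbb{R}^n}|f| \,\Big(\int_{\mathbb{R}^n} |\mathrm{D}\varphi|^n\Big)^{\frac1n}$$ if and only if the operator $L(\mathrm{D})$ is cocancelling.
   Context: All vector spaces are real and finite-dimensional, endowed with fixed Euclidean structures; $\langle\cdot,\cdot\rangle$ is the inner product. $\operatorname{Lin}(X,Y)$ is the space of linear maps from $X$ to $Y$. A homogeneous constant coefficient differential operator $L(\mathrm{D})$ from $E$ to $F$ on $\mathbb{R}^n$ (of some order $k \in \mathbb{N}\setminus\{0\}$) is an operator of the form $L(\mathrm{D})f(x) = \sum_{\alpha\in\mathbb{N}^n, |\alpha|=k} L_\alpha[\partial^\alpha f(x)]$ with $L_\alpha \in \operatorname{Lin}(E,F)$; its symbol is $L(\xi) = \sum_{|\alpha|=k} \xi^\alpha L_\alpha \in \operatorname{Lin}(E,F)$ for $\xi\in\mathbb{R}^n$. The operator is cocancelling if $\bigcap_{\xi\in\mathbb{R}^n\setminus\{0\}} \ker L(\xi) = \{0\}$. *)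

(* Defs.v *)
From HB Require Import structures.
From mathcomp Require Import all_boot all_order all_algebra.
From mathcomp Require Import all_classical all_reals all_analysis.
Set Implicit Arguments.
Unset Strict Implicit.
Unset Printing Implicit Defensive.
Import Order.TTheory GRing.Theory Num.Theory.
Import numFieldNormedType.Exports.
Local Open Scope classical_set_scope.
Local Open Scope ring_scope.

(* Positive definiteness of the inner product is a consequence of
   [dotprod_norm], since the norm of a [normedModType] is definite. *)
HB.mixin Record NormedModule_hasDotprod (R : realType) E of NormedModule R E := {
  dotprod : E -> E -> R ;
  dotprodC : forall x y, dotprod x y = dotprod y x ;
  dotprodDl : forall x y z, dotprod (x + y) z = dotprod x z + dotprod y z ;
  dotprodZl : forall (a : R) x y, dotprod (a *: x) y = a * dotprod x y ;
  dotprod_norm : forall x, dotprod x x = `|x| ^+ 2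
}.

#[short(type="euclideanType")]
HB.structure Definition Euclidean (R : realType) :=
  {E of NormedModule R E & Vector R E & NormedModule_hasDotprod R E}.

(* R^n is ['rV[R]_n]; the library norm on it is the sup norm, which is used
   below only through its topology. *)

Fact rV_display : measure_display.
Proof. exact. Qed.

Section measurable_rV.
Context (R : realType) (n : nat).

Definition rV_measurable : set (set 'rV[R]_n) :=
  g_sigma_preimage (fun (i : 'I_n) (x : 'rV[R]_n) => x ord0 i : R).

Let rV_set0 : rV_measurable set0.
Proof. exact: sigma_algebra0. Qed.

Let rV_setC A : rV_measurable A -> rV_measurable (~` A).
Proof. exact: sigma_algebraC. Qed.

Let rV_bigcup (F : (set 'rV[R]_n)^nat) : (forall i, rV_measurable (F i)) ->
  rV_measurable (\bigcup_i (F i)).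
Proof. exact: sigma_algebra_bigcup. Qed.

HB.instance Definition _ := @isMeasurable.Build rV_display
  'rV[R]_n rV_measurable rV_set0 rV_setC rV_bigcup.

End measurable_rV.

Definition rV_cons (R : realType) (n : nat) (p : R * 'rV[R]_n) : 'rV[R]_n.+1 :=
  row_mx p.1%:M p.2.

(* The Borel measure on R^n that is the n-fold product of the Lebesgue measure
   of R; R^n.+1 is identified with R * R^n through [rV_cons]. *)
Fixpoint lebesgue_rV (R : realType) (n : nat) : set 'rV[R]_n -> \bar R :=
  if n is m.+1 then
    pushforward (@lebesgue_measure R \x @lebesgue_rV R m)%E (@rV_cons R m)
  else \d_ (0 : 'rV[R]_0).

Section lebesgue_rV_measure.
Context (R : realType).

Lemma measurable_rV_coord n (i : 'I_n) :
  measurable_fun [set: 'rV[R]_n] (fun x : 'rV[R]_n => x ord0 i).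
Proof.
move=> _ Y mY; rewrite setTI; apply: sub_sigma_algebra => /=.
rewrite -bigcup_seq/=; exists i => /=; first by rewrite mem_index_enum.
by exists Y => //; rewrite setTI.
Qed.

Lemma measurable_fun_rVP d (T : measurableType d) n (f : T -> 'rV[R]_n) :
  (forall i, measurable_fun [set: T] (fun x => f x ord0 i)) ->
  measurable_fun [set: T] f.
Proof.
move=> mf _ A mA; rewrite setTI.
suff: g_sigma_preimage (fun i x => f x ord0 i : R) `<=` measurable.
  have -> : (fun (i : 'I_n) x => f x ord0 i : R) =
      (fun i => (fun v : 'rV[R]_n => v ord0 i) \o f) by [].
  by rewrite g_sigma_preimage_comp; apply; exists A => //; rewrite setTI.
apply: smallest_sub; first exact: sigma_algebra_measurable.
case: n => [|n] in f mf A mA *; first by rewrite big_ord0.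
rewrite -bigcup_mkord_ord; apply: bigcup_sub => i Ii.
by move=> B [C mC <-]; exact: mf.
Qed.

Lemma measurable_rV_cons n : measurable_fun [set: R * 'rV[R]_n] (@rV_cons R n).
Proof.
apply: measurable_fun_rVP => i.
case: (@splitP 1 n i) => j ij.
  rewrite (_ : (fun _ => _) = fst); first exact: measurable_fst.
  apply/funext => x; rewrite /rV_cons (_ : i = lshift n j); last exact/val_inj.
  by rewrite (@row_mxEl _ 1 1 n) mxE (ord1 j).
rewrite (_ : (fun _ => _) = (fun v : 'rV[R]_n => v ord0 j) \o snd).
  by apply: measurableT_comp => //; exact: measurable_rV_coord.
apply/funext => x; rewrite /rV_cons (_ : i = rshift 1 j); last exact/val_inj.
by rewrite (@row_mxEr _ 1 1 n).
Qed.

Let rV_uncons n (x : 'rV[R]_n.+1) : measurableTypeR R * 'rV[R]_n :=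
  (x ord0 ord0, \row_j x ord0 (lift ord0 j)).

Let measurable_rV_uncons n : measurable_fun [set: 'rV[R]_n.+1] (@rV_uncons n).
Proof.
apply/measurable_fun_pair; first exact: measurable_rV_coord.
apply: measurable_fun_rVP => i.
rewrite (_ : (fun _ => _) = (fun x : 'rV[R]_n.+1 => x ord0 (lift ord0 i))).
  exact: measurable_rV_coord.
by apply/funext => x; rewrite mxE.
Qed.

Let rV_consK n : cancel (@rV_cons R n) (@rV_uncons n).
Proof.
move=> -[a v]; rewrite /rV_uncons /rV_cons; congr pair.
  have -> : (ord0 : 'I_n.+1) = @lshift 1 n ord0 by exact/val_inj.
  by rewrite (@row_mxEl _ 1 1 n) mxE.
apply/rowP => j; rewrite mxE (_ : lift ord0 j = rshift 1 j); last exact/val_inj.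
by rewrite (@row_mxEr _ 1 1 n).
Qed.

Let is_sigma_finite_measure d (T : measurableType d) (mu : set T -> \bar R) :=
  [/\ mu set0 = 0%E, forall A, (0 <= mu A)%E, semi_sigma_additive mu
    & sigma_finite setT mu].

Let pushforward_rV_cons n (mu : {sigma_finite_measure set 'rV[R]_n -> \bar R}) :
  is_sigma_finite_measure
    (pushforward (@lebesgue_measure R \x mu)%E (@rV_cons R n)).
Proof.
have mcons := @measurable_rV_cons n.
split; [exact: measure0|by move=> A; exact: measure_ge0
  |exact: measure_semi_sigma_additive|].
have [F [FT Foo]] : exists F : (set (measurableTypeR R * 'rV[R]_n))^nat,
    setT = \bigcup_k F k /\ forall k, measurable (F k) /\
      ((@lebesgue_measure R \x mu) (F k) < +oo)%E.
  have /sigma_finiteP[A [TA ndA Aoo]] := sigma_finiteT (@lebesgue_measure R).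
  have /sigma_finiteP[B [TB ndB Boo]] := sigma_finiteT mu.
  exists (fun k => A k `*` B k); split.
    rewrite -setXTT TA TB predeqE => -[x y]; split.
      move=> [/= [k _ Akx] [l _ Bly]]; exists (maxn k l) => //; split.
      - by move: x Akx; exact/subsetPset/ndA/leq_maxl.
      - by move: y Bly; exact/subsetPset/ndB/leq_maxr.
    by move=> [k _ []/= ? ?]; split; exists k.
  move=> k; have [? ?] := Aoo k; have [? ?] := Boo k.
  split; first exact: measurableX.
  by rewrite product_measure1E// lte_mul_pinfty// ge0_fin_numE.
exists (fun k => (@rV_uncons n) @^-1` F k).
  by rewrite -preimage_bigcup -FT preimage_setT.
move=> k; have [mF Foo'] := Foo k; split.
  by rewrite -[X in measurable X]setTI; exact: measurable_rV_uncons.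
rewrite /pushforward -comp_preimage (_ : _ \o _ = id) ?preimage_id//.
by apply/funext => x /=; rewrite rV_consK.
Qed.

Let lebesgue_rV_subproof n : is_sigma_finite_measure (@lebesgue_rV R n).
Proof.
elim: n => [|n].
  by split; [exact: measure0|exact: measure_ge0
    |exact: measure_semi_sigma_additive|exact: sigma_finiteT].
rewrite /=; move: (@lebesgue_rV R n) => mu [mu0 mu_ge0 muS muF].
pose M := isMeasure.Build _ _ _ mu mu0 mu_ge0 muS.
pose m : {measure set _ -> \bar R} := HB.pack mu M.
exact: (pushforward_rV_cons
  (HB.pack mu M (Measure_isSigmaFinite.Build _ _ _ m muF))).
Qed.

Variable n : nat.

HB.instance Definition _ := isMeasure.Build _ _ _ (@lebesgue_rV R n)
  (let: And4 h _ _ _ := lebesgue_rV_subproof n in h)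
  (let: And4 _ h _ _ := lebesgue_rV_subproof n in h)
  (let: And4 _ _ h _ := lebesgue_rV_subproof n in h).

HB.instance Definition _ := Measure_isSigmaFinite.Build _ _ _ (@lebesgue_rV R n)
  (let: And4 _ _ _ h := lebesgue_rV_subproof n in h).

End lebesgue_rV_measure.

Section differential_operators.
Context (R : realType) (n : nat).
Implicit Types E F : euclideanType R.

Definition partial E (i : 'I_n) (f : 'rV[R]_n -> E) : 'rV[R]_n -> E :=
  fun x => 'D_(delta_mx ord0 i) f x.

Definition smooth E (f : 'rV[R]_n -> E) : Prop :=
  forall s : seq 'I_n, let g := foldr (@partial E) f s in
    continuous g /\ forall i x, derivable g x (delta_mx ord0 i).

(* Entries range over ['I_k.+1] only to make [multiindex] a finite type: the
   entries of a multi-index of length k are at most k. *)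
Definition multiindex (k : nat) : Type :=
  {a : {ffun 'I_n -> 'I_k.+1} | (\sum_i a i == k)%N}.
HB.instance Definition _ k := Finite.on (multiindex k).

Definition partial_multi E k (a : multiindex k) (f : 'rV[R]_n -> E) :
    'rV[R]_n -> E :=
  foldr (fun i => iter (val a i) (@partial E i)) f (enum 'I_n).

Definition diffop E F k (L : multiindex k -> 'Hom(E, F))
    (f : 'rV[R]_n -> E) : 'rV[R]_n -> F :=
  fun x => \sum_(a : multiindex k) L a (partial_multi a f x).

Definition symbol E F k (L : multiindex k -> 'Hom(E, F)) (xi : 'rV[R]_n) :
    'Hom(E, F) :=
  \sum_(a : multiindex k) (\prod_(i < n) xi ord0 i ^+ val a i) *: L a.

Definition cocancelling E F k (L : multiindex k -> 'Hom(E, F)) : Prop :=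
  \bigcap_(xi in [set xi : 'rV[R]_n | xi != 0])
    [set e : E | e \in lker (symbol L xi)] = [set 0].

(* Measurability of a map into a finite-dimensional Euclidean space is
   expressed on its scalar components. *)
Definition L1 E (f : 'rV[R]_n -> E) : Prop :=
  (forall e : E, measurable_fun [set: 'rV[R]_n] (fun x => dotprod (f x) e)) /\
  (\int[@lebesgue_rV R n]_x (`|f x|)%:E < +oo)%E.

Definition test_function E (phi : 'rV[R]_n -> E) : Prop :=
  smooth phi /\ compact (closure [set x | phi x != 0]).

(* Hilbert-Schmidt norm, i.e. the norm of the Euclidean structure of
   Lin(R^n, E), of the derivative of [phi] at [x]. *)
Definition norm_deriv E (phi : 'rV[R]_n -> E) (x : 'rV[R]_n) : R :=
  Num.sqrt (\sum_(i < n) `|partial i phi x| ^+ 2).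

End differential_operators.

(* Main.v *)
Require Import Defs.
From HB Require Import structures.
From mathcomp Require Import all_boot all_order all_algebra.
From mathcomp Require Import all_classical all_reals all_analysis.
From mathcomp Require Import measurable_realfun ring lra.
Set Implicit Arguments.
Unset Strict Implicit.
Unset Printing Implicit Defensive.
Import Order.TTheory GRing.Theory Num.Theory.
Import numFieldNormedType.Exports.
Local Open Scope classical_set_scope.
Local Open Scope ring_scope.

(* Sufficiency. It is enough to bound the integral of [g] times a scalar test
   function for the combinations [g = sum_a nu ^ a f_a] of solutions of
   [sum_a d ^ a f_a = 0], with [nu = (1, b)]: these are the components of [f]
   along the image of the adjoint of [symbol L nu], and by cocancellation such
   components span [E]. On each hyperplane [nu . x = t], the restriction of the
   test function is mollified at dyadic scales; a smooth function varying at
   scale [sg] is tested against the equation multiplied by an antiderivative of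
   order [k - 1] of a step function of [nu . x - t], which gives a gain [1 / sg],
   while Morrey's inequality in dimension [n - 1] controls the differences of
   consecutive mollifications by the [L^n] norm of the gradient on the
   hyperplane. Summing, optimizing the scale and integrating in [t] gives the
   estimate.
   Necessity. If [e <> 0] lies in all the kernels, then every [L a] kills [e],
   so that any [g *: e] is a solution; averages of [N] dilated bumps are test
   functions equal to [1] near [0] with gradient of [L^n] norm tending to [0]. *)

(** The obstacle is that [f] is only integrable while the exponent [n] is critical: the gradient
    norm just fails to control the sup of [phi]. On a hyperplane the dimension drops to [m = n - 1],
    below the exponent, and Morrey gives Holder continuity of exponent [1 - m / n = 1 / n].
    Mollifications at scale [rho ^ n] then differ by [rho * Ga], and the gain [1 / rho ^ n] leaves
    [rho ^- m], summable along dyadic [rho] because [m > 0]; this is where [n > 1] enters. With [F]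
    the mass of [f] near the slice and [M] its total mass, the slice bound
    [Ga * (F * r + M * r ^- m)] becomes [ka * F + M * ka ^- m * Ga ^ n] for [r = ka / Ga]. As [ka]
    is the same for all slices, this is linear in two quantities whose integrals in [t] are of order
    [M] and of the order of the energy of [phi]. So no Holder inequality in [t] is needed, and [ka]
    is chosen only at the very end. Normal vectors are normalised to have first coordinate [1], so
    that hyperplanes are graphs over the last [m] coordinates and the change of variables to them is
    a measure-preserving shear. *)

Section coordinates.
Context (R : realType).
Implicit Types (n : nat).

Lemma rV_consE0 n (x : R) (y : 'rV[R]_n) : rV_cons (x, y) ord0 ord0 = x.
Proof.
rewrite /rV_cons/= (_ : ord0 = @lshift 1 n ord0 :> 'I_n.+1); last exact/val_inj.
by rewrite (@row_mxEl _ 1 1 n) mxE.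
Qed.

Lemma rV_consES n (x : R) (y : 'rV[R]_n) j :
  rV_cons (x, y) ord0 (lift ord0 j) = y ord0 j.
Proof.
rewrite /rV_cons/= (_ : lift ord0 j = rshift 1 j); last exact/val_inj.
by rewrite (@row_mxEr _ 1 1 n).
Qed.

Lemma rV_norm_le n (x : 'rV[R]_n) (e : R) : 0 <= e ->
  (`|x| <= e) = [forall i, `|x ord0 i| <= e].
Proof.
move=> e0; apply/idP/idP => [xe|/forallP xe].
  apply/forallP => i; apply: le_trans xe.
  by rewrite [leRHS]/Num.Def.normr/= mx_normrE; exact: (le_bigmax _ _ (ord0, i)).
rewrite /Num.Def.normr/= mx_normrE; apply: bigmax_le => // -[i j] _ /=.
by rewrite (ord1 i).
Qed.

Lemma rV_coord_le n (x : 'rV[R]_n) i : `|x ord0 i| <= `|x|.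
Proof. by have := rV_norm_le x (normr_ge0 x); rewrite lexx => /esym/forallP. Qed.

End coordinates.

(** * Borel sets, Fubini and affine changes of variables on R^n *)

Section measurability.
Context (R : realType).
Implicit Types (n : nat).

(** The sigma-algebra is generated by the coordinates. Boxes with rational centre and half-side
    [1 / (N + 1)] form a countable base of the sup-norm topology, so every open set is a countable
    union of them. *)
Lemma rV_open_measurable n (A : set 'rV[R]_n) : open A -> measurable A.
Proof.
move=> oA.
pose box (p : 'rV[rat]_n * nat) : set 'rV[R]_n :=
  [set x | forall i, `|x ord0 i - ratr (p.1 ord0 i)| < p.2.+1%:R^-1].
have -> : A = \bigcup_p (if `[< box p `<=` A >] then box p else set0).
  apply/seteqP; split => [x Ax|x [p _]]; last by case: asboolP => // + ?; apply.
  have /nbhs_ballP[/= e e0 xeA] := open_nbhs_nbhs (conj oA Ax).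
  (* A box of half-side below [e / 2] whose centre is within [e / 2] of [x] lies in the ball of
     radius [e]. *)
  pose N := Num.truncn (2 / e).
  have Ne : N.+1%:R^-1 < e / 2.
    rewrite -[e / 2]invf_div ltf_pV2 ?posrE ?divr_gt0//.
    by rewrite truncnS_gt.
  have Q i : {q : rat | `|x ord0 i - ratr q| < N.+1%:R^-1}.
    apply/cid; have N0 : x ord0 i - N.+1%:R^-1 < x ord0 i + N.+1%:R^-1.
      by rewrite ltrBlDr -addrA ltrDl addr_gt0.
    by have [q /[!in_itv]/= qi] := rat_in_itvoo N0; exists q; rewrite distrC ltr_distl.
  exists (\row_i sval (Q i), N) => //; case: asboolP => [_|[]].
    by move=> i /=; rewrite mxE; case: (Q i).
  move=> y yb; apply: xeA; split => // j i; rewrite (ord1 j).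
  rewrite /ball/= -(subrKA (ratr (sval (Q i)))) (le_lt_trans (ler_normD _ _))//.
  rewrite (splitr e) ltrD//; first by rewrite (lt_trans _ Ne)//; case: (Q i).
  by rewrite distrC (lt_trans _ Ne)//; have := yb i; rewrite /= mxE.
apply: countable_bigcupT_measurable => [|p]; first exact: countableP.
case: ifPn => // _.
rewrite (_ : box p = \bigcap_(i in [set: 'I_n])
    ((fun x : 'rV[R]_n => x ord0 i) @^-1` (ball (ratr (p.1 ord0 i) : R) p.2.+1%:R^-1))); last first.
  apply/seteqP; split => x bx i; first by move=> _; rewrite /ball/= distrC; exact: bx.
  by have := bx i I; rewrite /ball/= distrC.
apply: fin_bigcap_measurable => //= i _; rewrite -[X in measurable X]setTI.
apply: measurable_rV_coord => //; exact: measurable_ball.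
Qed.

Lemma rV_continuous_measurable n (f : 'rV[R]_n -> R) :
  continuous f -> measurable_fun setT f.
Proof.
move=> /continuousP cf; apply: (measurability _ (RGenOpens.measurableE R)).
move=> _ [_ [a [b ->] <-]]; rewrite setTI; apply: rV_open_measurable.
exact/cf/interval_open.
Qed.

End measurability.

Section fubini_rV.
Context (R : realType).
Implicit Types (n : nat).
Local Notation leb := (@lebesgue_measure R).
Local Notation mu n := (@lebesgue_rV R n).
Local Open Scope ereal_scope.

Lemma measurable_comp_rV_cons n (f : 'rV[R]_n.+1 -> \bar R) :
  measurable_fun setT f ->
  measurable_fun [set: measurableTypeR R * 'rV[R]_n] (f \o @rV_cons R n).
Proof.
move=> mf; apply: (measurableT_comp mf); exact: measurable_rV_cons.
Qed.

Lemma ge0_integral_rVS n (f : 'rV[R]_n.+1 -> \bar R) :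
  measurable_fun setT f -> (forall x, 0 <= f x) ->
  \int[mu n.+1]_x f x = \int[leb]_x \int[mu n]_y f (rV_cons (x, y)).
Proof.
move=> mf f0.
transitivity (\int[leb \x mu n]_p f (rV_cons p)).
  by apply: (@ge0_integral_pushforward _ _ (measurableTypeR R * 'rV[R]_n)%type
    _ _ _ (@measurable_rV_cons R n) (leb \x mu n)).
apply: (@fubini_tonelli1 _ _ (measurableTypeR R) _ _ leb (mu n) (f \o @rV_cons R n)) => [|z]; last exact: f0.
exact: measurable_comp_rV_cons.
Qed.

Lemma ge0_integral_rVS' n (f : 'rV[R]_n.+1 -> \bar R) :
  measurable_fun setT f -> (forall x, 0 <= f x) ->
  \int[mu n.+1]_x f x = \int[mu n]_y \int[leb]_x f (rV_cons (x, y)).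
Proof.
move=> mf f0; rewrite ge0_integral_rVS//.
apply: (@fubini_tonelli _ _ (measurableTypeR R) _ _ leb (mu n) (f \o @rV_cons R n)) => [|z]; last exact: f0.
exact: measurable_comp_rV_cons.
Qed.

End fubini_rV.

Section affine.
Context (R : realType).
Implicit Types (n : nat).
Local Notation leb := (@lebesgue_measure R).
Local Notation mu n := (@lebesgue_rV R n).
Local Open Scope ereal_scope.

Let affine (b c : R) (x : measurableTypeR R) : measurableTypeR R := (b + c * x)%R.

Let measurable_affine b c : measurable_fun setT (affine b c).
Proof. by apply: measurable_funD => //; exact: measurable_funM. Qed.

(** [c] times the push-forward of Lebesgue measure by the affine map has the right value on
    half-open intervals, hence is Lebesgue measure by uniqueness. *)
Lemma ge0_integral_affine1 (b c : R) (f : R -> \bar R) : (0 < c)%R ->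
  measurable_fun setT f -> (forall x, 0 <= f x) ->
  \int[leb]_x f (b + c * x)%R = (c^-1)%:E * \int[leb]_x f x.
Proof.
move=> c0 mf f0.
pose m' : {measure set (measurableTypeR R) -> \bar R} :=
  mscale (NngNum (ltW c0)) (pushforward leb (affine b c)).
pose m := m' (measurable_affine b c).
have lebm A : measurable A -> leb A = m A.
  apply: lebesgue_measure_unique => _ [[x y] xy <-] /=.
  rewrite /m/m'/= /mscale/= /pushforward.
  have -> : affine b c @^-1` `]x, y] = `](x - b) / c, (y - b) / c]%classic%R.
    apply/seteqP; split => z /=; rewrite !in_itv/= /affine.
      by rewrite ltr_pdivrMr// ler_pdivlMr// ltrBlDl lerBrDl mulrC.
    by rewrite ltr_pdivrMr// ler_pdivlMr// ltrBlDl lerBrDl mulrC.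
  rewrite !lebesgue_measure_itv/= !lte_fin ltr_pM2r ?invr_gt0// ltrD2r.
  case: ifPn => _; last by rewrite mule0.
  by rewrite -!EFinB -EFinM; congr EFin; field; rewrite gt_eqF.
rewrite [in RHS](@eq_measure_integral _ _ _ setT m leb)//; last first.
  by move=> A mA _; exact: lebm.
rewrite /m/m' ge0_integral_mscale//= muleA -EFinM mulVf ?gt_eqF// mul1e.
by rewrite ge0_integral_pushforward//; exact: measurable_affine.
Qed.

Lemma ge0_integral_affine n (b : 'rV[R]_n) (c : R) (f : 'rV[R]_n -> \bar R) :
  (0 < c)%R -> measurable_fun setT f -> (forall x, 0 <= f x) ->
  \int[mu n]_x f (b + c *: x)%R = ((c ^- n)%R)%:E * \int[mu n]_x f x.
Proof.
move=> c0; elim: n => [|n IHn] in b f *; move=> mf f0.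
  rewrite expr0 invr1 mul1e; apply: eq_integral => x _; congr f.
  by apply/rowP => -[].
have mc : measurable_fun setT (fun x : 'rV[R]_n.+1 => (b + c *: x)%R).
  apply: measurable_fun_rVP => i; under eq_fun do rewrite !mxE.
  by apply: measurable_funD => //; apply: measurable_funM => //; exact: measurable_rV_coord.
pose b' := (\row_j b ord0 (lift ord0 j))%R.
have bE x y : (b + c *: rV_cons (x, y) = rV_cons (b ord0 ord0 + c * x, b' + c *: y))%R.
  apply/rowP => j; case: (unliftP ord0 j) => [i ->|->].
    by rewrite mxE [X in (_ + X)%R]mxE !rV_consES [RHS]mxE [X in _ = (X + _)%R]mxE [X in _ = (_ + X)%R]mxE.
  by rewrite mxE [X in (_ + X)%R]mxE !rV_consE0.
rewrite ge0_integral_rVS//; last exact: measurableT_comp.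
have mfc := measurable_comp_rV_cons mf.
under eq_integral => x _.
  under eq_integral do rewrite bE.
  rewrite (IHn b' (fun z => f (rV_cons (_, z))))//; last first.
    exact: (measurableT_comp mfc (pair1_measurable _)).
  over.
pose g x := ((c ^- n)%R)%:E * \int[mu n]_y f (rV_cons (x, y)).
have mg : measurable_fun setT (fun x => \int[mu n]_y f (rV_cons (x, y))).
  by apply: (@measurable_fun_fubini_tonelli_F _ _ (measurableTypeR R) _ _ (mu n) (f \o @rV_cons R n)) => // z; exact: f0.
rewrite (ge0_integral_affine1 _ (f := g))//=; last 2 first.
  by apply: emeasurable_funM.
  move=> x; rewrite mule_ge0 ?lee_fin ?invr_ge0 ?exprn_ge0 ?(ltW c0)//.
  exact: integral_ge0.
rewrite ge0_integralZl//; last 2 first.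
  by move=> x _; exact: integral_ge0.
  by rewrite lee_fin invr_ge0 exprn_ge0// ltW.
by rewrite muleA -EFinM -invfM -exprS ge0_integral_rVS.
Qed.

End affine.

Section integrability.
Context (R : realType).
Implicit Types (n : nat).
Local Notation leb := (@lebesgue_measure R).
Local Notation mu n := (@lebesgue_rV R n).

Definition cube n (K : R) : set 'rV[R]_n := [set x | `|x| <= K].

Lemma rV_norm_cons n (x : R) (y : 'rV[R]_n) (K : R) : 0 <= K ->
  (`|rV_cons (x, y)| <= K) = (`|x| <= K) && (`|y| <= K).
Proof.
move=> K0; rewrite !rV_norm_le//; apply/forallP/andP => [h|[x0 /forallP y0] i].
  split; first by have := h ord0; rewrite rV_consE0.
  by apply/forallP => j; have := h (lift ord0 j); rewrite rV_consES.
by case: (unliftP ord0 i) => [j ->|->]; rewrite ?rV_consES ?rV_consE0.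
Qed.

Lemma measurable_cube n (K : R) : measurable (@cube n K).
Proof.
rewrite -[@cube n K]setTI.
apply: (@emeasurable_fun_infty_c _ _ R setT (fun x : 'rV[R]_n => `|x|%:E)
  measurableT _ K%:E).
apply/measurable_EFinP; apply: rV_continuous_measurable; exact: norm_continuous.
Qed.

Lemma lebesgue_rV_cube n (K : R) : 0 <= K -> mu n (@cube n K) = ((K *+ 2) ^+ n)%:E.
Proof.
move=> K0; elim: n => [|n IHn].
  by rewrite expr0 /= diracE mem_set// /cube/= normr0.
rewrite -(setIT (@cube n.+1 K)) -integral_indic//; last exact: measurable_cube.
rewrite ge0_integral_rVS//; last first.
  by apply/measurable_EFinP; apply: measurable_indic; exact: measurable_cube.
transitivity (\int[leb]_x ((\1_`[-K, K] x)%:E * ((K *+ 2) ^+ n)%:E))%E.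
  apply: eq_integral => x _.
  transitivity (\int[mu n]_y ((\1_`[-K, K] x)%:E * (\1_(@cube n K) y)%:E))%E.
    apply: eq_integral => y _; rewrite -EFinM; congr EFin.
    rewrite !indicE -natrM mulnb; congr (_%:R)%R; congr nat_of_bool.
    apply/idP/andP => [/set_mem|[/set_mem + /set_mem]].
      rewrite /cube/= rV_norm_cons// => /andP[xK yK].
      by split; apply/mem_set => //=; rewrite in_itv/= -ler_norml.
    rewrite /cube/= in_itv/= -ler_norml => xK yK; apply/mem_set => /=.
    by rewrite rV_norm_cons// xK.
  rewrite ge0_integralZl//; last by apply/measurable_EFinP; apply: measurable_indic; exact: measurable_cube.
  by rewrite integral_indic ?setIT// -?IHn//; exact: measurable_cube.
rewrite ge0_integralZr//; last 2 first.
- by apply/measurable_EFinP/measurable_indic.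
- by rewrite lee_fin exprn_ge0// mulrn_wge0.
rewrite integral_indic// setIT [X in (X * _)%E]lebesgue_measure_itv/= lte_fin.
have [K1|K1] := ltP (- K) K; first by rewrite -EFinB -EFinM opprK -mulr2n exprS.
have -> : K = 0 by lra.
by rewrite mul0rn exprS mul0r mul0e.
Qed.

Lemma integrable_on_cube n (f : 'rV[R]_n -> R) (K B : R) : 0 <= K ->
  measurable_fun setT f -> (forall x, `|f x| <= B) ->
  (forall x, K < `|x| -> f x = 0) -> (mu n).-integrable setT (EFin \o f).
Proof.
move=> K0 mf fB f0.
have B0 : 0 <= B by exact: le_trans (fB 0).
apply: (@le_integrable _ _ _ (mu n) setT _ _ (fun x => (B * \1_(@cube n K) x)%:E)) => //.
- exact/measurable_EFinP.
- move=> x _ /=; rewrite lee_fin indicE; case: (boolP (x \in cube K)) => xK.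
    by rewrite mulr1 (ger0_norm B0).
  rewrite f0 ?normr0//; move: xK; rewrite notin_setE/= => /negP.
  by rewrite -ltNge.
- under eq_fun do rewrite EFinM; apply: integrableZl => //.
  apply/integrableP; split.
    by apply/measurable_EFinP; apply: measurable_indic; exact: measurable_cube.
  under eq_integral do rewrite gee0_abs ?lee_fin//.
  rewrite integral_indic ?setIT//; last exact: measurable_cube.
  by rewrite [X in (X < _)%E](lebesgue_rV_cube n K0) ltry.
Qed.

End integrability.

Section fubini_signed.
Context (R : realType).
Implicit Types (n : nat).
Local Notation leb := (@lebesgue_measure R).
Local Notation mu n := (@lebesgue_rV R n).
Local Open Scope ereal_scope.

Let integrable_prod n (f : 'rV[R]_n.+1 -> \bar R) :
  (mu n.+1).-integrable setT f ->
  (leb \x mu n).-integrable setT (f \o @rV_cons R n).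
Proof.
move=> /integrableP[mf foo]; apply/integrableP; split.
  exact: measurable_comp_rV_cons.
rewrite (le_lt_trans _ foo)//.
rewrite [leRHS](@ge0_integral_pushforward _ _ (measurableTypeR R * 'rV[R]_n)%type
    _ _ _ (@measurable_rV_cons R n) (leb \x mu n))//=.
exact: measurableT_comp.
Qed.

Let integral_prod n (f : 'rV[R]_n.+1 -> \bar R) :
  (mu n.+1).-integrable setT f ->
  \int[mu n.+1]_x f x = \int[leb \x mu n]_p f (rV_cons p).
Proof.
move=> intf; have /integrableP[mf _] := intf.
apply: (@integral_pushforward _ _ (measurableTypeR R * 'rV[R]_n)%type
    _ _ _ (@measurable_rV_cons R n) (leb \x mu n)) => //.
exact: integrable_prod.
Qed.

Lemma integral_rVS n (f : 'rV[R]_n.+1 -> \bar R) :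
  (mu n.+1).-integrable setT f ->
  \int[mu n.+1]_x f x = \int[leb]_x \int[mu n]_y f (rV_cons (x, y)).
Proof.
by move=> fi; rewrite integral_prod// -integral12_prod_meas1//; exact: integrable_prod.
Qed.

Lemma integral_rVS' n (f : 'rV[R]_n.+1 -> \bar R) :
  (mu n.+1).-integrable setT f ->
  \int[mu n.+1]_x f x = \int[mu n]_y \int[leb]_x f (rV_cons (x, y)).
Proof.
by move=> fi; rewrite integral_prod// -integral21_prod_meas1//; exact: integrable_prod.
Qed.

End fubini_signed.

(** * Smooth functions on the line: flat exponentials, steps, bumps and their antiderivatives *)

Section smooth_line.
Context (R : realType).
Implicit Types (f g : R -> R).

Fixpoint Ck (k : nat) f : Prop :=
  if k is k'.+1 then
    exists2 f' : R -> R, (forall x : R, is_derive x (1 : R) f (f' x)) & Ck k' f'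
  else True.

Definition smooth1 f := forall k, Ck k f.

Lemma Ck_pred k f : Ck k.+1 f -> Ck k f.
Proof.
elim: k f => [//|k IHk] f /= [f' ff' [f'' f'f'' Cf'']].
by exists f' => //; apply: IHk; exists f''.
Qed.

Lemma Ck_cst k (c : R) : Ck k (fun=> c).
Proof.
elim: k c => [//|k IHk] c; exists (fun=> 0) => // x; exact: is_derive_cst.
Qed.

Lemma Ck_D k f g : Ck k f -> Ck k g -> Ck k (fun x => f x + g x).
Proof.
elim: k f g => [//|k IHk] f g [f' df Cf'] [g' dg Cg'].
by exists (fun x => f' x + g' x); [move=> x; exact: is_deriveD|exact: IHk].
Qed.

Lemma Ck_N k f : Ck k f -> Ck k (fun x => - f x).
Proof.
elim: k f => [//|k IHk] f [f' df Cf'].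
by exists (fun x => - f' x); [move=> x; exact: is_deriveN|exact: IHk].
Qed.

Lemma Ck_M k f g : Ck k f -> Ck k g -> Ck k (fun x => f x * g x).
Proof.
elim: k f g => [//|k IHk] f g Cf Cg.
have [[f' df Cf'] [g' dg Cg']] := (Cf, Cg).
exists (fun x => f x * g' x + g x * f' x).
  by move=> x; apply: (@is_deriveM _ _ f g).
by apply: Ck_D; apply: IHk => //; exact: Ck_pred.
Qed.

Lemma Ck_V k f : (forall x, f x != 0) -> Ck k f -> Ck k (fun x => (f x)^-1).
Proof.
move=> f0; elim: k => [//|k IHk] Cf; have [f' df Cf'] := Cf.
exists (fun x => - ((f x)^-1 * (f x)^-1) * f' x).
  move=> x; apply: is_derive_eq.
  by rewrite expr2 invfM.
apply: Ck_M => //; apply: Ck_N.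
by apply: Ck_M; apply: IHk; exact: Ck_pred.
Qed.

Lemma Ck_affine k f (a b : R) : Ck k f -> Ck k (fun x => f (a * x + b)).
Proof.
elim: k f => [//|k IHk] f [f' df Cf'].
exists (fun x => f' (a * x + b) * a); last first.
  by apply: Ck_M; [exact: IHk|exact: Ck_cst].
move=> x; apply: (@is_derive1_comp _ f (fun x => a * x + b)) => //.
apply: is_derive_eq.
by rewrite addr0 /GRing.scale/= mulr1.
Qed.

Definition jet f (j : nat) : R -> R := derive1n j f.

Lemma smooth1_jet f : smooth1 f ->
  forall j x, is_derive x (1 : R) (jet f j) (jet f j.+1 x).
Proof.
move=> sf j x; suff: exists2 f' : R -> R, (forall x : R, is_derive x (1 : R) (jet f j) (f' x)) & smooth1 f'.
  move=> [f' df _]; rewrite /jet derive1nS derive1E.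
  by apply: DeriveDef => //; exact: (@ex_derive _ _ _ _ _ _ _ (df x)).
have step g : smooth1 g -> smooth1 (derive1 g) /\ forall x, is_derive x (1 : R) g (derive1 g x).
  move=> sg; have [g' dg _] := sg 1.
  have gE : derive1 g = g'.
    by apply/funext => y; rewrite derive1E; apply: (@derive_val _ _ _ _ _ _ _ (dg y)).
  rewrite gE; split=> // k; have [g'' dg' Cg''] := sg k.+1.
  suff -> : g' = g'' by [].
  apply/funext => y; rewrite -(@derive_val _ _ _ _ _ _ _ (dg y)).
  by rewrite (@derive_val _ _ _ _ _ _ _ (dg' y)).
have sj i : smooth1 (jet f i).
  elim: i => [|i IHi]; first by rewrite /jet derive1n0.
  by rewrite /jet derive1nS; exact: (step _ IHi).1.
by exists (derive1 (jet f j)); [exact: (step _ (sj j)).2|exact: (step _ (sj j)).1].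
Qed.

End smooth_line.

Section flat_exponential.
Context (R : realType).
Implicit Types (p : {poly R}).

Definition flat p (x : R) : R := if 0 < x then p.[x^-1] * expR (- x^-1) else 0.

(** With [u = 1 / x], the bound of [exp u] from below by [u ^ (i + 1) / (i + 1)!] gives
    [u ^ i * exp (- u) <= (i + 1)! * x] for each monomial. *)
Lemma flat_small p : exists2 C : R, 0 < C & forall x, `|flat p x| <= C * `|x|.
Proof.
exists (1 + \sum_(i < size p) `|p`_i| * (i.+1)`!%:R).
  by rewrite ltr_pwDl// sumr_ge0// => i _; rewrite mulr_ge0.
move=> x; rewrite /flat; case: ltP => [x0|_]; last first.
  by rewrite normr0 mulr_ge0// addr_ge0// sumr_ge0// => i _; rewrite mulr_ge0.
have u0 : 0 < x^-1 by rewrite invr_gt0.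
rewrite normrM (ger0_norm (expR_ge0 _)) (gtr0_norm x0) horner_coef.
apply: (@le_trans _ _ ((\sum_(i < size p) `|p`_i| * (i.+1)`!%:R) * x)); last first.
  by rewrite ler_wpM2r ?(ltW x0)// lerDr.
rewrite mulr_suml (le_trans (ler_wpM2r (expR_ge0 _) (ler_norm_sum _ _ _)))//.
rewrite mulr_suml ler_sum// => i _; rewrite normrM -!mulrA ler_wpM2l//.
rewrite normrX (gtr0_norm u0) expRN ler_pdivrMr ?expR_gt0//.
have h := @expR_ge1Dxn _ _ i (ltW u0).
apply: (@le_trans _ _ ((i.+1)`!%:R * x * (x^-1 ^+ i.+1 / (i.+1)`!%:R))).
  rewrite le_eqVlt; apply/orP; left; apply/eqP; rewrite exprS; field.
  by rewrite (gt_eqF x0) andbT pnatr_eq0 -lt0n fact_gt0.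
rewrite ler_pM2l ?mulr_gt0 ?ltr0n ?fact_gt0//.
by rewrite (le_trans _ h)// lerDr.
Qed.

Lemma is_derive_flat p (x : R) :
  is_derive x (1 : R) (flat p) (flat ('X^2 * (p - p^`())) x).
Proof.
have [x0|x0|->] := ltgtP x 0.
- rewrite {2}/flat ltNge (ltW x0)/=.
  apply: (@near_eq_is_derive _ _ _ (cst 0)).
  near=> y; rewrite /flat ltNge (_ : y <= 0)//=.
  by apply/ltW; near: y; exact: lt_nbhsl.
- rewrite {2}/flat x0.
  apply: (@near_eq_is_derive _ _ _ (fun y : R => p.[y^-1] * expR (- y^-1))).
    near=> y; rewrite /flat (_ : 0 < y)//.
    by near: y; exact: lt_nbhsr.
  have dinv : is_derive x (1 : R) (fun y : R => y^-1) (- x ^- 2).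
    apply: is_derive_eq; first by apply: is_deriveV; rewrite gt_eqF.
    by rewrite /GRing.scale/= mulr1.
  have dp : is_derive x (1 : R) (fun y : R => p.[y^-1]) (p^`().[x^-1] * - x ^- 2).
    apply: (@is_derive1_comp _ (horner p) (fun y : R => y^-1)) => //.
  have de : is_derive x (1 : R) (fun y : R => expR (- y^-1)) (expR (- x^-1) * x ^- 2).
    apply: is_derive_eq.
    by rewrite opprK.
  apply: is_derive_eq.
  by rewrite /GRing.scale/= !hornerE/= !exprVn; ring.
- rewrite {2}/flat ltxx.
  (* The difference quotient of [flat p] at [0] is [flat (p * 'X)], which tends to [0]. *)
  have [C C0 hC] := flat_small (p * 'X).
  have lim0 : (h^-1 *: (flat p (h *: 1 + 0) - flat p 0)) @[h --> 0^'] --> (0 : R).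
    apply/cvgrPdist_le => e e0; near=> h.
    rewrite sub0r normrN {2}/flat ltxx subr0 addr0 /GRing.scale/= mulr1.
    apply: (@le_trans _ _ `|flat (p * 'X) h|).
      rewrite /flat; case: ifPn => _; last by rewrite mulr0 normr0.
      by rewrite hornerMX mulrCA mulrA.
    apply: le_trans (hC h) _; rewrite mulrC -ler_pdivlMr//.
    by near: h; apply: dnbhs0_le; rewrite divr_gt0.
  apply: DeriveDef; first by apply/cvg_ex; exists 0.
  by rewrite /derive; exact/cvg_lim.
Unshelve. all: by end_near. Qed.

Lemma smooth1_flat p : smooth1 (flat p).
Proof.
move=> k; elim: k p => [//|k IHk] p; exists (flat ('X^2 * (p - p^`()))) => //.
by move=> x; exact: is_derive_flat.
Qed.

Definition sstep (x : R) : R := flat 1 x / (flat 1 x + flat 1 (1 - x)).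

Let flat1_ge0 (x : R) : 0 <= flat 1 x.
Proof. by rewrite /flat; case: ifP => // _; rewrite hornerC mul1r expR_ge0. Qed.

Let flat1_gt0 (x : R) : 0 < x -> 0 < flat 1 x.
Proof. by move=> x0; rewrite /flat x0 hornerC mul1r expR_gt0. Qed.

Let sstep_den_gt0 (x : R) : 0 < flat 1 x + flat 1 (1 - x).
Proof.
have [x0|x0] := ltP 0 x; first by rewrite ltr_pwDl ?flat1_gt0.
by rewrite ltr_pwDr ?flat1_gt0//; lra.
Qed.

Lemma smooth1_sstep : smooth1 sstep.
Proof.
move=> k; apply: Ck_M; first exact: smooth1_flat.
apply: Ck_V; first by move=> x; rewrite gt_eqF.
apply: Ck_D; first exact: smooth1_flat.
have -> : (fun x => flat 1 (1 - x)) = (fun x => flat 1 (-1 * x + 1)).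
  by apply/funext => x; rewrite mulN1r addrC.
exact/Ck_affine/smooth1_flat.
Qed.

Lemma sstep_ge0 (x : R) : 0 <= sstep x.
Proof. by rewrite divr_ge0// ltW. Qed.

Lemma sstep_le1 (x : R) : sstep x <= 1.
Proof. by rewrite ler_pdivrMr// mul1r lerDl. Qed.

Lemma sstep0 (x : R) : x <= 0 -> sstep x = 0.
Proof. by move=> x0; rewrite /sstep /flat ltNge x0 mul0r. Qed.

Lemma sstep1 (x : R) : 1 <= x -> sstep x = 1.
Proof.
move=> x1; rewrite /sstep [flat 1 (1 - x)]/flat ltNge subr_le0 x1/= addr0 divff//.
by rewrite gt_eqF// flat1_gt0//; lra.
Qed.

End flat_exponential.

Section jets.
Context (R : realType).
Implicit Types (f : R -> R) (H : nat -> R -> R).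

(** A function is carried together with all its derivatives as one sequence, so that the derivatives
    of everything built from it are explicit. *)
Definition is_jet H := forall j (x : R), is_derive x (1 : R) (H j) (H j.+1 x).

Lemma is_derive_continuous f (df : R -> R) :
  (forall x : R, is_derive x (1 : R) f (df x)) -> continuous f.
Proof.
move=> dfE x; apply: differentiable_continuous; apply/derivable1_diffP.
exact: (@ex_derive _ _ _ _ _ _ _ (dfE x)).
Qed.

Lemma jet_continuous H j : is_jet H -> continuous (H j).
Proof. by move=> HH; exact: is_derive_continuous. Qed.

Lemma MVT_jet f (df : R -> R) (a b : R) :
  (forall x : R, is_derive x (1 : R) f (df x)) -> a < b ->
  exists c, [/\ a < c, c < b & f b - f a = df c * (b - a)].
Proof.
move=> dfE ab; have [|c] := @MVT R f df a b ab (fun x _ => dfE x).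
  by apply: continuous_subspaceT; exact: is_derive_continuous dfE.
by rewrite in_itv/= => /andP[ac cb] fE; exists c.
Qed.

Lemma continuous_bounded_itv f (a b : R) : continuous f ->
  exists2 C, 0 <= C & forall x, a <= x <= b -> `|f x| <= C.
Proof.
move=> cf; have [ab|ba] := leP a b; last first.
  by exists 0 => // x /andP[ax xb]; have := lt_le_trans ba (le_trans ax xb); rewrite ltxx.
have [c _ hc] := @EVT_max R (fun x => `|f x|) a b ab
   (continuous_subspaceT (fun x => cvg_norm (cf x))).
by exists `|f c| => // x xab; apply: hc; rewrite in_itv.
Qed.

Lemma continuous_eq_left f (a c : R) : continuous f ->
  (forall x, x < a -> f x = c) -> f a = c.
Proof.
move=> cf fc; apply/eqP; rewrite -subr_eq0 -normr_le0 leNgt; apply/negP => h.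
have /cvgrPdist_lt/(_ _ h)/nbhs_ballP[/= e e0 he] := cf a.
have lta : a - e / 2 < a by rewrite ltrBlDr ltrDl divr_gt0.
suff /he : ball a e (a - e / 2) by rewrite /= (fc _ lta) ltxx.
rewrite /ball/=.
by rewrite opprB addrC subrK gtr0_norm ?divr_gt0// ltr_pdivrMr// ltr_pMr// ltr1n.
Qed.

Lemma jet_cst_left H (a c : R) : is_jet H -> (forall x, x < a -> H 0%N x = c) ->
  forall j x, x <= a -> H j x = if j == 0%N then c else 0.
Proof.
move=> HH Hc; have hlt j x : x < a -> H j x = if j == 0%N then c else 0.
  elim: j x => [//|j IHj] x xa /=.
  rewrite -(@derive_val _ _ _ _ _ _ _ (HH j x)).
  rewrite (@near_eq_derive _ _ _ _ (cst (if j == 0%N then c else 0))) ?derive_cst//.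
  by near=> y; apply: IHj; near: y; exact: lt_nbhsl.
move=> j x; rewrite le_eqVlt => /predU1P[->|]; last exact: hlt.
by apply: continuous_eq_left => //; [exact: jet_continuous|exact: hlt].
Unshelve. all: by end_near. Qed.

Lemma jet_affine H (a b : R) : is_jet H ->
  is_jet (fun j x => a ^+ j * H j (a * x + b)).
Proof.
move=> HH j x.
have dH : is_derive x (1 : R) (H j \o (fun x => a * x + b)) (H j.+1 (a * x + b) * a).
  apply: (@is_derive1_comp _ (H j) (fun x => a * x + b)); first exact: HH.
  by apply: is_derive_eq; rewrite /GRing.scale/= mulr1 addr0.
rewrite exprSr -mulrA [a * _]mulrC.
exact: (@is_deriveZ _ _ _ _ (a ^+ j) _ _ _ dH).
Qed.

Lemma antiderivative f : continuous f -> (forall x, x <= 0 -> f x = 0) ->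
  exists F : R -> R, (forall x : R, is_derive x (1 : R) F (f x)) /\
    (forall x, x <= 0 -> F x = 0).
Proof.
move=> cf f0.
(* The base point lies strictly to the left of [0], so that the fundamental theorem covers every
   [x > - 1], while [F] is locally zero elsewhere. *)
pose F (x : R) := (\int[@lebesgue_measure R]_(t in [set` `[- 1, x]]) (f t))%R.
have F0 x : x <= 0 -> F x = 0.
  move=> x0; rewrite /F /Rintegral (@eq_integral _ _ _ _ _ (cst 0%E)) ?integral0// => y.
  rewrite inE/= in_itv/= => /andP[_ yx]; congr EFin; apply: f0; exact: le_trans x0.
exists F; split=> // x; have [x1|x1] := ltP (- 1) x.
  have [||//||dF FE] := @continuous_FTC1_closed R f (- 1) x (x + 1).
  - by rewrite ltrDl.
  - apply: continuous_compact_integrable; first exact: segment_compact.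
    exact: continuous_subspaceT.
  - exact: cf.
  - by move: dF FE; rewrite derive1E => dF <-; exact: (derivableP dF).
rewrite f0; last lra.
apply: (@near_eq_is_derive _ _ _ (cst 0)).
near=> y; rewrite F0//; apply/ltW.
near: y; apply: lt_nbhsl; lra.
Unshelve. all: by end_near. Qed.

End jets.

Section step_functions.
Context (R : realType).

Definition sstepj (j : nat) : R -> R := jet (@sstep R) j.

Lemma sstepj_jet : is_jet sstepj.
Proof. exact/smooth1_jet/smooth1_sstep. Qed.

Lemma sstepj_left j (x : R) : x <= 0 -> sstepj j x = 0.
Proof.
move=> x0; rewrite (@jet_cst_left _ _ 0 0 sstepj_jet _ _ _ x0) ?if_same// => y y0.
by rewrite /sstepj /jet derive1n0 sstep0// ltW.
Qed.

Lemma sstepj_right j (x : R) : 1 <= x -> sstepj j x = (j == 0%N)%:R.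
Proof.
(* The behaviour on the right is deduced from the one on the left, applied to the reflected jet. *)
move=> x1; have h0 (y : R) : y < - 1 -> (- 1) ^+ 0 * sstepj 0 (- 1 * y + 0) = 1.
  by move=> y1; rewrite expr0 mul1r /sstepj /jet derive1n0 sstep1//; lra.
have Nx : - x <= - 1 by lra.
have := jet_cst_left (jet_affine (- 1) 0 sstepj_jet) h0 j Nx.
rewrite mulrNN mul1r addr0; case: j => [|j] /=; first by rewrite expr0 mul1r.
by move=> /eqP; rewrite mulf_eq0 expf_eq0/= oppr_eq0 oner_eq0/= => /eqP.
Qed.

Lemma sstepj_bounded j : exists2 C : R, 1 <= C & forall x, `|sstepj j x| <= C.
Proof.
have [C C0 hC] := @continuous_bounded_itv _ (sstepj j) 0 1 (@jet_continuous _ _ j sstepj_jet).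
exists (C + 1); first lra.
move=> x; have [x0|x0] := leP x 0; first by rewrite sstepj_left// normr0; lra.
have [x1|x1] := leP 1 x; first by rewrite sstepj_right//; case: (j == 0%N); rewrite ?normr1 ?normr0; lra.
by rewrite (le_trans (hC x _)) ?lerDl// (ltW x0) (ltW x1).
Qed.

(** A difference of two steps shifted by one unit: integer translates telescope, so they form a
    partition of unity whose derivatives sum to zero. *)
Definition bumpj j (z : R) : R := sstepj j (z + 1) - sstepj j z.

Lemma bumpj_jet : is_jet bumpj.
Proof.
move=> j x; apply: is_deriveB; last exact: sstepj_jet.
have := jet_affine 1 1 sstepj_jet j x; rewrite expr1n/= !mul1r expr1n.
suff -> : (fun x => 1 * sstepj j (1 * x + 1)) = (fun x => sstepj j (x + 1)) by rewrite !mul1r.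
by apply/funext => y; rewrite !mul1r.
Qed.

Lemma bumpj_out j (z : R) : 1 <= `|z| -> bumpj j z = 0.
Proof.
rewrite /bumpj ler_normr => /orP[z1|z1].
  by rewrite !sstepj_right ?subrr//; lra.
by rewrite !sstepj_left ?subrr//; lra.
Qed.

Lemma bumpj_bounded j : exists2 C : R, 1 <= C & forall x, `|bumpj j x| <= C.
Proof.
have [C C1 hC] := sstepj_bounded j; exists (C + C); first lra.
by move=> x; rewrite (le_trans (ler_normB _ _))// lerD.
Qed.

Lemma bumpj_sum j (B : nat) (z : R) : `|z| <= B%:R ->
  \sum_(q < B.*2.+1) bumpj j (z - (q%:R - B%:R)) = (j == 0%N)%:R.
Proof.
rewrite ler_norml => /andP[zB1 zB2].
pose G (q : nat) := - sstepj j (z + B%:R + 1 - q%:R).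
transitivity (\sum_(0 <= q < B.*2.+1) (G q.+1 - G q)).
  rewrite big_mkord; apply: eq_bigr => q _; rewrite /bumpj /G opprK [RHS]addrC.
  by congr (_ - _); congr (sstepj _); rewrite -?natr1; ring.
rewrite telescope_sumr// /G opprK.
rewrite sstepj_left; last by rewrite -natr1 -addnn natrD; lra.
by rewrite oppr0 add0r sstepj_right//; lra.
Qed.

Definition cutj j (z : R) : R := sstepj j (z + 1) - sstepj j (z - 1).

Lemma cutj_jet : is_jet cutj.
Proof.
have shift c : is_jet (fun j z => sstepj j (z + c)).
  move=> j x; have := jet_affine 1 c sstepj_jet j x; rewrite !expr1n !mul1r.
  suff -> : (fun x => 1 * sstepj j (1 * x + c)) = (fun x => sstepj j (x + c)) by [].
  by apply/funext => y; rewrite !mul1r.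
by move=> j x; apply: is_deriveB; exact: shift.
Qed.

Lemma cutj_mid j (z : R) : 0 <= z -> z <= 1 -> cutj j z = (j == 0%N)%:R.
Proof.
move=> z0 z1; rewrite /cutj sstepj_right; last lra.
by rewrite sstepj_left ?subr0//; lra.
Qed.

Lemma cutj_right j (z : R) : 2 <= z -> cutj j z = 0.
Proof. by move=> z1; rewrite /cutj !sstepj_right ?subrr//; lra. Qed.

Lemma cutj_left j (z : R) : z <= - 1 -> cutj j z = 0.
Proof. by move=> z1; rewrite /cutj !sstepj_left ?subrr//; lra. Qed.

Lemma cutj_bounded j : exists2 C : R, 1 <= C & forall x, `|cutj j x| <= C.
Proof.
have [C C1 hC] := sstepj_bounded j; exists (C + C); first lra.
by move=> x; rewrite (le_trans (ler_normB _ _))// lerD.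
Qed.

(** [H 0] is the antiderivative of order [k] of the smooth step that vanishes on the left, a
    smoothed truncated power. By the mean value theorem each integration costs exactly one factor
    [x], so that no constant appears in the bound. *)
Lemma primitive_jet (k : nat) : exists H : nat -> R -> R,
  [/\ is_jet H, forall j x, x <= 0 -> H j x = 0,
      forall j x, (j <= k)%N -> 0 <= x -> `|H j x| <= x ^+ (k - j)
    & H k.+1 = sstepj 1].
Proof.
elim: k => [|k [H [jH H0 Hb HE]]].
  exists sstepj; split; [exact: sstepj_jet|exact: sstepj_left| |by []].
  move=> [|//] x _ _; rewrite expr0 /sstepj /jet derive1n0.
  by rewrite ger0_norm ?sstep_le1 ?sstep_ge0.
have [F [dF F0]] := @antiderivative _ (H 0%N) (@jet_continuous _ _ 0%N jH) (H0 0%N).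
exists (fun j => if j is j'.+1 then H j' else F); split=> //.
- by case=> [|j] x; [exact: dF|exact: jH].
- by case=> [|j] x x0; [exact: F0|exact: H0].
- case=> [|j] x jk x0; last by rewrite subSS; exact: Hb.
  move: x0; rewrite le_eqVlt => /predU1P[<-|x0].
    by rewrite F0// normr0 exprn_ge0.
  have [c [c0 cx]] := MVT_jet dF x0.
  rewrite (F0 0)// !subr0 => ->; rewrite normrM (gtr0_norm x0) exprSr.
  rewrite ler_pM2r// (le_trans (Hb _ _ _ (ltW c0)))//= subn0.
  by rewrite lerXn2r ?nnegrE// ltW// (lt_trans c0).
Qed.

End step_functions.

(** * Directional derivatives and calculus of smooth functions of several variables *)

Section lines.
Context (R : realType) (n : nat).
Implicit Types (f g : 'rV[R]_n -> R) (x v : 'rV[R]_n).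

Lemma line_growth f x v (t : R) :
  (fun h : R => h^-1 *: (f ((h *: 1 + t) *: v + x) - f (t *: v + x))) =
  (fun h : R => h^-1 *: (f (h *: v + (t *: v + x)) - f (t *: v + x))).
Proof.
by apply/funext => h; rewrite addrA -scalerDl /GRing.scale/= mulr1.
Qed.

Lemma is_derive_line f x v (t d : R) : is_derive (t *: v + x) v f d ->
  is_derive t (1 : R) (fun h : R => f (h *: v + x)) d.
Proof.
move=> [df fE]; apply: DeriveDef.
  by rewrite /derivable/= line_growth; exact: df.
by rewrite -fE /derive/= line_growth.
Qed.

Lemma line_is_derive f x v (d : R) :
  is_derive (0 : R) (1 : R) (fun h : R => f (h *: v + x)) d -> is_derive x v f d.
Proof.
have E := line_growth f x v 0; rewrite scale0r add0r in E.
move=> [df fE]; apply: DeriveDef.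
  by move: df; rewrite /derivable/= scale0r add0r E.
by rewrite -fE /derive/= scale0r add0r E.
Qed.

Lemma is_deriveZ_dir f x v (c d : R) : is_derive x v f d ->
  is_derive x (c *: v) f (c * d).
Proof.
move=> fd; apply: line_is_derive; rewrite mulrC.
have -> : (fun h : R => f (h *: (c *: v) + x)) =
    (fun h : R => f (h *: v + x)) \o (fun h : R => c * h).
  by apply/funext => h /=; rewrite scalerA mulrC.
apply: is_derive1_comp.
  by apply: is_derive_line; rewrite mulr0 scale0r add0r.
by apply: is_derive_eq; rewrite /GRing.scale/= mulr1.
Qed.

(** The increment along [v + w] is a step along [w] followed by a step along [v]. The second one
    starts from a moving point; the mean value theorem and the continuity of [dv] handle it. *)
Lemma is_deriveD_dir f (dv dw : 'rV[R]_n -> R) x v w :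
  (forall y, is_derive y v f (dv y)) -> continuous dv ->
  (forall y, is_derive y w f (dw y)) -> is_derive x (v + w) f (dv x + dw x).
Proof.
move=> fv cdv fw.
suff lim0 : (h^-1 *: (f (h *: (v + w) + x) - f x)) @[h --> (0 : R)^'] --> dv x + dw x.
  apply: DeriveDef; first by apply/cvg_ex; exists (dv x + dw x).
  exact/cvg_lim.
have -> : (fun h : R => h^-1 *: (f (h *: (v + w) + x) - f x)) =
    (fun h => h^-1 *: (f (h *: v + (h *: w + x)) - f (h *: w + x))
              + h^-1 *: (f (h *: w + x) - f x)).
  apply/funext => h; rewrite -scalerDr [h *: (v + w)]scalerDr !addrA; congr (_ *: _).
  by rewrite subrK.
apply: cvgD; last first.
  by have [dfw <-] := fw x; exact: dfw.
apply/cvgrPdist_le => e e0.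
have /cvgrPdist_le/(_ e e0)/nbhs_ballP[/= r r0 hr] := cdv x.
have s0 : 0 < r / (`|v| + `|w| + 1) by rewrite divr_gt0// ltr_wpDl// addr_ge0.
near=> h.
have h0 : h != 0 by near: h; exact: nbhs_dnbhs_neq.
have hs : `|h| < r / (`|v| + `|w| + 1) by near: h; exact: dnbhs0_lt.
pose z := h *: w + x.
have dl (t : R) : is_derive t (1 : R) (fun s : R => f (s *: v + z)) (dv (t *: v + z)).
  exact: is_derive_line.
have [c [ch ->]] : exists c, `|c| <= `|h| /\
    h^-1 *: (f (h *: v + z) - f z) = dv (c *: v + z).
  move: h0; rewrite neq_lt => /orP[h0|h0].
    have [c [hc c0 cE]] := MVT_jet dl h0; exists c; split.
      by rewrite !ltr0_norm// lerN2 ltW.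
    move: cE; rewrite sub0r scale0r add0r => cE.
    by rewrite -[f (h *: v + z) - f z]opprB cE mulrN opprK /GRing.scale/= mulrC mulfK ?lt_eqF.
  have [c [c0 hc cE]] := MVT_jet dl h0; exists c; split.
    by rewrite !gtr0_norm// ltW.
  move: cE; rewrite subr0 scale0r add0r => ->.
  by rewrite /GRing.scale/= mulrC mulfK ?gt_eqF.
apply: hr; rewrite -ball_normE/= /z.
have -> : x - (c *: v + (h *: w + x)) = - (c *: v + h *: w).
  by rewrite addrA [- (_ + x)]opprD addrCA subrr addr0.
rewrite normrN (le_lt_trans (ler_normD _ _))// !normrZ.
apply: (@le_lt_trans _ _ (`|h| * (`|v| + `|w|))).
  by rewrite mulrDr lerD// ler_wpM2r.
move: hs; rewrite ltr_pdivlMr; last by rewrite ltr_wpDl// addr_ge0.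
by apply: le_lt_trans; rewrite ler_wpM2l// lerDl.
Unshelve. all: by end_near. Qed.

Lemma rV_continuousD f g : continuous f -> continuous g ->
  continuous (fun x => f x + g x).
Proof. by move=> cf cg x; exact: (cvgD (cf x) (cg x)). Qed.

Lemma rV_continuousM f g : continuous f -> continuous g ->
  continuous (fun x => f x * g x).
Proof. by move=> cf cg x; exact: (cvgM (cf x) (cg x)). Qed.

Lemma rV_continuous_sum (I : Type) (r : seq I) (F : I -> 'rV[R]_n -> R) :
  (forall i, continuous (F i)) -> continuous (fun x => \sum_(i <- r) F i x).
Proof.
move=> cF; elim: r => [|i r IHr].
  by under eq_fun do rewrite big_nil; exact: cst_continuous.
under eq_fun do rewrite big_cons; exact: rV_continuousD.
Qed.

Lemma rV_continuous_prod (I : Type) (r : seq I) (F : I -> 'rV[R]_n -> R) :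
  (forall i, continuous (F i)) -> continuous (fun x => \prod_(i <- r) F i x).
Proof.
move=> cF; elim: r => [|i r IHr].
  by under eq_fun do rewrite big_nil; exact: cst_continuous.
under eq_fun do rewrite big_cons; exact: rV_continuousM.
Qed.

Lemma rV_continuous_comp (h : R -> R) f : continuous h -> continuous f ->
  continuous (fun x => h (f x)).
Proof. by move=> ch cf x; exact: (@continuous_comp _ _ _ f h x (cf x) (ch _)). Qed.

End lines.

Section partials.
Context (R : realType) (n : nat).
Implicit Types (f g : 'rV[R]_n -> R) (x v : 'rV[R]_n).

Definition pd (i : 'I_n) f : 'rV[R]_n -> R :=
  fun x => 'D_(delta_mx ord0 i) f x.

Definition pds (s : seq 'I_n) f := foldr pd f s.

(** Partial derivatives are required along every word of directions, so that the symmetry of mixed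
    derivatives is never invoked. *)
Definition csmooth f := forall s,
  continuous (pds s f) /\ forall i x, derivable (pds s f) x (delta_mx ord0 i).

Lemma pds_cat s1 s2 f : pds (s1 ++ s2) f = pds s1 (pds s2 f).
Proof. by rewrite /pds foldr_cat. Qed.

Lemma csmooth_pds f s : csmooth f -> csmooth (pds s f).
Proof. by move=> sf s'; rewrite -pds_cat; exact: sf. Qed.

Lemma csmooth_continuous f : csmooth f -> continuous f.
Proof. by move=> /(_ [::])[]. Qed.

Lemma csmooth_is_derive f i x : csmooth f ->
  is_derive x (delta_mx ord0 i) f (pd i f x).
Proof. by move=> /(_ [::])[_ h]; exact/derivableP/h. Qed.

Lemma pdE f (df : 'rV[R]_n -> R) i :
  (forall x, is_derive x (delta_mx ord0 i) f (df x)) -> pd i f = df.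
Proof. by move=> h; apply/funext => x; exact: (@derive_val _ _ _ _ _ _ _ (h x)). Qed.

(* A family of continuous functions that is stable under differentiation. *)
Lemma csmooth_family (T : Type) (F : T -> 'rV[R]_n -> R) (d : 'I_n -> T -> T) :
  (forall t, continuous (F t)) ->
  (forall t i x, is_derive x (delta_mx ord0 i) (F t) (F (d i t) x)) ->
  forall t, csmooth (F t) /\ forall s, pds s (F t) = F (foldr d t s).
Proof.
move=> cF dF t; have E s : pds s (F t) = F (foldr d t s).
  by elim: s => //= i s ->; exact/pdE.
split=> // s; rewrite E; split=> [|i x]; first exact: cF.
exact: (@ex_derive _ _ _ _ _ _ _ (dF _ _ _)).
Qed.

Lemma is_derive_gradient f x v :
  (forall i, continuous (pd i f)) ->
  (forall i x, derivable f x (delta_mx ord0 i)) ->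
  is_derive x v f (\sum_i v ord0 i * pd i f x).
Proof.
move=> cf df; rewrite {1}(row_sum_delta v).
have cs (r : seq 'I_n) : continuous (fun x => \sum_(i <- r) v ord0 i * pd i f x).
  apply: rV_continuous_sum => i; apply: rV_continuousM => //.
  exact: cst_continuous.
elim: (index_enum _) x => [|i r IHr] x; first by rewrite !big_nil; exact: is_derive0.
rewrite !big_cons addrC [X in is_derive _ _ _ X]addrC.
apply: (@is_deriveD_dir _ _ _ _ (fun x => v ord0 i * pd i f x)) => //.
by move=> y; apply: is_deriveZ_dir; exact/derivableP/df.
Qed.

End partials.

Section smooth_algebra.
Context (R : realType) (n : nat).
Implicit Types (f g : 'rV[R]_n -> R) (x v : 'rV[R]_n) (s : seq 'I_n).
Local Notation e_ i := (delta_mx ord0 i).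

Lemma is_derive_bigsum (I : Type) (r : seq I) (F : I -> 'rV[R]_n -> R)
    (d : I -> R) x v :
  (forall i, is_derive x v (F i) (d i)) ->
  is_derive x v (fun y => \sum_(i <- r) F i y) (\sum_(i <- r) d i).
Proof.
move=> Fd; elim: r => [|i r IHr].
  rewrite big_nil; under eq_fun do rewrite big_nil; exact: is_derive_cst.
by rewrite big_cons; under eq_fun do rewrite big_cons; exact: is_deriveD.
Qed.

Lemma csmooth_sum (I : Type) (r : seq I) (F : I -> 'rV[R]_n -> R) :
  (forall i, csmooth (F i)) ->
  csmooth (fun x => \sum_(i <- r) F i x) /\
  forall s, pds s (fun x => \sum_(i <- r) F i x) =
    fun x => \sum_(i <- r) pds s (F i) x.
Proof.
move=> sF.
have [] := @csmooth_family R n (seq 'I_n)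
  (fun s x => \sum_(i <- r) pds s (F i) x) cons _ _ [::].
- by move=> s; apply: rV_continuous_sum => i; have [] := sF i s.
- by move=> s i x; apply: is_derive_bigsum => j; exact/csmooth_is_derive/csmooth_pds.
move=> ? h; split=> // s; rewrite h.
by congr (fun t x => \sum_(i <- r) pds t (F i) x); elim: s => //= i s ->.
Qed.

Lemma csmoothZ (c : R) f : csmooth f ->
  csmooth (fun x => c * f x) /\
  forall s, pds s (fun x => c * f x) = fun x => c * pds s f x.
Proof.
move=> sf.
have [] := @csmooth_family R n (seq 'I_n) (fun s x => c * pds s f x) cons _ _ [::].
- move=> s; apply: rV_continuousM; first exact: cst_continuous.
  by have [] := sf s.
- by move=> s i x; apply: is_deriveZ; exact/csmooth_is_derive/csmooth_pds.
move=> ? h; split=> // s; rewrite h.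
by congr (fun t x => c * pds t f x); elim: s => //= i s ->.
Qed.

Definition splits_step (i : 'I_n) (l : seq (seq 'I_n * seq 'I_n)) :=
  [seq (i :: p.1, p.2) | p <- l] ++ [seq (p.1, i :: p.2) | p <- l].

(* The ways of distributing the derivatives in [s] over the two factors of a
   product, in the Leibniz rule. *)
Definition splits s := foldr splits_step [:: ([::], [::])] s.

Lemma csmoothM f g : csmooth f -> csmooth g ->
  csmooth (fun x => f x * g x) /\
  forall s, pds s (fun x => f x * g x) =
    fun x => \sum_(p <- splits s) pds p.1 f x * pds p.2 g x.
Proof.
move=> sf sg.
have [] := @csmooth_family R n (seq (seq 'I_n * seq 'I_n))
  (fun l x => \sum_(p <- l) pds p.1 f x * pds p.2 g x) splits_step _ _
  [:: ([::], [::])].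
- move=> l; apply: rV_continuous_sum => p; apply: rV_continuousM.
    by have [] := sf p.1.
  by have [] := sg p.2.
- move=> l i x; rewrite big_cat !big_map/= -big_split/=.
  apply: is_derive_bigsum => p.
  have := @is_deriveM _ _ (pds p.1 f) (pds p.2 g) x (e_ i) _ _
    (csmooth_is_derive i x (csmooth_pds p.1 sf))
    (csmooth_is_derive i x (csmooth_pds p.2 sg)).
  by rewrite addrC /GRing.scale/= [pds p.2 g x * _]mulrC.
have -> : (fun x => \sum_(p <- [:: ([::], [::])]) pds p.1 f x * pds p.2 g x) =
    (fun x => f x * g x) by apply/funext => x; rewrite big_seq1.
by [].
Qed.

Lemma splits_size s p : p \in splits s -> (size p.1 + size p.2 = size s)%N.
Proof.
elim: s p => [|i s IHs] p /=; first by rewrite inE => /eqP ->.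
rewrite mem_cat => /orP[] /mapP[q qs ->] /=.
  by rewrite addSn IHs.
by rewrite addnS IHs.
Qed.

Lemma size_splits s : size (splits s) = (2 ^ size s)%N.
Proof. by elim: s => //= i s IHs; rewrite size_cat !size_map IHs addnn -mul2n expnS. Qed.

(** Isolates the Leibniz term in which all derivatives fall on the first factor, the one that
    [pde_estimate] keeps as its main term. *)
Lemma splits_head s : exists2 l, splits s = (s, [::]) :: l &
  forall p, p \in l -> (size p.1 < size s)%N.
Proof.
elim: s => [|i s [l sE hl]]; first by exists [::].
exists ([seq (i :: p.1, p.2) | p <- l] ++ [seq (p.1, i :: p.2) | p <- splits s]).
  by rewrite /= /splits_step {1}/splits -/(splits s) sE.
move=> p; rewrite mem_cat => /orP[] /mapP[q qs ->] /=; first by rewrite ltnS hl.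
by rewrite ltnS -(splits_size qs) leq_addr.
Qed.

Lemma pds_near_eq f g s x :
  (\forall y \near x, f y = g y) -> \forall y \near x, pds s f y = pds s g y.
Proof.
move=> fg; elim: s => //= i s /near_join; apply: filterS => y.
exact: near_eq_derive.
Qed.

Lemma pds_cst0 s : pds s (fun=> 0) = fun=> 0 :> R.
Proof.
elim: s => //= i s ->; apply: pdE => x; exact: is_derive_cst.
Qed.

Lemma pds_open0 f s (U : set 'rV[R]_n) : open U ->
  (forall x, U x -> f x = 0) -> forall x, U x -> pds s f x = 0.
Proof.
move=> oU f0 x Ux; have /(_ s) := @pds_near_eq f (fun=> 0) _ x.
rewrite pds_cst0 => /(_ _)/nbhs_singleton; apply.
by apply: filterS (open_nbhs_nbhs (conj oU Ux)) => y /f0.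
Qed.

Lemma pds_cube0 f s (K : R) :
  (forall x, K < `|x| -> f x = 0) -> forall x, K < `|x| -> pds s f x = 0.
Proof.
move=> f0; apply: pds_open0 => //.
apply: (@open_comp _ _ (fun x : 'rV[R]_n => `|x|) [set t | K < t]).
  by move=> x _; exact: norm_continuous.
exact: open_gt.
Qed.

Definition lam (b x : 'rV[R]_n) : R := \sum_i b ord0 i * x ord0 i.

Lemma lamD b x y : lam b (x + y) = lam b x + lam b y.
Proof. by rewrite -big_split; apply: eq_bigr => i _; rewrite mxE mulrDr. Qed.

Lemma lamZ b (c : R) x : lam b (c *: x) = c * lam b x.
Proof. by rewrite mulr_sumr; apply: eq_bigr => i _; rewrite mxE mulrCA. Qed.

Lemma lam_delta b i : lam b (e_ i) = b ord0 i.
Proof.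
rewrite /lam (bigD1 i)//= mxE !eqxx mulr1 big1 ?addr0// => j ji.
by rewrite mxE (negbTE ji) andbF mulr0.
Qed.

Lemma lam_continuous b : continuous (lam b).
Proof.
apply: rV_continuous_sum => i; apply: rV_continuousM; first exact: cst_continuous.
exact: coord_continuous.
Qed.

Lemma csmooth_lam (H : nat -> R -> R) (b : 'rV[R]_n) (c : R) : is_jet H ->
  csmooth (fun x => H 0 (lam b x + c)) /\
  forall s, pds s (fun x => H 0 (lam b x + c)) =
    fun x => (\prod_(i <- s) b ord0 i) * H (size s) (lam b x + c).
Proof.
move=> jH.
have [] := @csmooth_family R n (R * nat)
  (fun p x => p.1 * H p.2 (lam b x + c))
  (fun i p => (b ord0 i * p.1, p.2.+1)) _ _ (1, 0%N).
- move=> [a j] /=; apply: rV_continuousM; first exact: cst_continuous.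
  apply: rV_continuous_comp; first exact: jet_continuous.
  by apply: rV_continuousD; [exact: lam_continuous|exact: cst_continuous].
- move=> [a j] i x /=; rewrite mulrAC mulrC; apply: is_deriveZ.
  apply: line_is_derive.
  have -> : (fun h : R => H j (lam b (h *: e_ i + x) + c)) =
      (H j) \o (fun h : R => b ord0 i * h + (lam b x + c)).
    by apply/funext => h /=; rewrite lamD lamZ lam_delta mulrC addrA.
  rewrite mulrC; apply: is_derive1_comp; first by rewrite mulr0 add0r; exact: jH.
  by apply: is_derive_eq; rewrite /GRing.scale/= mulr1 addr0.
rewrite /=; have -> : (fun x => (1 : R) * H 0 (lam b x + c)) =
    (fun x => H 0 (lam b x + c)) by apply/funext => x; rewrite mul1r.
move=> ? h; split=> // s; rewrite h; apply/funext => x.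
suff -> : foldr (fun i p => (b ord0 i * p.1, p.2.+1)) (1, 0%N) s =
   (\prod_(i <- s) b ord0 i, size s) by [].
by elim: s => [|i s /= ->]; rewrite ?big_nil ?big_cons.
Qed.

Definition tens (G : 'I_n -> nat -> R -> R) (c : 'I_n -> nat) x : R :=
  \prod_i G i (c i) (x ord0 i).

Lemma csmooth_tens (G : 'I_n -> nat -> R -> R) : (forall i, is_jet (G i)) ->
  csmooth (tens G (fun=> 0)) /\
  forall s, pds s (tens G (fun=> 0)) = tens G (fun i => count_mem i s).
Proof.
move=> jG.
have [] := @csmooth_family R n ('I_n -> nat) (tens G)
  (fun i c => fun j => ((i == j) + c j)%N) _ _ (fun=> 0).
- move=> c; apply: rV_continuous_prod => i; apply: rV_continuous_comp.
    exact: jet_continuous.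
  exact: coord_continuous.
- move=> c i x; apply: line_is_derive.
  pose P := \prod_(j < n | j != i) G j (c j) (x ord0 j).
  have -> : (fun h : R => tens G c (h *: e_ i + x)) =
      (fun h => P * (G i (c i) \o (fun h : R => 1 * h + x ord0 i)) h).
    apply/funext => h; rewrite /tens (bigD1 i)//= mulrC; congr (_ * _).
      apply: eq_bigr => j ji; rewrite !mxE (negbTE ji) andbF mulr0 add0r//.
    by rewrite !mxE !eqxx mulr1 mul1r.
  have -> : tens G (fun j => ((i == j) + c j)%N) x =
      P * (G i (c i).+1 (1 * 0 + x ord0 i) * 1).
    rewrite /tens (bigD1 i)//= mulrC eqxx mul1r add0r mulr1; congr (_ * _).
    by apply: eq_bigr => j ji; rewrite eq_sym (negbTE ji).
  apply: is_deriveZ; apply: is_derive1_comp; first exact: jG.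
  by apply: is_derive_eq; rewrite /GRing.scale/= mulr1 addr0.
move=> ? h; split=> // s; rewrite h; congr tens; apply/funext => j.
by elim: s => //= i s ->.
Qed.

End smooth_algebra.

(** * Integration by parts against compactly supported functions *)

Section integration_by_parts.
Context (R : realType).
Implicit Types (n : nat).
Local Notation leb := (@lebesgue_measure R).
Local Notation mu n := (@lebesgue_rV R n).

Lemma cube_compact n (K : R) : compact (@cube R n K).
Proof.
have [K0|K0] := leP 0 K; last first.
  rewrite (_ : cube K = set0); first exact: compact0.
  apply/seteqP; split=> // x /= xK.
  by have := le_lt_trans (le_trans (normr_ge0 x) xK) K0; rewrite ltxx.
rewrite (_ : cube K = [set v : 'rV[R]_n | forall i, `[- K, K]%classic (v ord0 i)]).
  by apply: (@rV_compact R n (fun=> `[- K, K]%classic)) => i; exact: segment_compact.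
apply/seteqP; split=> x /=; rewrite /cube/= rV_norm_le//.
  by move=> /forallP xK i; rewrite /= in_itv/= -ler_norml.
by move=> xK; apply/forallP => i; have := xK i; rewrite /= in_itv/= -ler_norml.
Qed.

Lemma bounded_on_cube n (f : 'rV[R]_n -> R) (K : R) : continuous f ->
  exists2 C, 0 <= C & forall x, `|x| <= K -> `|f x| <= C.
Proof.
move=> cf; have [K0|K0] := leP 0 K; last first.
  exists 0 => // x xK.
  by have := le_lt_trans (le_trans (normr_ge0 x) xK) K0; rewrite ltxx.
have cn : {within cube K, continuous (fun x => `|f x|)}.
  by apply: continuous_subspaceT; apply: (rV_continuous_comp _ cf); exact: norm_continuous.
have cube0 : @cube R n K 0 by rewrite /cube/= normr0.
have [c _ hc] := @EVT_max_rV R n (fun x => `|f x|) (cube K)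
  (ex_intro _ _ cube0) (@cube_compact n K) cn.
by exists `|f c| => // x xK; apply: hc; rewrite inE.
Qed.

Lemma bounded_cube_support n (f : 'rV[R]_n -> R) (K : R) : continuous f ->
  (forall x, K < `|x| -> f x = 0) -> exists2 C, 0 <= C & forall x, `|f x| <= C.
Proof.
move=> cf f0; have [C C0 hC] := bounded_on_cube K cf.
exists C => // x; have [xK|/f0 ->] := leP `|x| K; first exact: hC.
by rewrite normr0.
Qed.

Lemma integrable_continuous_cube n (f : 'rV[R]_n -> R) (K : R) : 0 <= K ->
  continuous f -> (forall x, K < `|x| -> f x = 0) ->
  (mu n).-integrable setT (EFin \o f).
Proof.
move=> K0 cf f0; have [C C0 hC] := bounded_cube_support cf f0.
apply: (integrable_on_cube K0 _ hC f0); exact: rV_continuous_measurable.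
Qed.

Lemma rV_cons_line n (x : R) (y : 'rV[R]_n) :
  rV_cons (x, y) = x *: delta_mx ord0 ord0 + rV_cons (0, y).
Proof.
apply/rowP => j; rewrite [RHS]mxE [X in _ = X + _]mxE [X in _ = _ * X + _]mxE.
case: (unliftP ord0 j) => [i ->|->].
  by rewrite !rV_consES /= mulr0 add0r.
by rewrite !rV_consE0 !eqxx mulr1 addr0.
Qed.

Lemma rV_cons_shift n (x h : R) (y : 'rV[R]_n) (j : 'I_n) :
  rV_cons (x, h *: delta_mx ord0 j + y) =
  h *: delta_mx ord0 (lift ord0 j) + rV_cons (x, y).
Proof.
apply/rowP => k; rewrite [RHS]mxE [X in _ = X + _]mxE [X in _ = _ * X + _]mxE.
case: (unliftP ord0 k) => [i ->|->].
  rewrite !rV_consES [LHS]mxE; congr (_ + _).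
  by rewrite [LHS]mxE [X in _ * X = _]mxE (inj_eq lift_inj).
by rewrite !rV_consE0 /= mulr0 add0r.
Qed.

Lemma rV_cons_continuous n (x : R) : continuous (fun y : 'rV[R]_n => rV_cons (x, y)).
Proof.
move=> y.
suff h (e : R) : 0 < e ->
    \forall z \near nbhs y, `|rV_cons (x, y) - rV_cons (x, z)| <= e.
  exact: (cvgrPdist_le _ _).2 h.
move=> e0; apply/nbhs_ballP; exists e => // z; rewrite -ball_normE/= => yz.
rewrite rV_norm_le ?(ltW e0)//; apply/forallP => i; rewrite mxE [X in _ + X]mxE.
case: (unliftP ord0 i) => [j ->|->].
  rewrite !rV_consES.
  have := rV_coord_le (y - z) j; rewrite mxE [X in _ + X]mxE => /le_trans; apply.
  exact: ltW.
by rewrite !rV_consE0 subrr normr0 ltW.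
Qed.

Lemma rV_cons_continuous1 n (y : 'rV[R]_n) : continuous (fun x : R => rV_cons (x, y)).
Proof.
have -> : (fun x : R => rV_cons (x, y)) =
    (fun x => x *: delta_mx ord0 ord0 + rV_cons (0, y)).
  by apply/funext => x; exact: rV_cons_line.
move=> x; exact: (cvgD (cvgZr_tmp cvg_id) (cvg_cst _)).
Qed.

Lemma integral_line0 (u du : R -> R) (K : R) : 0 <= K ->
  (forall x : R, is_derive x (1 : R) u (du x)) -> continuous du ->
  (forall x, K < `|x| -> u x = 0) -> (\int[leb]_x (du x)%:E = 0)%E.
Proof.
move=> K0 dE cdu u0.
have du0 x : K + 1 < `|x| -> du x = 0.
  move=> xK; rewrite -(@derive_val _ _ _ _ _ _ _ (dE x)).
  rewrite (@near_eq_derive _ _ _ _ (cst 0)) ?derive_cst//.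
  near=> y; apply: u0.
  have : `|x - y| < 1 by near: y; exact: cvgr_dist_lt.
  have := ler_normD (x - y) y; rewrite subrK; lra.
have cu := is_derive_continuous dE.
rewrite (_ : (fun x => (du x)%:E) = ((EFin \o du) \_ `[(- (K + 1))%R, (K + 1)%R])); last first.
  apply/funext => x; rewrite patchE; case: ifPn => //.
  rewrite notin_setE/= in_itv/= -ler_norml => /negP.
  by rewrite -ltNge => /du0 ->.
rewrite -integral_mkcond (@continuous_FTC2 _ du u)//.
- by rewrite !u0 ?subee//; [rewrite normrN ger0_norm; lra|rewrite ger0_norm; lra].
- lra.
- exact: continuous_subspaceT.
- split; [by move=> x _; exact: (@ex_derive _ _ _ _ _ _ _ (dE x))| |].
    by apply: cvg_at_right_filter; exact: cu.
  by apply: cvg_at_left_filter; exact: cu.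
- by move=> x _; rewrite derive1E (@derive_val _ _ _ _ _ _ _ (dE x)).
Unshelve. all: by end_near. Qed.

(** By Fubini: for the first coordinate the inner integral is [integral_line0]; for the others the
    slices fall under the induction hypothesis. *)
Lemma integral_pd0 n (i : 'I_n) (u du : 'rV[R]_n -> R) (K : R) : 0 <= K ->
  (forall x, is_derive x (delta_mx ord0 i) u (du x)) -> continuous du ->
  (forall x, K < `|x| -> u x = 0) -> (\int[mu n]_x (du x)%:E = 0)%E.
Proof.
move=> K0; elim: n => [|n IHn] in i u du *; first by case: i.
move=> dE cdu u0.
have du0 x : K < `|x| -> du x = 0.
  move=> xK; rewrite -(pdE dE).
  exact: (@pds_cube0 _ _ u [:: i] K u0).
have idu := integrable_continuous_cube K0 cdu du0.
have out x y : K < `|x| \/ K < `|y| -> u (rV_cons (x, y)) = 0.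
  move=> h; apply: u0; rewrite ltNge rV_norm_cons// negb_and -!ltNge.
  by apply/orP.
case: (unliftP ord0 i) => [j|] ij.
  rewrite integral_rVS//; apply: integral0_eq => x _.
  apply: (IHn j (fun y => u (rV_cons (x, y)))) => [y| |y yK].
  - apply: line_is_derive.
    under eq_fun do rewrite rV_cons_shift -ij.
    by apply: is_derive_line; rewrite scale0r add0r.
  - by move=> y; apply: (@continuous_comp _ _ _ (fun y => rV_cons (x, y)) du);
     [exact: rV_cons_continuous|exact: cdu].
  - by apply: out; right.
rewrite integral_rVS'//; apply: integral0_eq => y _.
apply: (@integral_line0 (fun x => u (rV_cons (x, y))) _ K) => //.
- move=> x; under eq_fun do rewrite rV_cons_line -ij.
  by rewrite (rV_cons_line x y) -ij; exact: is_derive_line.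
- by move=> x; apply: (@continuous_comp _ _ _ (fun x => rV_cons (x, y)) du);
   [exact: rV_cons_continuous1|exact: cdu].
- by move=> x xK; apply: out; left.
Qed.

Lemma integral_pdM n (i : 'I_n) (g chi : 'rV[R]_n -> R) (K : R) : 0 <= K ->
  csmooth g -> csmooth chi -> (forall x, K < `|x| -> chi x = 0) ->
  (\int[mu n]_x (pd i g x * chi x)%:E = - \int[mu n]_x (g x * pd i chi x)%:E)%E.
Proof.
move=> K0 sg sc c0.
have cg := csmooth_continuous sg; have cc := csmooth_continuous sc.
have cpg : continuous (pd i g) by have [] := sg [:: i].
have cpc : continuous (pd i chi) by have [] := sc [:: i].
have pc0 x : K < `|x| -> pd i chi x = 0.
  exact: (@pds_cube0 _ _ chi [:: i] K c0).
have c1 := rV_continuousM cg cpc; have c2 := rV_continuousM cpg cc.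
have i1 : (mu n).-integrable setT (EFin \o (fun x => g x * pd i chi x)).
  by apply: (integrable_continuous_cube K0 c1) => x /pc0 ->; rewrite mulr0.
have i2 : (mu n).-integrable setT (EFin \o (fun x => pd i g x * chi x)).
  by apply: (integrable_continuous_cube K0 c2) => x /c0 ->; rewrite mulr0.
have h : (\int[mu n]_x (g x * pd i chi x + pd i g x * chi x)%:E = 0)%E.
  apply: (@integral_pd0 n i (fun x => g x * chi x) _ K) => //.
  - move=> x; have := @is_deriveM _ _ g chi x (delta_mx ord0 i) _ _
      (csmooth_is_derive i x sg) (csmooth_is_derive i x sc).
    by rewrite /GRing.scale/= [chi x * _]mulrC.
  - exact: rV_continuousD.
  - by move=> x /c0 ->; rewrite mulr0.
have E : (\int[mu n]_x (g x * pd i chi x)%:E + \int[mu n]_x (pd i g x * chi x)%:E = 0)%E.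
  by rewrite -integralD.
have fa := integrable_fin_num measurableT i1.
have fb := integrable_fin_num measurableT i2.
rewrite /comp in fa fb; move: E; rewrite -(fineK fa) -(fineK fb) -EFinD => -[E].
by rewrite -EFinN; congr EFin; lra.
Qed.

(** Each integration by parts moves the outermost derivative of [g] innermost onto [chi], which
    reverses the list; keeping [rev] dispenses with commuting derivatives. *)
Lemma integral_pdsM n (s : seq 'I_n) (g chi : 'rV[R]_n -> R) (K : R) : 0 <= K ->
  csmooth g -> csmooth chi -> (forall x, K < `|x| -> chi x = 0) ->
  (\int[mu n]_x (pds s g x * chi x)%:E =
    ((-1) ^+ size s)%:E * \int[mu n]_x (g x * pds (rev s) chi x)%:E)%E.
Proof.
move=> K0 sg; elim: s chi => [|i s IHs] chi sc c0; first by rewrite mul1e.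
rewrite (integral_pdM i K0 (csmooth_pds s sg) sc c0) IHs; last 2 first.
- exact: (csmooth_pds [:: i]).
- exact: (@pds_cube0 _ _ chi [:: i] K c0).
by rewrite rev_cons -cats1 pds_cat /= exprS mulN1r EFinN mulNe.
Qed.

End integration_by_parts.

(** * Discrete mollification of functions of the last [m] coordinates *)

Section mollification.
Context (R : realType) (m : nat).
Implicit Types (s : seq 'I_m.+1).

Definition tail (x : 'rV[R]_m.+1) : 'rV[R]_m := \row_j x ord0 (lift ord0 j).

Lemma bumpj_uniform k : exists2 C : R, 1 <= C &
  forall j (z : R), (j <= k)%N -> `|bumpj j z| <= C.
Proof.
elim: k => [|k [C C1 hC]].
  have [C C1 hC] := @bumpj_bounded R 0; exists C => // j z.
  by rewrite leqn0 => /eqP ->.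
have [C' C'1 hC'] := @bumpj_bounded R k.+1; exists (C + C'); first lra.
move=> j z; rewrite leq_eqVlt => /predU1P[->|].
  by rewrite (le_trans (hC' z))// lerDr; lra.
by rewrite ltnS => jk; rewrite (le_trans (hC j z jk))// lerDl; lra.
Qed.

(* The majorant [T (z + 1) - T (z - 2)] of the indicator of ]-1, 1[, with [T]
   the Heaviside function, telescopes. *)
Lemma bumpj_overlap (j N : nat) (C w : R) : 0 <= C ->
  (forall z, `|bumpj j z| <= C) ->
  \sum_(q < N) `|bumpj j (w - q%:R)| <= C *+ 3.
Proof.
move=> C0 hC; pose T (q : nat) : R := (0 <= w - q%:R + 1)%R%:R.
have T01 q : 0 <= T q <= 1 by rewrite /T; case: (0 <= w - _ + 1); rewrite ?lexx ?ler01.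
have le1 (q : 'I_N) : `|bumpj j (w - q%:R)| <= C * (T q - T (q.+3)).
  have [z1|z1] := leP 1 `|w - q%:R|.
    rewrite bumpj_out// normr0 mulr_ge0// subr_ge0 /T ler_nat.
    case: (leP 0 (w - q%:R + 1)) => h; first exact: leq_b1.
    by rewrite leqn0 eqb0 -ltNge -!natr1; lra.
  rewrite (le_trans (hC _))// ler_peMr//.
  move: z1; rewrite ltr_norml => /andP[z1 z2]; rewrite /T.
  rewrite (_ : (0 <= w - q%:R + 1) = true); last lra.
  rewrite (_ : (0 <= w - q.+3%:R + 1) = false) ?subr0//.
  by apply/negbTE; rewrite -ltNge -!natr1; lra.
rewrite (le_trans (ler_sum _ (fun q _ => le1 q)))// -mulr_sumr -mulr_natr.
rewrite ler_wpM2l//.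
rewrite (eq_bigr (fun q : 'I_N => (T q - T q.+1) + (T q.+1 - T q.+2) + (T q.+2 - T q.+3))); last first.
  by move=> q _; ring.
rewrite big_split big_split/=.
have tel r : \sum_(q < N) (T (q + r)%N - T (q + r).+1) <= 1.
  rewrite -(big_mkord xpredT (fun q => T (q + r)%N - T (q + r).+1)).
  rewrite -[X in X <= _]opprK -sumrN.
  rewrite (eq_bigr (fun q => T (q.+1 + r)%N - T (q + r)%N)); last first.
    by move=> q _; rewrite opprB addSn.
  rewrite (telescope_sumr (fun q => T (q + r)%N))// opprB.
  by have := T01 (0 + r)%N; have := T01 (N + r)%N; lra.
have t2 : \sum_(q < N) (T q.+2 - T q.+3) <= 1.
  by have := tel 2%N; under eq_bigr do rewrite addn2.
have t1 : \sum_(q < N) (T q.+1 - T q.+2) <= 1.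
  by have := tel 1%N; under eq_bigr do rewrite addn1.
have t0 : \sum_(q < N) (T q - T q.+1) <= 1.
  by have := tel 0%N; under eq_bigr do rewrite addn0.
by lra.
Qed.

Variables (sg : R) (sg0 : 0 < sg) (B : nat).
Notation box := {ffun 'I_m -> 'I_B.*2.+1}.

Definition node (q : box) : 'rV[R]_m := \row_j (sg * ((q j)%:R - B%:R)).

(** The factor of the variable [ord0] is a constant jet: the mollifier depends only on the last [m]
    coordinates, which parametrise the hyperplanes. *)
Definition mollj (q : box) (i : 'I_m.+1) (j : nat) (z : R) : R :=
  if unlift ord0 i is Some i' then
    sg^-1 ^+ j * bumpj j (sg^-1 * z + (B%:R - (q i')%:R))
  else (j == 0)%:R.

Definition mollifier (q : box) : 'rV[R]_m.+1 -> R := tens (mollj q) (fun=> 0).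

Definition bprod (q : box) (c : 'I_m -> nat) (y : 'rV[R]_m) : R :=
  \prod_j bumpj (c j) (y ord0 j / sg + B%:R - (q j)%:R).

Lemma mollj_jet q i : is_jet (mollj q i).
Proof.
rewrite /mollj => j x; case: (unlift ord0 i) => [i'|].
  exact: (jet_affine sg^-1 (B%:R - (q i')%:R) (@bumpj_jet R)).
exact: is_derive_cst.
Qed.

Lemma csmooth_mollifier q : csmooth (mollifier q) /\
  forall s, pds s (mollifier q) = fun x =>
    (ord0 \notin s)%:R * (sg^-1 ^+ size s *
      bprod q (fun j => count_mem (lift ord0 j) s) (tail x)).
Proof.
have [sm E] := csmooth_tens (mollj_jet q); split=> // s.
rewrite E; apply/funext => x; rewrite /tens big_ord_recl /mollj unlift_none.
rewrite -[in LHS]leqn0 leqNgt -has_count has_pred1.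
case: (boolP (ord0 \in s)) => s0; first by rewrite !mul0r.
rewrite !mul1r /=; under eq_bigr do rewrite liftK.
rewrite big_split/= prodrXr; congr (_ ^+ _ * _).
  have -> : size s = (\sum_(i < m.+1) count_mem i s)%N.
    elim: s {s0} => [|i s IHs] /=; first by rewrite big1.
    rewrite big_split/= -IHs (bigD1 i)//= eqxx big1 ?addn0// => j ji.
    by rewrite eq_sym (negbTE ji).
  by rewrite big_ord_recl; move/count_memPn: s0 => ->.
apply: eq_bigr => j _; congr (bumpj _ _).
by rewrite mxE mulrC addrA.
Qed.

Lemma bprod_abs_sum (c : 'I_m -> nat) y (C : R) : 0 <= C ->
  (forall j z, `|bumpj (c j) z| <= C) ->
  \sum_(q : box) `|bprod q c y| <= (C *+ 3) ^+ m.
Proof.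
move=> C0 hC; under eq_bigr do rewrite normr_prod.
rewrite -(bigA_distr_bigA (fun j (q : 'I_B.*2.+1) =>
  `|bumpj (c j) (y ord0 j / sg + B%:R - q%:R)|)).
rewrite -[X in _ <= _ ^+ X](card_ord m) -prodr_const ler_prod// => j _.
by rewrite sumr_ge0//= bumpj_overlap.
Qed.

Lemma bprod_sum (c : 'I_m -> nat) (y : 'rV[R]_m) : (forall j, `|y ord0 j / sg| <= B%:R) ->
  \sum_(q : box) bprod q c y = [forall j, c j == 0%N]%:R.
Proof.
move=> yB; rewrite -(bigA_distr_bigA (fun j (q : 'I_B.*2.+1) =>
  bumpj (c j) (y ord0 j / sg + B%:R - q%:R))).
under eq_bigr => j _.
  under eq_bigr do rewrite -[_ + _ - _]addrA -[B%:R - _]opprB.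
  rewrite bumpj_sum//; over.
rewrite /=; case: forallP => [h|h]; first by rewrite big1// => j _; rewrite h.
suff [j cj] : exists j, c j != 0%N by rewrite (bigD1 j)//= (negbTE cj) mul0r.
apply: contrapT => hn; apply: h => j.
by apply: contraT => cj; exfalso; apply: hn; exists j.
Qed.

Lemma bprod_far q c y : sg < `|y - node q| -> bprod q c y = 0.
Proof.
move=> h; have [j hj] : exists j, sg < `|(y - node q) ord0 j|.
  apply: contrapT => hn; move: h; rewrite ltNge rV_norm_le ?ltW//.
  move=> /negP; apply; apply/forallP => j; rewrite leNgt; apply/negP => hj.
  by apply: hn; exists j.
rewrite /bprod (bigD1 j)//= bumpj_out ?mul0r//.
move: hj; rewrite !mxE => hj.
have -> : y ord0 j / sg + B%:R - (q j)%:R = (y ord0 j - sg * ((q j)%:R - B%:R)) / sg.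
  by field; rewrite gt_eqF.
by rewrite normrM normfV (gtr0_norm sg0) ler_pdivlMr// mul1r ltW.
Qed.

(** In place of a convolution, a finite sum of bumps weighted by the values of [psi] at the grid
    nodes: [psi] need not be differentiable and every derivative is a finite sum. *)
Definition mollified (psi : 'rV[R]_m -> R) (x : 'rV[R]_m.+1) : R :=
  \sum_(q : box) psi (node q) * mollifier q x.

Lemma csmooth_mollified psi : csmooth (mollified psi) /\
  forall s, pds s (mollified psi) = fun x => (ord0 \notin s)%:R * (sg^-1 ^+ size s *
    \sum_(q : box) psi (node q) *
      bprod q (fun j => count_mem (lift ord0 j) s) (tail x)).
Proof.
have sq q : csmooth (fun x => psi (node q) * mollifier q x).
  by have [] := csmoothZ (psi (node q)) (csmooth_mollifier q).1.
have [sm E] := csmooth_sum (index_enum box) sq; split=> // s.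
rewrite E; apply/funext => x; rewrite !mulr_sumr; apply: eq_bigr => q _.
have [_ ->] := csmoothZ (psi (node q)) (csmooth_mollifier q).1.
by have [_ ->] := csmooth_mollifier q; ring.
Qed.

Variables (psi : 'rV[R]_m -> R) (K : R).
Hypothesis psi0 : forall y, K < `|y| -> psi y = 0.
Hypothesis KB : K + sg <= B%:R * sg.

Lemma psi_bprod_far q c y : K + sg < `|y| -> psi (node q) * bprod q c y = 0.
Proof.
move=> yK; have [nK|/psi0 ->] := leP `|node q| K; last by rewrite mul0r.
rewrite bprod_far ?mulr0//.
by have := ler_normD (y - node q) (node q); rewrite subrK; lra.
Qed.

Lemma mollified_support s x : K + sg < `|tail x| -> pds s (mollified psi) x = 0.
Proof.
move=> xK; have [_ ->] := csmooth_mollified psi.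
by rewrite big1 ?mulr0// => q _; exact: psi_bprod_far.
Qed.

Lemma mollified_bound (k : nat) (C Phi : R) s x : 0 <= C -> 0 <= Phi ->
  (forall j (z : R), (j <= k)%N -> `|bumpj j z| <= C) ->
  (forall y, `|psi y| <= Phi) -> (size s <= k)%N ->
  `|pds s (mollified psi) x| <= (C *+ 3) ^+ m * Phi * sg^-1 ^+ size s.
Proof.
move=> C0 Phi0 hC hPhi sk; have [_ ->] := csmooth_mollified psi.
have sg1 : 0 <= sg^-1 ^+ size s by rewrite exprn_ge0// invr_ge0 ltW.
rewrite normrM normrM (ger0_norm sg1) normr_nat.
apply: (@le_trans _ _ (1 * (sg^-1 ^+ size s * (Phi * (C *+ 3) ^+ m)))); last first.
  by rewrite mul1r mulrC [Phi * _]mulrC.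
apply: ler_pM => //; [by rewrite mulr_ge0|by rewrite lern1 leq_b1|].
rewrite ler_wpM2l// (le_trans (ler_norm_sum _ _ _))//.
apply: (@le_trans _ _ (\sum_(q : box) Phi *
    `|bprod q (fun j => count_mem (lift ord0 j) s) (tail x)|)).
  by apply: ler_sum => q _; rewrite normrM ler_wpM2r.
rewrite -mulr_sumr ler_wpM2l// bprod_abs_sum// => j z; apply: hC.
by rewrite (leq_trans (count_size _ _)).
Qed.

(** Where [|tail x| <= K + sg], a region covered by the grid thanks to [KB], the bumps sum to [1]
    and their derivatives to [0]. So [psi (tail x)] can be subtracted from every nodal value, and
    only nodes within [sg] of [tail x] contribute. The factor [C *+ 3] per coordinate bounds the
    overlap of the bumps. *)
Lemma mollified_approx (k : nat) (C h : R) s x : 0 <= C -> 0 <= h ->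
  (forall j (z : R), (j <= k)%N -> `|bumpj j z| <= C) ->
  (forall y y', `|y - y'| <= sg -> `|psi y - psi y'| <= h) -> (size s <= k)%N ->
  `|pds s (mollified psi) x - (s == [::])%:R * psi (tail x)|
    <= (C *+ 3) ^+ m * h * sg^-1 ^+ size s.
Proof.
move=> C0 h0 hC hh sk.
have sg1 : 0 <= sg^-1 ^+ size s by rewrite exprn_ge0// invr_ge0 ltW.
have C3 : 0 <= (C *+ 3) ^+ m by rewrite exprn_ge0// mulrn_wge0.
have [xK|xK] := leP `|tail x| (K + sg); last first.
  have xK' : K < `|tail x| by apply: lt_trans xK; rewrite ltrDl.
  rewrite mollified_support// (psi0 xK').
  by rewrite mulr0 subr0 normr0 !mulr_ge0.
have [_ ->] := csmooth_mollified psi.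
pose c j := count_mem (lift ord0 j) s.
have sum1 : \sum_(q : box) bprod q c (tail x) = [forall j, c j == 0%N]%:R.
  apply: bprod_sum => j; rewrite normrM normfV (gtr0_norm sg0) ler_pdivrMr//.
  exact: le_trans (le_trans (rV_coord_le _ _) xK) KB.
have s0 : (s == [::])%:R = (ord0 \notin s)%:R * [forall j, c j == 0%N]%:R :> R.
  rewrite -natrM mulnb; congr (_%:R)%R; congr nat_of_bool.
  apply/eqP/andP => [s0|[]]; first by rewrite /c s0; split=> //; exact/forallP.
  rewrite /c => s0 /forallP sj; case: s {sk sg1 sum1 c} s0 sj => // i s /=; case: (unliftP ord0 i) => [j ->|->].
    by move=> _ /(_ j); rewrite eqxx.
  by rewrite inE eqxx.
have -> : (s == [::])%:R = (ord0 \notin s)%:R * (sg^-1 ^+ size s * \sum_(q : box) bprod q c (tail x)).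
  rewrite sum1; case: eqP s0 => [->|_] s0; first by rewrite expr0 mul1r.
  by rewrite mulrCA -s0 mulr0.
rewrite -(mulrA (_%:R)) -mulrBr -[X in _ - X]mulrA -mulrBr mulr_suml -sumrB.
rewrite normrM normrM.
rewrite (ger0_norm sg1) normr_nat.
apply: (@le_trans _ _ (1 * (sg^-1 ^+ size s * (h * (C *+ 3) ^+ m)))); last first.
  by rewrite mul1r mulrC [h * _]mulrC.
apply: ler_pM => //; [by rewrite mulr_ge0|by rewrite lern1 leq_b1|].
rewrite ler_wpM2l// (le_trans (ler_norm_sum _ _ _))//.
apply: (@le_trans _ _ (\sum_(q : box) h * `|bprod q c (tail x)|)).
  apply: ler_sum => q _; rewrite [psi _ * _]mulrC -mulrBr normrM mulrC.
  have [nq|nq] := leP `|tail x - node q| sg.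
    by rewrite ler_wpM2r// hh// distrC.
  by rewrite bprod_far// normr0 !mulr0.
rewrite -mulr_sumr ler_wpM2l// bprod_abs_sum// => j z; apply: hC.
by rewrite (leq_trans (count_size _ _)).
Qed.

End mollification.

(** * Testing the equation near a hyperplane *)

Section pde.
Context (R : realType) (n : nat).
Implicit Types (s : seq 'I_n).
Local Notation mu := (@lebesgue_rV R n).

(** A multi-index spelled out as a word of directions, the form on which [pds] and the Leibniz rule
    operate. *)
Definition mlist k (a : multiindex n k) : seq 'I_n :=
  flatten [seq nseq (val a i) i | i <- enum 'I_n].

Lemma size_mlist k (a : multiindex n k) : size (mlist a) = k.
Proof.
rewrite size_flatten /shape -map_comp sumnE big_map big_enum /=.
by rewrite -[RHS](eqP (valP a)); apply: eq_bigr => i _; rewrite size_nseq.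
Qed.

Lemma foldr_mlist (T : Type) (d : 'I_n -> T -> T) k (a : multiindex n k) (f : T) :
  foldr (fun i => iter (val a i) (d i)) f (enum 'I_n) = foldr d f (mlist a).
Proof.
rewrite /mlist; elim: (enum 'I_n) => //= i r ->; rewrite foldr_cat.
by elim: (nat_of_ord _) => //= j ->.
Qed.

Lemma prod_mlist k (a : multiindex n k) (b : 'rV[R]_n) :
  \prod_(i <- mlist a) b ord0 i = \prod_i b ord0 i ^+ val a i.
Proof.
rewrite big_flatten big_map big_enum; apply: eq_bigr => i _.
by rewrite big_nseq iter_mulr_1.
Qed.

Lemma integral_dominated (f h : 'rV[R]_n -> R) (c M : R) : 0 <= c ->
  measurable_fun setT f -> measurable_fun setT h ->
  (forall x, `|f x| <= c * h x) -> (\int[mu]_x (h x)%:E = M%:E)%E ->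
  (forall x, 0 <= h x) ->
  (`|\int[mu]_x (f x)%:E| <= (c * M)%:E)%E.
Proof.
move=> c0 mf mh fh hM h0.
apply: (le_trans (le_abse_integral _ _ _)) => //; first exact/measurable_EFinP.
apply: (@le_trans _ _ (\int[mu]_x (c%:E * (h x)%:E))%E).
  apply: ge0_le_integral => //.
  - by do 2 apply: measurableT_comp => //.
  - by under eq_fun do rewrite -EFinM; apply/measurable_EFinP; exact: measurable_funM.
  - by move=> x _ /=; rewrite lee_fin.
rewrite ge0_integralZl//; first by rewrite hM EFinM.
- exact/measurable_EFinP.
- by move=> x _; rewrite lee_fin.
Qed.

(* The test function is [P 0 (lam b x - t) * W x]: the derivatives of [P] of
   order at most [k] grow polynomially at the rate [z ^+ (k - j)], so that when
   [W] varies at scale [sg] all terms of the Leibniz expansion are [O(B / sg)]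
   except the one where all the derivatives fall on [P]. *)
Lemma pde_estimate k (b : 'rV[R]_n) : exists2 C : R, 0 < C &
  forall (P : nat -> R -> R) (g : multiindex n k.+1 -> 'rV[R]_n -> R)
    (h W : 'rV[R]_n -> R) (M K B t sg : R),
  is_jet P -> (forall j z, z <= 0 -> P j z = 0) ->
  (forall j z, (j <= k)%N -> 0 <= z -> `|P j z| <= z ^+ (k - j)) ->
  (forall a, csmooth (g a)) ->
  (forall x, \sum_a pds (mlist a) (g a) x = 0) ->
  continuous h -> (forall x, 0 <= h x) -> (forall a x, `|g a x| <= h x) ->
  (\int[mu]_x (h x)%:E = M%:E)%E ->
  csmooth W -> 0 <= K -> (forall x, K < `|x| -> W x = 0) ->
  0 < sg -> 0 <= B -> (forall x, sg *+ 2 < lam b x - t -> W x = 0) ->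
  (forall s x, (size s <= k.+1)%N -> `|pds s W x| <= B * sg^-1 ^+ size s) ->
  (`| \int[mu]_x ((\sum_a (\prod_(i <- mlist a) b ord0 i) * g a x) *
       (P k.+1 (lam b x - t) * W x))%:E | <= (C * B * sg^-1 * M)%:E)%E.
Proof.
pose be : R := 1 + `|b|.
have be1 : 1 <= be by rewrite lerDl.
pose N := #|{: multiindex n k.+1}|%:R : R.
(* [2 ^+ k.+1] counts the Leibniz terms, [be ^+ k.+1] bounds the products of coordinates of [b], and
   [2 ^+ k] comes from inserting [z <= sg *+ 2] in the bound on [P]. *)
pose D : R := (2 ^+ k.+1) * be ^+ k.+1 * 2 ^+ k.
have D0 : 0 < D by rewrite !mulr_gt0// exprn_gt0//; lra.
exists (N * D + 1); first by rewrite ltr_wpDl// mulr_ge0// ltW.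
move=> P g h W M K B t sg jP P0 Pb sg_ g0 ch h0 gh hM sW K0 W0 sg0 B0 Wt Wb.
pose u x := P 0%N (lam b x - t).
have [su uE] := csmooth_lam b (- t) jP; rewrite -/(u) in su uE.
have cx := csmoothM su sW; set chi := (fun x => _ * W x) in cx.
have [sx xE] := cx.
have chi0 x : K < `|x| -> chi x = 0 by move=> /W0; rewrite /chi => ->; rewrite mulr0.
have prodb s : `|\prod_(i <- s) b ord0 i| <= be ^+ size s.
  elim: s => [|i s IHs]; first by rewrite big_nil normr1 expr0.
  rewrite big_cons normrM /= exprS ler_pM//.
  by rewrite (le_trans (rV_coord_le b i))// lerDr.
(* The Leibniz expansion deprived of its leading term. *)
pose E (a : multiindex n k.+1) x := pds (rev (mlist a)) chi x -
  (\prod_(i <- mlist a) b ord0 i) * (P k.+1 (lam b x - t) * W x).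
have EB a x : `|E a x| <= D * B * sg^-1.
  have [l sE hl] := splits_head (rev (mlist a)).
  have sz : size (rev (mlist a)) = k.+1 by rewrite size_rev size_mlist.
  have prev : \prod_(i <- rev (mlist a)) b ord0 i = \prod_(i <- mlist a) b ord0 i.
    by rewrite (perm_big (mlist a))//= perm_rev.
  rewrite /E xE sE big_cons/= uE sz prev mulrA addrC addrA addNr add0r.
  rewrite (le_trans (ler_norm_sum _ _ _))//.
  have sl : (size l <= 2 ^ k.+1)%N by rewrite -sz -size_splits sE.
  apply: (@le_trans _ _ (\sum_(p <- l) be ^+ k.+1 * 2 ^+ k * (B * sg^-1))); last first.
    rewrite big_const_seq count_predT iter_addr_0 -[leLHS]mulr_natl /D -!mulrA.
    rewrite ler_wpM2r//; last by rewrite -natrX ler_nat.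
    by rewrite !mulr_ge0// ?exprn_ge0 ?invr_ge0 ?(ltW sg0)//; lra.
  rewrite big_seq [leRHS]big_seq; apply: ler_sum => p pl.
  have p1 := hl p pl; rewrite sz ltnS in p1.
  have p12 : (size p.1 + size p.2 = k.+1)%N.
    by rewrite -sz; apply: splits_size; rewrite sE inE pl orbT.
  have rhs0 : 0 <= be ^+ k.+1 * 2 ^+ k * (B * sg^-1).
    by rewrite !mulr_ge0// ?exprn_ge0 ?invr_ge0 ?(ltW sg0)//; lra.
  rewrite uE normrM normrM.
  have [z0|z0] := leP (lam b x - t) 0; first by rewrite P0// normr0 mulr0 mul0r.
  have [z2|z2] := leP (lam b x - t) (sg *+ 2); last first.
    rewrite (@pds_open0 _ _ W p.2 [set x | sg *+ 2 < lam b x - t])// ?normr0 ?mulr0//.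
    apply: (@open_comp _ _ (fun x => lam b x - t) [set z | sg *+ 2 < z]).
      move=> y _; apply: rV_continuousD; first exact: lam_continuous.
      exact: cst_continuous.
    exact: open_gt.
  (* [W] receives one derivative more than the power of [sg] supplied by [P]: this is the gain
     [1 / sg]. *)
  have -> : be ^+ k.+1 * 2 ^+ k * (B * sg^-1) =
      be ^+ k.+1 * (2 ^+ k * sg ^+ (k - size p.1)) * (B * sg^-1 ^+ size p.2).
    rewrite (_ : size p.2 = (k - size p.1).+1); last by rewrite -subSn// -p12 addKn.
    rewrite [sg^-1 ^+ _.+1]exprS exprVn; field.
    by rewrite (gt_eqF sg0) expf_neq0// gt_eqF.
  apply: ler_pM => //.
    apply: ler_pM => //.
      rewrite (le_trans (prodb _))// ler_weXn2l//.
      by rewrite (leq_trans p1).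
    rewrite (le_trans (Pb _ _ p1 (ltW z0)))//.
    apply: (@le_trans _ _ ((sg *+ 2) ^+ (k - size p.1))).
      by rewrite lerXn2r ?nnegrE// ?(ltW z0)// mulrn_wge0// ltW.
    rewrite -[sg *+ 2]mulr_natl exprMn ler_wpM2r ?exprn_ge0 ?(ltW sg0)//.
    by rewrite ler_weXn2l ?ler1n// leq_subr.
  by apply: Wb; rewrite -p12 leq_addl.
pose rho x := P k.+1 (lam b x - t) * W x.
have clam : continuous (fun x => lam b x - t).
  by apply: rV_continuousD; [exact: lam_continuous|exact: cst_continuous].
have crho : continuous rho.
  apply: rV_continuousM; last exact: csmooth_continuous.
  by apply: rV_continuous_comp => //; exact: jet_continuous.
have cpx s : continuous (pds s chi) by have [] := sx s.
have cga a : continuous (g a) := csmooth_continuous (sg_ a).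
have cE a : continuous (E a).
  apply: rV_continuousD => //; under eq_fun do rewrite -mulNr.
  by apply: rV_continuousM; first exact: cst_continuous.
have E0 a x : K < `|x| -> E a x = 0.
  by move=> xK; rewrite /E (pds_cube0 _ chi0)// W0// !mulr0 subrr.
pose f1 x := \sum_a g a x * pds (rev (mlist a)) chi x.
pose f2 x := \sum_a g a x * E a x.
have cf1 : continuous f1 by apply: rV_continuous_sum => a; exact: rV_continuousM.
have cf2 : continuous f2 by apply: rV_continuous_sum => a; exact: rV_continuousM.
have if1 : mu.-integrable setT (EFin \o f1).
  apply: (integrable_continuous_cube K0 cf1) => x xK.
  by rewrite /f1 big1// => a _; rewrite (pds_cube0 _ chi0)// mulr0.
have if2 : mu.-integrable setT (EFin \o f2).
  apply: (integrable_continuous_cube K0 cf2) => x xK.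
  by rewrite /f2 big1// => a _; rewrite E0// mulr0.
pose c : R := (-1) ^+ k.+1.
have cpg a : continuous (pds (mlist a) (g a)) by have [] := sg_ a (mlist a).
have cchi : continuous chi := csmooth_continuous sx.
have ig a : mu.-integrable setT (EFin \o (fun x => pds (mlist a) (g a) x * chi x)).
  apply: (integrable_continuous_cube K0); first exact: rV_continuousM.
  by move=> x /chi0 ->; rewrite mulr0.
(* The weak form of the equation. All multi-indices have the same length, so the signs produced by
   the integrations by parts agree. *)
have If1 : (\int[mu]_x (f1 x)%:E = 0)%E.
  under eq_integral do rewrite -sumEFin.
  rewrite integral_sum//; last first.
    move=> a; apply: (@integrable_continuous_cube _ _ (fun x => g a x * pds (rev (mlist a)) chi x) _ K0).
      exact: rV_continuousM.
    by move=> x xK; rewrite (pds_cube0 _ chi0)// mulr0.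
  have step a : (\int[mu]_x (g a x * pds (rev (mlist a)) chi x)%:E =
      \int[mu]_x (c%:E * (pds (mlist a) (g a) x * chi x)%:E))%E.
    rewrite integralZl//; last exact: ig.
    rewrite (integral_pdsM _ K0 (sg_ a) sx chi0) size_mlist muleA -EFinM -exprD.
    by rewrite addnn -signr_odd odd_double expr0 mul1e.
  rewrite (eq_bigr _ (fun a _ => step a)) -integral_sum//; last first.
    by move=> a; apply: integrableZl => //; exact: ig.
  apply: integral0_eq => x _; under eq_bigr do rewrite -EFinM mulrCA.
  by rewrite sumEFin -mulr_suml g0 mul0r.
have -> : (\int[mu]_x ((\sum_a (\prod_(i <- mlist a) b ord0 i) * g a x) *
       (P k.+1 (lam b x - t) * W x))%:E = \int[mu]_x ((f1 x)%:E - (f2 x)%:E))%E.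
  apply: eq_integral => x _; rewrite -EFinB; congr EFin.
  rewrite /f1 /f2 mulr_suml -sumrB; apply: eq_bigr => a _.
  by rewrite /E; ring.
rewrite integralB// If1 sub0e abseN.
apply: (integral_dominated _ _ _ _ hM) => //.
- by rewrite mulr_ge0 ?invr_ge0 ?(ltW sg0)// mulr_ge0// addr_ge0// mulr_ge0// ltW.
- exact: rV_continuous_measurable.
- exact: rV_continuous_measurable.
move=> x; rewrite (le_trans (ler_norm_sum _ _ _))//.
apply: (@le_trans _ _ (\sum_(a : multiindex n k.+1) h x * (D * B * sg^-1))).
  by apply: ler_sum => a _; rewrite normrM ler_pM.
rewrite sumr_const -mulr_natl -/N.
have -> : N * (h x * (D * B * sg^-1)) = (N * D) * (B * sg^-1 * h x) by ring.
have -> : (N * D + 1) * B * sg^-1 * h x = (N * D + 1) * (B * sg^-1 * h x) by ring.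
by rewrite ler_wpM2r ?lerDl// !mulr_ge0// invr_ge0 ltW.
Qed.

End pde.

Section scaled_bounds.
Context (R : realType) (n : nat).
Implicit Types (f g : 'rV[R]_n -> R).

(* [f] varies at scale [sg] with amplitude [A]. *)
Definition scaled (k : nat) (sg A : R) f :=
  forall s x, (size s <= k)%N -> `|pds s f x| <= A * sg^-1 ^+ size s.

Lemma scaledM k sg A1 A2 f g : 0 < sg -> csmooth f -> csmooth g ->
  0 <= A1 -> 0 <= A2 -> scaled k sg A1 f -> scaled k sg A2 g ->
  scaled k sg (2 ^+ k * (A1 * A2)) (fun x => f x * g x).
Proof.
move=> sg0 sf sgm A10 A20 bf bg s x sk.
have [_ ->] := csmoothM sf sgm.
rewrite (le_trans (ler_norm_sum _ _ _))//.
apply: (@le_trans _ _ (\sum_(p <- splits s) A1 * A2 * sg^-1 ^+ size s)).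
  rewrite big_seq [leRHS]big_seq; apply: ler_sum => p ps.
  have psz := splits_size ps; rewrite normrM -psz exprD mulrACA.
  by apply: ler_pM => //; [apply: bf|apply: bg]; rewrite (leq_trans _ sk)// -psz ?leq_addr ?leq_addl.
rewrite big_const_seq count_predT iter_addr_0 -[leLHS]mulr_natl size_splits mulrA.
rewrite ler_wpM2r ?exprn_ge0 ?invr_ge0 ?(ltW sg0)// natrX.
by rewrite ler_wpM2r ?mulr_ge0// ler_weXn2l// ler1n.
Qed.

Lemma csmoothB f g : csmooth f -> csmooth g ->
  csmooth (fun x => f x - g x) /\
  forall s, pds s (fun x => f x - g x) = fun x => pds s f x - pds s g x.
Proof.
move=> sf sg; have sF (c : bool) : csmooth (fun x => if c then f x else -1 * g x).
  by case: c; [exact: sf|exact: (csmoothZ (-1) sg).1].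
have [] := csmooth_sum [:: true; false] sF.
have E (u v : 'rV[R]_n -> R) : (fun x => \sum_(c <- [:: true; false]) if c then u x else -1 * v x) =
    (fun x => u x - v x).
  by apply/funext => x; rewrite big_cons big_seq1 mulN1r.
rewrite E => ? h; split=> // s; rewrite h -E; apply/funext => x.
by rewrite !big_cons !big_nil /=; have [_ ->] := csmoothZ (-1) sg.
Qed.

End scaled_bounds.

Section slices.
Context (R : realType) (m k : nat) (b : 'rV[R]_m.+1).
Hypothesis b0 : b ord0 ord0 = 1.
Local Notation mu := (@lebesgue_rV R m.+1).
Local Notation n := m.+1.

(** [P 0] plays the role of a truncated power of degree [k], so that [P k.+1] approximates a Dirac
    mass and lives on [[0, de]]. The bounds on the lower orders are uniform in [de]. *)
Definition kernel_jet (P : nat -> R -> R) (de : R) :=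
  [/\ is_jet P, forall j z, z <= 0 -> P j z = 0,
      forall j z, (j <= k)%N -> 0 <= z -> `|P j z| <= z ^+ (k - j)
    & forall z, de <= z -> P k.+1 z = 0].

(** A scalar equation for a family of functions with a common integrable majorant [h], which will be
    a multiple of the norm of [f]. *)
Definition pde_solution (g : multiindex n k.+1 -> 'rV[R]_n -> R)
    (h : 'rV[R]_n -> R) (M : R) :=
  [/\ forall a, csmooth (g a), forall x, \sum_a pds (mlist a) (g a) x = 0,
      continuous h /\ (forall x, 0 <= h x), forall a x, `|g a x| <= h x
    & (\int[mu]_x (h x)%:E = M%:E)%E].

(** What the equation controls near a hyperplane [lam b x = t]: the coefficient of [P k.+1] when all
    derivatives fall on a function of [lam b x - t]. *)
Definition dirsymb (g : multiindex n k.+1 -> 'rV[R]_n -> R) x : R :=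
  \sum_a (\prod_(i <- mlist a) b ord0 i) * g a x.

Definition Kbound (K r t : R) : R := K + (`|t| + r + m%:R * `|b| * K).

Lemma slab_bounded (K r t : R) (x : 'rV[R]_n) : 0 <= K ->
  `|tail x| <= K -> `|lam b x - t| <= r -> `|x| <= Kbound K r t.
Proof.
move=> K0 xK xr; have r0 : 0 <= r := le_trans (normr_ge0 _) xr.
have X0 : 0 <= `|t| + r + m%:R * `|b| * K by rewrite !addr_ge0// !mulr_ge0.
have KB0 : 0 <= Kbound K r t by exact: addr_ge0.
rewrite rV_norm_le//; apply/forallP => i.
have xi j : `|x ord0 (lift ord0 j)| <= K.
  by have := rV_coord_le (tail x) j; rewrite mxE => /le_trans; apply.
case: (unliftP ord0 i) => [j ->|->]; first by rewrite (le_trans (xi j))// lerDl.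
have -> : x ord0 ord0 = (lam b x - t) + t -
    \sum_(j < m) b ord0 (lift ord0 j) * x ord0 (lift ord0 j).
  by rewrite /lam big_ord_recl b0 mul1r; ring.
rewrite (le_trans (ler_normB _ _))//.
have h1 : `|\sum_(j < m) b ord0 (lift ord0 j) * x ord0 (lift ord0 j)| <= m%:R * `|b| * K.
  rewrite (le_trans (ler_norm_sum _ _ _))//.
  apply: (@le_trans _ _ (\sum_(j < m) `|b| * K)).
    by apply: ler_sum => j _; rewrite normrM ler_pM// rV_coord_le.
  by rewrite sumr_const card_ord -[leLHS]mulr_natl mulrA.
by apply: (le_trans (lerD (ler_normD _ _) h1)); rewrite /Kbound; lra.
Qed.

Lemma cut_scaled : exists2 A : R, 0 <= A & forall t sg : R, 0 < sg ->
  csmooth (fun x => cutj 0 (sg^-1 * (lam b x - t))) /\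
  scaled k.+1 sg A (fun x => cutj 0 (sg^-1 * (lam b x - t))).
Proof.
have [C C1 hC] : exists2 C : R, 1 <= C & forall j (z : R), (j <= k.+1)%N -> `|cutj j z| <= C.
  elim: k.+1 => [|i [C C1 hC]].
    have [C C1 hC] := @cutj_bounded R 0; exists C => // j z.
    by rewrite leqn0 => /eqP ->.
  have [C' C'1 hC'] := @cutj_bounded R i.+1; exists (C + C'); first lra.
  move=> j z; rewrite leq_eqVlt => /predU1P[->|].
    by rewrite (le_trans (hC' z))// lerDr; lra.
  by rewrite ltnS => jk; rewrite (le_trans (hC j z jk))// lerDl; lra.
have C0 : 0 <= C by lra.
have be1 : 1 <= 1 + `|b| by rewrite lerDl.
exists ((1 + `|b|) ^+ k.+1 * C) => [|t sg sg0].
  by rewrite mulr_ge0// exprn_ge0//; lra.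
have jH := jet_affine sg^-1 0 (@cutj_jet R).
have [sc E] := csmooth_lam b (- t) jH.
have fE : (fun x => sg^-1 ^+ 0 * cutj 0 (sg^-1 * (lam b x + - t) + 0)) =
    (fun x => cutj 0 (sg^-1 * (lam b x - t))).
  by apply/funext => x; rewrite expr0 mul1r addr0.
rewrite /= fE in sc E; split=> // s x sk; rewrite E normrM normrM.
rewrite mulrCA [leRHS]mulrC ler_pM//.
  by rewrite ger0_norm// exprn_ge0// invr_ge0 ltW.
apply: ler_pM => //; last exact: hC.
apply: (@le_trans _ _ ((1 + `|b|) ^+ size s)); last by rewrite ler_weXn2l.
elim: s {sk} => [|i s IHs]; first by rewrite big_nil normr1 expr0.
rewrite big_cons normrM /= exprS ler_pM//.
by rewrite (le_trans (rV_coord_le b i))// lerDr.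
Qed.

(** [V] need not be compactly supported in the direction [ord0], as [pde_estimate] demands. It is
    multiplied by a cutoff in [lam b x - t] at scale [sg], which equals [1] on the support of
    [P k.+1] because [de <= sg]. The cutoff varies at the scale of [V], so no power of [sg] is
    lost. *)
Lemma piece_estimate : exists2 C : R, 0 < C &
  forall P g h (V : 'rV[R]_n -> R) (M K B t de sg : R),
  kernel_jet P de -> pde_solution g h M -> csmooth V -> 0 <= K ->
  (forall x, K < `|tail x| -> V x = 0) -> 0 < de -> de <= sg -> 0 <= B ->
  scaled k.+1 sg B V ->
  (`| \int[mu]_x (dirsymb g x * (P k.+1 (lam b x - t) * V x))%:E |
     <= (C * B * sg^-1 * M)%:E)%E.
Proof.
have [C C0 hC] := @pde_estimate R n k b; have [A A0 hA] := cut_scaled.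
exists (C * (2 ^+ k.+1 * A) + 1).
  by rewrite ltr_wpDl// mulr_ge0 ?(ltW C0)// mulr_ge0// exprn_ge0.
move=> P g h V M K B t de sg [jP P0 Pb Pde] [sg_ g0 [ch h0] gh hM] sV K0 V0 de0 desg B0 Vb.
have sg0 : 0 < sg := lt_le_trans de0 desg.
have [sc bc] := hA t sg sg0.
have [sW _] := csmoothM sc sV.
have bW := scaledM sg0 sc sV A0 B0 bc Vb.
have M0 : 0 <= M by rewrite -lee_fin -hM; apply: integral_ge0 => x _; rewrite lee_fin.
pose W x := cutj 0 (sg^-1 * (lam b x - t)) * V x.
have -> : (\int[mu]_x (dirsymb g x * (P k.+1 (lam b x - t) * V x))%:E =
    \int[mu]_x (dirsymb g x * (P k.+1 (lam b x - t) * W x))%:E)%E.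
  apply: eq_integral => x _; congr EFin; congr (_ * _); rewrite /W.
  set z := lam b x - t; have [z0|z0] := leP z 0; first by rewrite P0// !mul0r.
  have [z1|z1] := leP z de; last by rewrite Pde ?mul0r// ltW.
  rewrite cutj_mid ?mul1r//; first by rewrite mulr_ge0 ?invr_ge0// ltW.
  by rewrite mulrC ler_pdivrMr// mul1r (le_trans z1).
apply: le_trans (hC P g h W M (Kbound K (sg *+ 2) t) (2 ^+ k.+1 * (A * B)) t sg _ _ _ _ _ _ _ _ _ _ _ _ _ _ _ _) _ => //.
- by rewrite addr_ge0// !addr_ge0// ?mulrn_wge0 ?(ltW sg0)// !mulr_ge0.
- move=> x; rewrite /W; have [xK|xK] := leP `|tail x| K; last by rewrite V0// mulr0.
  have [xr|xr] := leP `|lam b x - t| (sg *+ 2).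
    by move=> h'; have := slab_bounded K0 xK xr; rewrite leNgt h'.
  move=> _; move: xr; rewrite ltr_normr => /orP[xr|xr].
    rewrite cutj_right ?mul0r// mulrC ler_pdivlMr// mulr_natl; exact: ltW.
  rewrite cutj_left ?mul0r// mulrC ler_pdivrMr// mulN1r lerNr.
  by rewrite (le_trans _ (ltW xr))// mulr2n lerDl ltW.
- by rewrite mulr_ge0 ?exprn_ge0// mulr_ge0.
- by move=> x xs; rewrite /W cutj_right ?mul0r// mulrC ler_pdivlMr// mulr_natl ltW.
rewrite lee_fin ler_wpM2r// ler_wpM2r ?invr_ge0 ?(ltW sg0)//.
have -> : C * (2 ^+ k.+1 * (A * B)) = C * (2 ^+ k.+1 * A) * B by ring.
by rewrite ler_wpM2r// lerDl.
Qed.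

End slices.

(** * Dyadic decomposition on a single hyperplane *)

Section telescoping.
Context (R : realType) (m k : nat) (b : 'rV[R]_m.+1).
Hypothesis m0 : (0 < m)%N.
Hypothesis b0 : b ord0 ord0 = 1.
Local Notation mu := (@lebesgue_rV R m.+1).
Local Notation n := m.+1.

Lemma tail_continuous : continuous (@tail R m).
Proof.
move=> x.
suff h (e : R) : 0 < e -> \forall z \near nbhs x, `|tail x - tail z| <= e.
  exact: (cvgrPdist_le _ _).2 h.
move=> e0; apply/nbhs_ballP; exists e => // z; rewrite -ball_normE/= => xz.
rewrite rV_norm_le ?(ltW e0)//; apply/forallP => i; rewrite !mxE.
have := rV_coord_le (x - z) (lift ord0 i); rewrite !mxE => /le_trans; apply.
exact: ltW.
Qed.

Lemma scale_box (K sg : R) : 0 < sg -> exists B : nat, K + sg <= B%:R * sg.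
Proof.
move=> sg0; exists (Num.truncn ((K + sg) / sg)).+1.
by rewrite -ler_pdivrMr// ltW// truncnS_gt.
Qed.

(* Compares the slice function [psi] with its mollifications [V j] at the
   scales [(r * 2 ^ j) ^ n]: the first difference is estimated in sup norm, all
   the others by [piece_estimate], and the resulting series is geometric. *)
Lemma slice_estimate : exists2 C : R, 0 < C &
  forall (P : nat -> R -> R) g h (psi : 'rV[R]_m -> R)
    (M K Phi Ga t de r F : R),
  kernel_jet k P de -> @pde_solution R m k g h M ->
  continuous psi -> 0 <= K -> (forall y, K < `|y| -> psi y = 0) ->
  (forall y, `|psi y| <= Phi) -> 0 <= Ga ->
  (forall y y' rho, 0 < rho -> `|y - y'| <= rho ^+ n -> `|psi y - psi y'| <= rho * Ga) ->
  0 < de -> 0 < r -> de <= r ^+ n ->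
  (\int[mu]_x (h x * `|P k.+1 (lam b x - t)|)%:E = F%:E)%E ->
  (`| \int[mu]_x (dirsymb b g x * (P k.+1 (lam b x - t) * psi (tail x)))%:E |
     <= (C * Ga * (F * r + M * r ^- m))%:E)%E.
Proof.
have [C C0 hC] := @piece_estimate R m k b b0.
have [D D1 hD] := @bumpj_uniform R k.+1.
have D0 : 0 <= D by lra.
pose A := (D *+ 3) ^+ m; have A0 : 0 <= A by rewrite exprn_ge0// mulrn_wge0.
pose Lc := \sum_(a : multiindex n k.+1) `|\prod_(i <- mlist a) b ord0 i|.
have Lc0 : 0 <= Lc by exact: sumr_ge0.
pose X := 1 + A * Lc + 2 * (C * (3 * A)).
have X0 : 0 < X by rewrite ltr_pwDl// ?ltr_pwDl// ?mulr_ge0// ?mulr_ge0// ltW.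
exists X => // P g h psi M K Phi Ga t de r F hP hg cpsi K0 psi0 psiP Ga0 hol de0 r0 der hF.
have [jP P0 Pb Pde] := hP; have [sg_ g0 [ch h0] gh hM] := hg.
have M0 : 0 <= M by rewrite -lee_fin -hM; apply: integral_ge0 => x _; rewrite lee_fin.
have Phi0 : 0 <= Phi := le_trans (normr_ge0 _) (psiP 0).
(* [psi] oscillates by at most [rj * Ga] at distance [rj ^+ n]; indexing the scales by [rj] keeps
   the exponent [1 / n] out of the formulas. *)
pose rj j : R := r * 2 ^+ j; pose sg j := rj j ^+ n.
have rj0 j : 0 < rj j by rewrite mulr_gt0// exprn_gt0.
have sg0 j : 0 < sg j by exact: exprn_gt0.
have rjS j : rj j.+1 = 2 * rj j by rewrite /rj exprS; ring.
have sgS j : sg j <= sg j.+1.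
  by rewrite /sg lerXn2r ?nnegrE ?(ltW (rj0 _))// rjS; have := rj0 j; lra.
have desg j : de <= sg j.
  elim: j => [|j IHj]; last exact: le_trans (sgS j).
  by rewrite /sg /rj expr0 mulr1.
pose Bx j := sval (cid (@scale_box K (sg j) (sg0 j))).
have hBx j : K + sg j <= (Bx j)%:R * sg j by exact: (svalP (cid (@scale_box K (sg j) (sg0 j)))).
pose V j := mollified (sg j) (Bx j) psi.
have sV j : csmooth (V j) by exact: (csmooth_mollified (sg j) (Bx j) psi).1.
have V0 j x : K + sg j < `|tail x| -> V j x = 0.
  exact: (@mollified_support _ _ _ (sg0 j) _ _ _ psi0 [::]).
have Vapp j s x : (size s <= k.+1)%N ->
    `|pds s (V j) x - (s == [::])%:R * psi (tail x)| <= A * (rj j * Ga) * (sg j)^-1 ^+ size s.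
  move=> sk; apply: (@mollified_approx _ _ _ (sg0 j) _ _ _ psi0 (hBx j) k.+1 D _ s x D0 _ hD _ sk).
    by rewrite mulr_ge0// ltW.
  by move=> y y' yy; exact: hol.
have VPhi j : scaled k.+1 (sg j) (A * Phi) (V j).
  by move=> s x sk; exact: (@mollified_bound _ _ _ (sg0 j) _ _ k.+1 D _ s x D0 Phi0 hD psiP sk).
pose w x := dirsymb b g x * P k.+1 (lam b x - t).
have cL : continuous (dirsymb b g).
  apply: rV_continuous_sum => a; apply: rV_continuousM; first exact: cst_continuous.
  exact: csmooth_continuous.
have cP : continuous (fun x => P k.+1 (lam b x - t)).
  apply: rV_continuous_comp; first exact: jet_continuous.
  by apply: rV_continuousD; [exact: lam_continuous|exact: cst_continuous].
have cw : continuous w by exact: rV_continuousM.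
(* [w] vanishes off the slab [0 <= lam b x - t <= de], so a bound on the support in the last
   coordinates suffices for integrability against [w]. *)
pose good (f : 'rV[R]_n -> R) := continuous f /\ exists2 K', 0 <= K' & forall x, K' < `|tail x| -> f x = 0.
have goodi f : good f -> mu.-integrable setT (EFin \o (fun x => w x * f x)).
  move=> [cf [K' K'0 f0]].
  apply: (@integrable_continuous_cube _ _ _ (Kbound b K' de t)).
  - by rewrite addr_ge0// !addr_ge0// ?(ltW de0)// !mulr_ge0.
  - exact: rV_continuousM.
  move=> x; have [xK|xK] := leP `|tail x| K'; last by rewrite f0// mulr0.
  have [xr|xr] := leP `|lam b x - t| de.
    by move=> h'; have := slab_bounded b0 K'0 xK xr; rewrite leNgt h'.
  move=> _; rewrite /w; move: xr; rewrite ltr_normr => /orP[xr|xr].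
    by rewrite Pde ?mulr0 ?mul0r// ltW.
  by rewrite P0 ?mulr0 ?mul0r//; lra.
pose J (f : 'rV[R]_n -> R) : R := fine (\int[mu]_x (w x * f x)%:E)%E.
have JE f : good f -> (\int[mu]_x (w x * f x)%:E = (J f)%:E)%E.
  by move=> /goodi fi; rewrite /J fineK//; exact: (integrable_fin_num measurableT fi).
have JB f1 f2 : good f1 -> good f2 -> J f1 = J (fun x => f1 x - f2 x) + J f2.
  move=> g1 g2; have i1 := goodi _ g1; have i2 := goodi _ g2.
  suff : J (fun x => f1 x - f2 x) = J f1 - J f2 by move=> ->; rewrite subrK.
  rewrite /J; under eq_integral do rewrite mulrBr EFinB.
  rewrite integralB// fineB//; exact: (integrable_fin_num measurableT).
have gV j : good (V j).
  split; first exact: csmooth_continuous.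
  exists (K + sg j); [by rewrite addr_ge0// ltW|exact: V0].
have gpsi : good (fun x => psi (tail x)).
  split; last by exists K => // x /psi0.
  by move=> x; apply: (@continuous_comp _ _ _ (@tail R m) psi); [exact: tail_continuous|exact: cpsi].
have goodB f1 f2 : good f1 -> good f2 -> good (fun x => f1 x - f2 x).
  move=> [c1 [K1 K10 h1]] [c2 [K2 K20 h2]]; split.
    apply: rV_continuousD => // x; exact: (cvgN (c2 x)).
  exists (K1 + K2); first exact: addr_ge0.
  move=> x xK; rewrite h1 ?h2 ?subrr// (le_lt_trans _ xK)//.
    by rewrite lerDr.
  by rewrite lerDl.
have JleE f (c : R) : good f -> (`|\int[mu]_x (w x * f x)%:E| <= c%:E)%E -> `|J f| <= c.
  by move=> gf; rewrite JE// lee_fin.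
have step0 : `|J (fun x => psi (tail x) - V 0%N x)| <= A * Lc * Ga * (F * r).
  have F0 : 0 <= F by rewrite -lee_fin -hF; apply: integral_ge0 => x _; rewrite lee_fin mulr_ge0.
  apply: JleE; first exact: goodB.
  have -> : A * Lc * Ga * (F * r) = A * Lc * Ga * r * F by ring.
  apply: (integral_dominated _ _ _ _ hF).
  - by rewrite !mulr_ge0// ltW.
  - apply: rV_continuous_measurable; apply: rV_continuousM => //.
    exact: (goodB _ _ gpsi (gV 0%N)).1.
  - apply: rV_continuous_measurable; apply: rV_continuousM => //.
    by apply: rV_continuous_comp => //; exact: norm_continuous.
  - move=> x; rewrite /w !normrM.
    have hL : `|dirsymb b g x| <= Lc * h x.
      rewrite (le_trans (ler_norm_sum _ _ _))// mulr_suml.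
      by apply: ler_sum => a _; rewrite normrM ler_wpM2l.
    have hV : `|psi (tail x) - V 0%N x| <= A * (r * Ga).
      have := Vapp 0%N [::] x isT.
      by rewrite /= expr0 mulr1 mul1r /rj expr0 mulr1 distrC.
    have -> : A * Lc * Ga * r * (h x * `|P k.+1 (lam b x - t)|) =
       Lc * h x * `|P k.+1 (lam b x - t)| * (A * (r * Ga)) by ring.
    by apply: ler_pM => //; apply: ler_pM.
  - by move=> x; rewrite mulr_ge0.
have piece f (K' B : R) j : csmooth f -> 0 <= K' -> (forall x, K' < `|tail x| -> f x = 0) ->
    0 <= B -> scaled k.+1 (sg j) B f -> `|J f| <= C * B * (sg j)^-1 * M.
  move=> sf K'0 f0 B0 bf; apply: JleE.
    by split; [exact: csmooth_continuous|exists K'].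
  have := hC P g h f M K' B t de (sg j) hP hg sf K'0 f0 de0 (desg j) B0 bf.
  congr (`|_| <= _)%E; apply: eq_integral => x _.
  by rewrite /w mulrA.
(* Amplitude [rj j * Ga] and gain [1 / rj j ^+ n] leave [rj j ^- m], which decays at least like
   [2 ^- j] since [m >= 1]. *)
have stepj j : `|J (fun x => V j x - V j.+1 x)| <= C * (3 * A) * Ga * M * r ^- m * (2^-1) ^+ j.
  have [sB BE] := csmoothB (sV j) (sV j.+1).
  have bd : scaled k.+1 (sg j) (3 * A * (rj j * Ga)) (fun x => V j x - V j.+1 x).
    move=> s x sk; rewrite BE.
    have -> : pds s (V j) x - pds s (V j.+1) x =
      (pds s (V j) x - (s == [::])%:R * psi (tail x)) -
      (pds s (V j.+1) x - (s == [::])%:R * psi (tail x)) by ring.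
    rewrite (le_trans (ler_normB _ _))//.
    rewrite (le_trans (lerD (Vapp j s x sk) (Vapp j.+1 s x sk)))// rjS.
    have -> : 3 * A * (rj j * Ga) * (sg j)^-1 ^+ size s =
      A * (rj j * Ga) * (sg j)^-1 ^+ size s + A * (2 * rj j * Ga) * (sg j)^-1 ^+ size s by ring.
    rewrite lerD2l ler_wpM2l//; first by rewrite !mulr_ge0// ltW.
    by rewrite lerXn2r ?nnegrE ?invr_ge0 ?(ltW (sg0 _))// lef_pV2 ?posrE.
  have := piece _ (K + sg j.+1) _ j sB _ _ _ bd.
  move=> /(_ _ _ _)/le_trans; apply.
  - by rewrite addr_ge0// ltW.
  - by move=> x xK; rewrite !V0 ?subrr//; have := sgS j; lra.
  - by rewrite !mulr_ge0// ltW.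
  have -> : C * (3 * A * (rj j * Ga)) / sg j * M =
      C * (3 * A) * Ga * M * (rj j ^- m).
    rewrite /sg exprS; field.
    by rewrite expf_neq0 gt_eqF.
  rewrite -[leRHS]mulrA ler_wpM2l//; first by rewrite !mulr_ge0// ltW.
  rewrite /rj exprMn invfM ler_wpM2l ?invr_ge0 ?exprn_ge0 ?(ltW r0)//.
  rewrite exprVn lef_pV2 ?posrE ?exprn_gt0// exprAC.
  by rewrite -exprM ler_weXn2l ?ler1n// leq_pmull.
(* The amplitude of [V j] is merely bounded, but the gain alone sends its integral to [0]: the
   telescoping sum leaves no remainder. *)
have stepJ j : `|J (V j)| <= C * (A * Phi) * M * (r ^- n) * (2^-1) ^+ j.
  have := piece _ (K + sg j) _ j (sV j) _ (V0 j) _ (VPhi j).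
  move=> /(_ _ _)/le_trans; apply.
  - by rewrite addr_ge0// ltW.
  - by rewrite mulr_ge0.
  rewrite -[leRHS]mulrA mulrAC ler_wpM2l//; first by rewrite !mulr_ge0// ltW.
  rewrite /sg /rj exprMn invfM ler_wpM2l ?invr_ge0 ?exprn_ge0 ?(ltW r0)//.
  rewrite exprVn lef_pV2 ?posrE ?exprn_gt0// -exprM ler_weXn2l ?ler1n//.
  by rewrite leq_pmulr.
pose Y := C * (3 * A) * Ga * M * r ^- m.
have tel j : `|J (V 0%N)| <= `|J (V j)| + Y * (2 - 2 * (2^-1) ^+ j).
  elim: j => [|j IHj]; first by rewrite expr0 mulr1 subrr mulr0 addr0.
  apply: (le_trans IHj); rewrite (JB (V j) (V j.+1))//.
  rewrite (le_trans (lerD (ler_normD _ _) (lexx _)))//.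
  rewrite (le_trans (lerD (lerD (stepj j) (lexx _)) (lexx _)))//.
  by rewrite -/Y le_eqVlt exprS; apply/orP; left; apply/eqP; field.
have Y0 : 0 <= Y by rewrite !mulr_ge0// ?invr_ge0 ?exprn_ge0 ?(ltW r0) ?(ltW C0).
have JV0 : `|J (V 0%N)| <= Y * 2.
  apply/ler_addgt0Pr => e e0.
  pose Z := C * (A * Phi) * M * (r ^- n).
  have Z0 : 0 <= Z by rewrite !mulr_ge0// ?invr_ge0 ?exprn_ge0 ?(ltW r0) ?(ltW C0).
  pose j := (Num.truncn (Z / e)).+1.
  have hj : Z * 2^-1 ^+ j <= e.
    rewrite exprVn ler_pdivrMr ?exprn_gt0// mulrC -ler_pdivrMr//.
    rewrite (le_trans (ltW (truncnS_gt _)))//.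
    by rewrite -natrX ler_nat ltnW// ltn_expl.
  rewrite (le_trans (tel j))// addrC lerD//; last exact: le_trans (stepJ j) hj.
  by rewrite ler_wpM2l// gerBl mulr_ge0// exprn_ge0// invr_ge0.
have main : `|J (fun x => psi (tail x))| <= X * Ga * (F * r + M * r ^- m).
  rewrite (JB _ _ gpsi (gV 0%N)) (le_trans (ler_normD _ _))//.
  rewrite (le_trans (lerD step0 JV0))// /X /Y.
  have F0 : 0 <= F by rewrite -lee_fin -hF; apply: integral_ge0 => x _; rewrite lee_fin mulr_ge0.
  have a1 : 0 <= Ga * (F * r) by rewrite !mulr_ge0// ltW.
  have a2 : 0 <= Ga * (M * r ^- m) by rewrite !mulr_ge0// invr_ge0 exprn_ge0// ltW.
  have a3 : 0 <= A * Lc by rewrite mulr_ge0.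
  have a4 : 0 <= C * (3 * A) by rewrite mulr_ge0 ?(ltW C0)// mulr_ge0.
  have -> : A * Lc * Ga * (F * r) + C * (3 * A) * Ga * M / r ^+ m * 2 =
     A * Lc * (Ga * (F * r)) + 2 * (C * (3 * A)) * (Ga * (M / r ^+ m)) by ring.
  have -> : (1 + A * Lc + 2 * (C * (3 * A))) * Ga * (F * r + M / r ^+ m) =
     (1 + A * Lc + 2 * (C * (3 * A))) * (Ga * (F * r)) +
     (1 + A * Lc + 2 * (C * (3 * A))) * (Ga * (M / r ^+ m)) by ring.
  by rewrite lerD// ler_wpM2r//; lra.
have := JE _ gpsi; rewrite /w => JE'.
under eq_integral do rewrite mulrA.
by rewrite JE' lee_fin.
Qed.

End telescoping.

(** * Morrey's inequality in dimension [m] with exponent [m + 1] *)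

Section morrey.
Context (R : realType) (m : nat).
Local Notation leb := (@lebesgue_measure R).
Local Notation mu := (@lebesgue_rV R m).
Local Notation n := m.+1.
Variables (psi N : 'rV[R]_m -> R) (D : 'rV[R]_m -> 'rV[R]_m -> R) (C1 : R).
Hypothesis m0 : (0 < m)%N.
Hypothesis cpsi : continuous psi.
Hypothesis dpsi : forall y v, is_derive y v psi (D y v).
Hypothesis cD : forall v, continuous (fun y => D y v).
Hypothesis C10 : 0 <= C1.
Hypothesis DN : forall y v, `|D y v| <= C1 * `|v| * N y.
Hypothesis cN : continuous N.
Hypothesis N0 : forall y, 0 <= N y.

Lemma measurable_rV_affine (b : 'rV[R]_m) (c : R) :
  measurable_fun [set: 'rV[R]_m] (fun w : 'rV[R]_m => b + c *: w).
Proof.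
apply: measurable_fun_rVP => i; under eq_fun do rewrite mxE [X in _ + X]mxE.
apply: measurable_funD => //; apply: measurable_funM => //.
exact: measurable_rV_coord.
Qed.

Lemma measurable_dist_psi (y z : 'rV[R]_m) (d : R) :
  measurable_fun [set: 'rV[R]_m] (fun w => `|psi (y + d *: w) - psi z|%:E).
Proof.
apply/measurable_EFinP; apply: measurableT_comp => //.
apply: measurable_funD => //.
exact: (measurableT_comp (rV_continuous_measurable cpsi) (measurable_rV_affine y d)).
Qed.

(* Young's inequality without real powers. *)
Lemma young_scaled (x ka : R) : 0 <= x -> 0 < ka -> x <= ka + ka ^- m * x ^+ n.
Proof.
move=> x0 ka0; have [xk|xk] := leP x ka.
  by rewrite (le_trans xk)// lerDl mulr_ge0 ?exprn_ge0// invr_ge0 exprn_ge0// ltW.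
rewrite (@le_trans _ _ (ka ^- m * x ^+ n))//; last by rewrite lerDr ltW.
rewrite mulrC exprS -mulrA ler_peMr// ler_pdivlMr ?exprn_gt0// mul1r.
by rewrite lerXn2r ?nnegrE// ltW// (lt_trans ka0).
Qed.

Lemma young_path (u x ka : R) : 0 <= x -> 0 <= u -> 0 < ka ->
  u ^+ m * x <= ka + ka ^- m * (u ^+ (n * m) * x ^+ n).
Proof.
move=> x0 u0 ka0.
have := @young_scaled (u ^+ m * x) ka _ ka0; rewrite mulr_ge0 ?exprn_ge0//.
by move=> /(_ isT); rewrite exprMn -exprM mulnC.
Qed.

(* The parametrization [u ^ n] of the segment cancels the singularity of the
   change of variables [z = u ^ n w] below. *)
Lemma segment_bound (y v : 'rV[R]_m) (ka : R) : 0 < ka ->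
  (`|psi (v + y) - psi y|%:E <=
   \int[leb]_(u in `[0%R, 1%R])
     (n%:R * C1 * `|v| * (ka + ka ^- m * (u ^+ (n * m) * N (u ^+ n *: v + y) ^+ n)))%:E)%E.
Proof.
move=> ka0.
pose g (u : R) := psi (u ^+ n *: v + y).
pose g' (u : R) := n%:R * u ^+ m * D (u ^+ n *: v + y) v.
have pow (u : R) : is_derive u (1 : R) (fun u : R => u ^+ n) (n%:R * u ^+ m).
  apply: DeriveDef; first exact: exprn_derivable.
  by rewrite exp_derive /GRing.scale/= mulr1.
have dg (u : R) : is_derive u (1 : R) g (g' u).
  have -> : g = (fun s : R => psi (s *: v + y)) \o (fun u : R => u ^+ n) by [].
  have hl : is_derive (u ^+ n) (1 : R) (fun s : R => psi (s *: v + y))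
      (D (u ^+ n *: v + y) v) by exact: is_derive_line.
  by rewrite /g' [_ * D _ _]mulrC; exact: (@is_derive1_comp _ _ (fun u : R => u ^+ n) _ _ _ hl (pow u)).
have cline : continuous (fun u : R => u ^+ n *: v + y).
  move=> u; apply: cvgD; last exact: cvg_cst.
  by apply: cvgZr_tmp; exact: exprn_continuous.
have cg' : continuous g'.
  move=> u; apply: cvgM.
    by apply: cvgM; [exact: cvg_cst|exact: exprn_continuous].
  by apply: (@continuous_comp _ _ _ (fun u : R => u ^+ n *: v + y) (fun y => D y v));
    [exact: cline|exact: cD].
have FTC : (\int[leb]_(u in `[0%R, 1%R]) (g' u)%:E = (g 1)%:E - (g 0)%:E)%E.
  apply: continuous_FTC2 => //.
  - exact: continuous_subspaceT.
  - split; [by move=> x _; exact: (@ex_derive _ _ _ _ _ _ _ (dg x))| |].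
      by apply: cvg_at_right_filter; exact: (is_derive_continuous dg).
    by apply: cvg_at_left_filter; exact: (is_derive_continuous dg).
  - by move=> x _; rewrite derive1E (@derive_val _ _ _ _ _ _ _ (dg x)).
have -> : (`|psi (v + y) - psi y|%:E = `|\int[leb]_(u in `[0%R, 1%R]) (g' u)%:E|)%E.
  by rewrite FTC -EFinB /g expr1n scale1r expr0n scale0r add0r.
have mg' : measurable_fun (`[(0 : R), 1] : set R) g'.
  by apply: measurable_funTS; exact: continuous_measurable_fun.
have cNl : continuous (fun u : R => N (u ^+ n *: v + y)).
  by move=> u; apply: (@continuous_comp _ _ _ (fun u : R => u ^+ n *: v + y) N);
    [exact: cline|exact: cN].
apply: (le_trans (le_abse_integral _ _ _)) => //; first exact/measurable_EFinP.
apply: ge0_le_integral => //.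
- by apply: measurableT_comp => //; exact/measurable_EFinP.
- apply/measurable_EFinP; apply: measurable_funTS; apply: continuous_measurable_fun.
  move=> u; apply: cvgM; first exact: cvg_cst.
  apply: cvgD; first exact: cvg_cst.
  apply: cvgM; first exact: cvg_cst.
  apply: cvgM; first exact: exprn_continuous.
  by apply: (@continuous_comp _ _ _ (fun u : R => N (u ^+ n *: v + y)) (fun z => z ^+ n));
    [exact: cNl|exact: exprn_continuous].
- move=> u; rewrite /= in_itv/= => /andP[u0 u1]; rewrite lee_fin /g' !normrM.
  rewrite (ger0_norm (ler0n _ _)) (ger0_norm (exprn_ge0 _ u0)).
  apply: (@le_trans _ _ (n%:R * u ^+ m * (C1 * `|v| * N (u ^+ n *: v + y)))).
    by rewrite ler_wpM2l// mulr_ge0// exprn_ge0.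
  have -> : n%:R * u ^+ m * (C1 * `|v| * N (u ^+ n *: v + y)) =
    n%:R * C1 * `|v| * (u ^+ m * N (u ^+ n *: v + y)) by ring.
  by rewrite ler_wpM2l ?mulr_ge0// young_path.
Qed.

(** Averages [segment_bound] over the endpoints [y + d *: w], at distance at most [2 * d] from [y1].
    After Tonelli, for fixed [u] the substitution in [w] produces [(u ^+ n * d) ^- m], whose power
    of [u] is compensated by the weight [u ^+ (n * m)]. *)
Lemma cube_average (y y1 : 'rV[R]_m) (d ka I : R) : 0 < d -> 0 < ka ->
  `|y - y1| <= d -> (\int[mu]_x (N x ^+ n)%:E <= I%:E)%E ->
  (\int[mu]_(w in cube 1) `|psi (y + d *: w) - psi y1|%:E <=
    (n%:R * C1 * (2 * d) * (ka * 2 ^+ m + ka ^- m * (d ^- m * I)))%:E)%E.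
Proof.
move=> d0 ka0 yy1 hI.
have I0 : 0 <= I by rewrite -lee_fin (le_trans _ hI)// integral_ge0// => x _; rewrite lee_fin exprn_ge0.
pose K1 := n%:R * C1 * (2 * d); have K10 : 0 <= K1 by rewrite !mulr_ge0// ltW.
pose b (u : R) := y1 + u ^+ n *: (y - y1).
pose c (u : R) := u ^+ n * d.
(* The restriction to [0 <= u <= 1] is put into the integrand so that Tonelli applies on the whole
   product. *)
pose f (p : R * 'rV[R]_m) : \bar R :=
  (if (0 <= p.1 <= 1) then p.1 ^+ (n * m) * N (b p.1 + c p.1 *: p.2) ^+ n else 0)%:E.
have f0 p : (0 <= f p)%E.
  rewrite lee_fin; case: ifPn => // /andP[p0 _].
  by rewrite mulr_ge0 ?exprn_ge0.
have mb : measurable_fun [set: measurableTypeR R * 'rV[R]_m] (fun p => b p.1 + c p.1 *: p.2).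
  apply: measurable_fun_rVP => i.
  have m1 : measurable_fun [set: measurableTypeR R * 'rV[R]_m] (fun p => p.1 ^+ n).
    by apply: measurable_funX; exact: measurable_fst.
  have m2 : measurable_fun [set: measurableTypeR R * 'rV[R]_m] (fun p => p.2 ord0 i).
    exact: (measurableT_comp (@measurable_rV_coord R m i) measurable_snd).
  rewrite (_ : (fun _ => _) = (fun p : measurableTypeR R * 'rV[R]_m =>
    (y1 ord0 i + p.1 ^+ n * (y - y1) ord0 i) + p.1 ^+ n * d * p.2 ord0 i)).
    apply: measurable_funD; first by apply: measurable_funD => //; exact: measurable_funM.
    by apply: measurable_funM => //; exact: measurable_funM.
  by apply/funext => p; rewrite /b /c [LHS]mxE [X in X + _]mxE [X in _ + X + _]mxE [X in _ + X]mxE.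
have mf : measurable_fun [set: measurableTypeR R * 'rV[R]_m] f.
  apply/measurable_EFinP; apply: measurable_fun_if => //.
  - rewrite (_ : (fun _ => _) = (fun u : measurableTypeR R => (0 <= u <= 1)) \o fst)//.
    apply: measurableT_comp; last exact: measurable_fst.
    by apply: measurable_and; [exact: measurable_fun_ler|exact: measurable_fun_ler].
  - apply: measurable_funTS; apply: measurable_funM.
      by apply: measurable_funX; exact: measurable_fst.
    apply: measurable_funX; apply: (measurableT_comp _ mb).
    exact: rV_continuous_measurable.
have cube2 : (mu (cube 1) = (2 ^+ m)%:E)%E by rewrite lebesgue_rV_cube.
have mcube := @measurable_cube R m 1.
have bound w : cube 1 w -> (`|psi (y + d *: w) - psi y1|%:E <=
    K1%:E * (ka%:E + (ka ^- m)%:E * \int[leb]_u f (u, w)))%E.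
  move=> w1; set v := y + d *: w - y1.
  have v2 : `|v| <= 2 * d.
    rewrite /v -addrA [d *: w - _]addrC addrA (le_trans (ler_normD _ _))// mulr2n mulrDl mul1r.
    by rewrite lerD// normrZ gtr0_norm// ger_pMr.
  have := segment_bound y1 v ka0; rewrite /v subrK -/v => /le_trans; apply.
  rewrite [leLHS](_ : _ = (\int[leb]_(u in `[0%R, 1%R])
     ((n%:R * C1 * `|v|)%:E * (ka%:E + (ka ^- m)%:E * f (u, w))))%E); last first.
    apply: eq_integral => u; rewrite inE/= in_itv/= => u01.
    rewrite /f /= u01 [LHS]EFinM EFinD [X in (_ * (_ + X))%E = _]EFinM.
    congr (_ * (_ + _ * (_ * N _ ^+ _)%:E))%E.
    rewrite /b /c /v -scalerA -[RHS]addrA -scalerDr [LHS]addrC; congr (_ + _ *: _).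
    by rewrite addrAC.
  have mfw : measurable_fun (`[(0 : R), 1] : set R) (fun u => f (u, w)).
    apply: measurable_funTS; exact: (measurableT_comp mf (pair2_measurable _)).
  have mfw2 : measurable_fun (`[(0 : R), 1] : set R) (fun u => (ka ^- m)%:E * f (u, w))%E.
    exact: emeasurable_funM.
  have kam : (0 <= (ka ^- m)%:E)%E by rewrite lee_fin invr_ge0 exprn_ge0// ltW.
  rewrite ge0_integralZl//; last 3 first.
  - exact: emeasurable_funD.
  - by move=> u _; rewrite adde_ge0 ?mule_ge0// lee_fin ltW.
  - by rewrite lee_fin !mulr_ge0.
  apply: lee_pmul.
  - by rewrite lee_fin !mulr_ge0.
  - by apply: integral_ge0 => u _; rewrite adde_ge0 ?mule_ge0// lee_fin ltW.
  - by rewrite lee_fin ler_wpM2l// mulr_ge0.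
  rewrite ge0_integralD//; last 2 first.
  - by move=> u _; rewrite lee_fin ltW.
  - by move=> u _; rewrite mule_ge0.
  rewrite integral_cst// [X in (_ * X)%E]lebesgue_measure_itv/= lte_fin ltr01 oppr0 adde0 mule1.
  apply: leeD => //; rewrite ge0_integralZl//.
  apply: lee_wpmul2l => //; apply: ge0_subset_integral => //.
  exact: (measurableT_comp mf (pair2_measurable _)).
have swap : (\int[mu]_w \int[leb]_u f (u, w) <= (d ^- m * I)%:E)%E.
  rewrite -(@fubini_tonelli _ _ (measurableTypeR R) _ _ leb mu f)//.
  apply: (@le_trans _ _ (\int[leb]_(u in `[0%R, 1%R]) (d ^- m * I)%:E)%E); last first.
    by rewrite integral_cst// [X in (_ * X)%E]lebesgue_measure_itv/= lte_fin ltr01 oppr0 adde0 mule1.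
  rewrite [leRHS]integral_mkcond; apply: ge0_le_integral => //.
  - by move=> u _; exact: integral_ge0.
  - exact: (@measurable_fun_fubini_tonelli_F _ _ (measurableTypeR R) _ _ mu f).
  - by apply/measurable_restrict => //; apply: measurable_funS measurableT _ _.
  move=> u _; rewrite patchE; case: ifPn; last first.
    rewrite notin_setE/= in_itv/= => /negP u01.
    by rewrite integral0_eq// => w _; rewrite /f /= (negbTE u01).
  rewrite inE/= in_itv/= => u01; have /andP[u0 u1] := u01.
  rewrite /f /= u01.
  (* At [u = 0] the substitution degenerates, but there the weight vanishes because [m > 0]. *)
  move: u0; rewrite le_eqVlt => /predU1P[u0|u0].
    rewrite integral0_eq; first by rewrite lee_fin mulr_ge0// invr_ge0 exprn_ge0// ltW.
    by move=> w _; rewrite -u0 expr0n muln_eq0 /= (gtn_eqF m0) mul0r.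
  have cu0 : 0 < c u by rewrite mulr_gt0// exprn_gt0.
  have mNn : measurable_fun setT (fun x => (N x ^+ n)%:E).
    by apply/measurable_EFinP; apply: measurable_funX; exact: rV_continuous_measurable.
  under eq_integral do rewrite EFinM.
  rewrite ge0_integralZl//; last 3 first.
  - exact: (measurableT_comp mNn (measurable_rV_affine (b u) (c u))).
  - by move=> w _; rewrite lee_fin exprn_ge0.
  - by rewrite lee_fin exprn_ge0// ltW.
  rewrite (ge0_integral_affine (b u) cu0 mNn); last by move=> x; rewrite lee_fin exprn_ge0.
  rewrite muleA -EFinM.
  have -> : u ^+ (n * m) * c u ^- m = d ^- m.
    rewrite /c exprMn -exprM; field.
    by rewrite !expf_neq0 ?gt_eqF.
  by rewrite EFinM lee_wpmul2l// lee_fin invr_ge0 exprn_ge0// ltW.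
have Kf : (\int[mu]_(w in cube 1) (K1%:E * (ka%:E + (ka ^- m)%:E * \int[leb]_u f (u, w))) <=
   (K1 * (ka * 2 ^+ m + ka ^- m * (d ^- m * I)))%:E)%E.
  have kam : (0 <= (ka ^- m)%:E)%E by rewrite lee_fin invr_ge0 exprn_ge0// ltW.
  have mF : measurable_fun [set: 'rV[R]_m] (fun w => \int[leb]_u f (u, w))%E.
    exact: (@measurable_fun_fubini_tonelli_G _ _ (measurableTypeR R) _ _ leb f).
  have iF w : (0 <= \int[leb]_u f (u, w))%E by apply: integral_ge0 => u _.
  have mF1 : measurable_fun (cube 1) (fun w => \int[leb]_u f (u, w))%E.
    exact: measurable_funTS.
  have mF2 : measurable_fun (cube 1) (fun w => (ka ^- m)%:E * \int[leb]_u f (u, w))%E.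
    exact: emeasurable_funM.
  rewrite ge0_integralZl//; last 2 first.
  - exact: emeasurable_funD.
  - by move=> w _; rewrite adde_ge0 ?mule_ge0// lee_fin ltW.
  rewrite [leRHS]EFinM lee_wpmul2l ?lee_fin// ge0_integralD//; last 2 first.
  - by move=> w _; rewrite lee_fin ltW.
  - by move=> w _; rewrite mule_ge0.
  rewrite EFinD; apply: leeD.
    by rewrite integral_cst// [X in (_ * X)%E]cube2 -EFinM.
  rewrite ge0_integralZl// [leRHS]EFinM lee_wpmul2l//.
  by apply: le_trans swap; apply: ge0_subset_integral.
apply: le_trans Kf; apply: ge0_le_integral => //.
- apply: measurable_funTS; exact: measurable_dist_psi.
- apply: measurable_funTS; apply: emeasurable_funM => //; apply: emeasurable_funD => //.
  apply: emeasurable_funM => //.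
  exact: (@measurable_fun_fubini_tonelli_G _ _ (measurableTypeR R) _ _ leb f).
Qed.

(** Both values are compared with [psi (y + d *: w)], averaged over [w] in the unit cube, for
    [d = rho ^+ n]. The choice [ka = rho ^- m * Ga] gives both terms of [cube_average] the order
    [rho * Ga]. The constant [8] bounds [4 * (1 + 2 ^- m)]. Writing distances as [rho ^+ n] avoids
    the Holder exponent [1 / n]. *)
Lemma morrey (Ga : R) : 0 < Ga -> (\int[mu]_x (N x ^+ n)%:E <= (Ga ^+ n)%:E)%E ->
  forall y y' rho, 0 < rho -> `|y - y'| <= rho ^+ n ->
  `|psi y - psi y'| <= n%:R * C1 * 8 * (rho * Ga).
Proof.
move=> Ga0 hN y y' rho rho0 yy.
pose d := rho ^+ n; have d0 : 0 < d by exact: exprn_gt0.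
pose ka := rho ^- m * Ga; have ka0 : 0 < ka by rewrite mulr_gt0// invr_gt0 exprn_gt0.
have h1 : `|y - y| <= d by rewrite subrr normr0 ltW.
have c1 := cube_average d0 ka0 h1 hN; have c2 := cube_average d0 ka0 yy hN.
have cube2 : (mu (cube 1) = (2 ^+ m)%:E)%E by rewrite lebesgue_rV_cube.
have mcube := @measurable_cube R m 1.
have mabs z : measurable_fun [set: 'rV[R]_m] (fun w => `|psi (y + d *: w) - psi z|%:E).
  exact: measurable_dist_psi.
have : (\int[mu]_(w in cube 1) `|psi y - psi y'|%:E <=
    \int[mu]_(w in cube 1) (`|psi (y + d *: w) - psi y|%:E + `|psi (y + d *: w) - psi y'|%:E))%E.
  apply: ge0_le_integral => //.
  - by apply: measurable_funTS; apply: emeasurable_funD.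
  - move=> w _; rewrite -EFinD lee_fin [`|_ - psi y|]distrC.
    by rewrite -(subrKA (psi (y + d *: w)) (psi y)) ler_normD.
rewrite ge0_integralD//; last 2 first.
- exact: measurable_funTS.
- exact: measurable_funTS.
rewrite integral_cst// [X in (_ * X)%E]cube2 => /le_trans/(_ (leeD c1 c2)).
rewrite -EFinM -EFinD lee_fin.
set X := _ * (ka * _ + _).
have -> : X = 2 ^+ m * (n%:R * C1 * 2 * (1 + (2 ^+ m)^-1) * (rho * Ga)).
  rewrite /X /ka /d.
  have rm : rho ^+ n = rho * rho ^+ m by rewrite exprS.
  have gm : Ga ^+ n = Ga * Ga ^+ m by rewrite exprS.
  rewrite !rm !gm !exprMn exprVn -[(rho ^+ m) ^+ m]exprM; field.
  by rewrite !expf_neq0 ?gt_eqF ?pnatr_eq0.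
move=> h; have : 2 ^+ m * `|psi y - psi y'| <= 2 ^+ m *
    (2 * (n%:R * C1 * 2 * (1 + (2 ^+ m)^-1) * (rho * Ga))).
  by rewrite mulrC (le_trans h)// mulr2n mulrDl mul1r mulrDr.
rewrite ler_pM2l ?exprn_gt0// => /le_trans; apply.
have -> : n%:R * C1 * 8 * (rho * Ga) = n%:R * C1 * (rho * Ga) * 8 by ring.
have -> : 2 * (n%:R * C1 * 2 * (1 + (2 ^+ m)^-1) * (rho * Ga)) =
  n%:R * C1 * (rho * Ga) * (4 * (1 + (2 ^+ m)^-1)) by ring.
rewrite ler_wpM2l ?mulr_ge0// ?(ltW rho0) ?(ltW Ga0)//.
have : (2 ^+ m)^-1 <= 1 :> R by rewrite invf_le1 ?exprn_gt0// exprn_ege1// ler1n.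
by lra.
Qed.

End morrey.

(** * Approximate Dirac masses and charts of hyperplanes *)

Section kernels.
Context (R : realType).
Local Notation leb := (@lebesgue_measure R).

(** Rescales [primitive_jet] by [de]. The factor [de ^+ k] preserves the bounds [z ^+ (k - j)] and
    turns [P k.+1] into the derivative of the step compressed to [[0, de]]: its mass is [1], and its
    absolute mass is bounded by height [C / de] times width [de]. *)
Lemma exists_kernel (k : nat) : exists2 C : R, 0 < C & forall de : R, 0 < de ->
  exists P, [/\ kernel_jet k P de,
    forall s, (\int[leb]_t (P k.+1 (s - t))%:E = 1)%E &
    forall s, (\int[leb]_t `|P k.+1 (s - t)|%:E <= C%:E)%E].
Proof.
have [H [jH H0 Hb HE]] := @primitive_jet R k.
have [C C1 hC] := @sstepj_bounded R 1.
exists C; first lra.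
move=> de de0.
pose P j z := de ^+ k * (de^-1 ^+ j * H j (de^-1 * z + 0)).
have jP : is_jet P.
  by move=> j x; apply: is_deriveZ; exact: (jet_affine de^-1 0 jH).
have PE z : P k.+1 z = de^-1 * sstepj 1 (de^-1 * z).
  rewrite /P HE addr0 mulrA exprS mulrCA exprVn divff ?mulr1//.
  by rewrite expf_neq0// gt_eqF.
have out s t : ~ (s - de <= t <= s) -> P k.+1 (s - t) = 0.
  move=> /negP; rewrite negb_and -!ltNge => /orP[h|h]; rewrite PE.
    rewrite sstepj_right ?mulr0// mulrC ler_pdivlMr// mul1r; lra.
  rewrite sstepj_left ?mulr0// pmulr_rle0 ?invr_gt0//; lra.
have cPs s : continuous (fun t => P k.+1 (s - t)).
  move=> t; apply: (@continuous_comp _ _ _ (fun t => s - t) (P k.+1)).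
    by apply: cvgB; [exact: cvg_cst|exact: cvg_id].
  exact: jet_continuous.
have ss s : s - de < s by rewrite ltrBlDr ltrDl.
exists P; split.
- split=> //.
  + move=> j z z0; rewrite /P H0 ?mulr0//.
    by rewrite addr0 pmulr_rle0// invr_gt0.
  + move=> j z jk z0; rewrite /P addr0 !normrM !normrX normfV (gtr0_norm de0).
    have z1 : 0 <= de^-1 * z by rewrite mulr_ge0// invr_ge0 ltW.
    rewrite (le_trans (ler_wpM2l _ (ler_wpM2l _ (Hb j _ jk z1))))//.
    * by rewrite exprn_ge0// ltW.
    * by rewrite exprn_ge0// invr_ge0 ltW.
    rewrite -{1}(subnKC jk) exprD exprMn !exprVn le_eqVlt; apply/orP; left; apply/eqP.
    by field; rewrite !expf_neq0 ?gt_eqF.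
  + move=> z zde; rewrite PE sstepj_right ?mulr0// mulrC ler_pdivlMr// mul1r//.
- move=> s.
  rewrite (_ : (fun t => (P k.+1 (s - t))%:E) =
      ((fun t => (P k.+1 (s - t))%:E) \_ `[s - de, s])); last first.
    apply/funext => t; rewrite patchE; case: ifPn => //.
    by rewrite notin_setE/= in_itv/= => /out ->.
  rewrite -integral_mkcond.
  pose u t := - P k (s - t).
  have du t : is_derive t (1 : R) u (P k.+1 (s - t)).
    have h : is_derive t (1 : R) (P k \o (fun t => s - t)) (P k.+1 (s - t) * - 1).
      apply: is_derive1_comp => //.
      by apply: is_derive_eq; rewrite add0r mul1r.
    have := is_deriveN h; rewrite mulrN1 opprK; exact.
  have Pk0 : P k 0 = 0 by rewrite /P H0 ?mulr0// addr0 mulr0.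
  (* [H k] and the smooth step have the same derivative and both vanish at [0], hence they agree at
     [1]. *)
  have Pkd : P k de = 1.
    have dP : is_jet (fun j => H (k + j)%N) by move=> j x; rewrite addnS; exact: jH.
    rewrite /P exprVn mulrA divff ?expf_neq0 ?gt_eqF// mul1r addr0 mulVf ?gt_eqF//.
    have dH x : is_derive x (1 : R) (fun x => H k x - sstepj 0%N x) 0.
      rewrite -(subrr (sstepj 1 x)) -{1}HE; apply: is_deriveB; first exact: jH.
      exact: sstepj_jet.
    have [c [_ _]] := MVT_jet dH (ltr01 : (0 : R) < 1).
    rewrite mul0r (H0 k 0)// (sstepj_left 0%N (lexx 0)) (sstepj_right 0%N (lexx 1)) /= subrr subr0 => /eqP.
    by rewrite subr_eq0 => /eqP.
  rewrite (@continuous_FTC2 _ (fun t => P k.+1 (s - t)) u)//.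
  + rewrite /u subrr Pk0 oppr0 (_ : s - (s - de) = de); last by ring.
    by rewrite Pkd -EFinB opprK add0r.
  + exact: continuous_subspaceT.
  + split; [by move=> x _; exact: (@ex_derive _ _ _ _ _ _ _ (du x))| |].
      by apply: cvg_at_right_filter; exact: (is_derive_continuous du).
    by apply: cvg_at_left_filter; exact: (is_derive_continuous du).
  + by move=> x _; rewrite derive1E (@derive_val _ _ _ _ _ _ _ (du x)).
- move=> s.
  rewrite (_ : (fun t => `|P k.+1 (s - t)|%:E) =
      ((fun t => `|P k.+1 (s - t)|%:E) \_ `[s - de, s])); last first.
    apply/funext => t; rewrite patchE; case: ifPn => //.
    by rewrite notin_setE/= in_itv/= => /out ->; rewrite normr0.
  rewrite -integral_mkcond.
  apply: (@le_trans _ _ (\int[leb]_(t in `[(s - de)%R, s]) (C / de)%:E)%E).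
    apply: ge0_le_integral => //.
    + apply/measurable_EFinP; apply: measurable_funTS; apply: continuous_measurable_fun.
      by move=> t; apply: cvg_norm; exact: cPs.
    + move=> t _; rewrite lee_fin PE normrM gtr0_norm ?invr_gt0// mulrC.
      by rewrite ler_wpM2r// invr_ge0 ltW.
  rewrite integral_cst// [X in (_ * X)%E]lebesgue_measure_itv/= lte_fin ss.
  by rewrite -EFinB -EFinM lee_fin opprB addrC subrK mulfVK// gt_eqF.
Qed.

End kernels.

Section charts.
Context (R : realType) (m : nat) (b : 'rV[R]_m.+1).
Hypothesis b0 : b ord0 ord0 = 1.
Local Notation n := m.+1.
Local Notation leb := (@lebesgue_measure R).
Local Notation mu n := (@lebesgue_rV R n).

Definition shear (y : 'rV[R]_m) : R := \sum_j b ord0 (lift ord0 j) * y ord0 j.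

(* The point of the hyperplane [lam b x = t] above [y]. *)
Definition chart (t : R) (y : 'rV[R]_m) : 'rV[R]_n := rV_cons (t - shear y, y).

(** Projects [x] onto the hyperplane along the first axis. The displacement [t - lam b x] is at most
    [de] in absolute value on the support of the kernel, whence the error estimate in
    [scalar_estimate]. *)
Lemma chart_tail t x : chart t (tail x) = (t - lam b x) *: delta_mx ord0 ord0 + x.
Proof.
apply/rowP => i; rewrite [RHS]mxE [X in _ = X + _]mxE [X in _ = _ * X + _]mxE.
case: (unliftP ord0 i) => [j ->|->].
  by rewrite rV_consES mxE /= mulr0 add0r.
rewrite rV_consE0 !eqxx mulr1 /lam big_ord_recl b0 mul1r /shear.
rewrite (eq_bigr (fun j => b ord0 (lift ord0 j) * x ord0 (lift ord0 j))); last first.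
  by move=> j _; rewrite mxE.
by ring.
Qed.

Definition dchart (v : 'rV[R]_m) : 'rV[R]_n := rV_cons (- shear v, v).

Lemma chart_line t y v (h : R) : chart t (h *: v + y) = h *: dchart v + chart t y.
Proof.
apply/rowP => i; rewrite [RHS]mxE [X in _ = X + _]mxE.
case: (unliftP ord0 i) => [j ->|->]; first by rewrite !rV_consES mxE [X in X + _]mxE.
rewrite !rV_consE0 /shear mulrN mulr_sumr.
have -> : \sum_j b ord0 (lift ord0 j) * (h *: v + y) ord0 j =
    \sum_j h * (b ord0 (lift ord0 j) * v ord0 j) + \sum_j b ord0 (lift ord0 j) * y ord0 j.
  by rewrite -big_split/=; apply: eq_bigr => j _; rewrite mxE [X in X + _]mxE; ring.
by ring.
Qed.

Lemma shear_bound y : `|shear y| <= m%:R * `|b| * `|y|.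
Proof.
rewrite (le_trans (ler_norm_sum _ _ _))//.
apply: (@le_trans _ _ (\sum_(j < m) `|b| * `|y|)).
  by apply: ler_sum => j _; rewrite normrM ler_pM// rV_coord_le.
by rewrite sumr_const card_ord -[leLHS]mulr_natl mulrA.
Qed.

Lemma dchart_bound v : `|dchart v| <= (1 + m%:R * `|b|) * `|v|.
Proof.
have c0 : 0 <= m%:R * `|b| * `|v| by rewrite !mulr_ge0.
have c1 := normr_ge0 v.
rewrite rV_norm_cons; last by rewrite mulr_ge0// addr_ge0// mulr_ge0.
rewrite normrN mulrDl mul1r; apply/andP; split; last by rewrite lerDl.
by rewrite (le_trans (shear_bound v))// lerDr.
Qed.

Lemma shear_continuous : continuous shear.
Proof.
apply: rV_continuous_sum => j; apply: rV_continuousM; first exact: cst_continuous.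
exact: coord_continuous.
Qed.

Lemma chart_continuous t : continuous (chart t).
Proof.
have -> : chart t = fun y => (t - shear y) *: delta_mx ord0 ord0 + rV_cons (0, y).
  by apply/funext => y; rewrite /chart rV_cons_line.
move=> y.
have c1 : (fun y => t - shear y) @ nbhs y --> t - shear y.
  exact: (cvgB (cvg_cst _) (shear_continuous (x:=y))).
exact: (cvgD (cvgZr_tmp c1) (@rV_cons_continuous R m 0 y)).
Qed.

Lemma measurable_chart :
  measurable_fun [set: measurableTypeR R * 'rV[R]_m] (fun p => chart p.1 p.2).
Proof.
apply: measurable_fun_rVP => i; case: (unliftP ord0 i) => [j ->|->].
  under eq_fun do rewrite rV_consES.
  exact: (measurableT_comp (@measurable_rV_coord R m j) measurable_snd).
under eq_fun do rewrite rV_consE0.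
apply: measurable_funB; first exact: measurable_fst.
exact: (measurableT_comp (rV_continuous_measurable shear_continuous) measurable_snd).
Qed.

(** For fixed [y] the passage from [t] to the first coordinate is a translation, so the slices
    recompose Lebesgue measure with density [1]. *)
Lemma integral_chart (f : 'rV[R]_n -> \bar R) : measurable_fun setT f ->
  (forall x, 0 <= f x)%E ->
  (\int[leb]_t \int[mu m]_y f (chart t y) = \int[mu n]_x f x)%E.
Proof.
move=> mf f0; rewrite ge0_integral_rVS'//.
transitivity (\int[mu m]_y \int[leb]_t f (chart t y))%E.
  apply: (@fubini_tonelli _ _ (measurableTypeR R) _ _ leb (mu m)
    (fun p => f (chart p.1 p.2))) => [|p]; last exact: f0.
  exact: (measurableT_comp mf measurable_chart).
apply: eq_integral => y _.
have := @ge0_integral_affine1 R (- shear y) 1 (fun s => f (rV_cons (s, y))) ltr01.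
rewrite invr1 mul1e => <-//.
  by apply: eq_integral => t _; rewrite mul1r addrC.
exact: (measurableT_comp (measurable_comp_rV_cons mf) (pair2_measurable _)).
Qed.

End charts.

(** * From the slices to the estimate for scalar systems *)

Section scalar_estimate.
Context (R : realType) (m k : nat) (b : 'rV[R]_m.+1).
Hypothesis m0 : (0 < m)%N.
Hypothesis b0 : b ord0 ord0 = 1.
Local Notation n := m.+1.
Local Notation leb := (@lebesgue_measure R).
Local Notation mu := (@lebesgue_rV R n).
Local Notation nu := (@lebesgue_rV R m).

Definition gradn (phi : 'rV[R]_n -> R) x : R := Num.sqrt (\sum_i `|pd i phi x| ^+ 2).

Lemma gradn_ge0 phi x : 0 <= gradn phi x.
Proof. exact: sqrtr_ge0. Qed.

Lemma pd_le_gradn phi i x : `|pd i phi x| <= gradn phi x.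
Proof.
rewrite -[leLHS]ger0_norm// -sqrtr_sqr ler_wsqrtr// (bigD1 i)//= lerDl.
by rewrite sumr_ge0// => j _; rewrite exprn_ge0.
Qed.

Lemma gradn_continuous phi : csmooth phi -> continuous (gradn phi).
Proof.
move=> sp; apply: rV_continuous_comp; first exact: sqrt_continuous.
apply: rV_continuous_sum => i.
have ci : continuous (pd i phi) by have [] := sp [:: i].
apply: (@rV_continuous_comp _ _ (fun z => z ^+ 2) (fun x => `|pd i phi x|)).
  exact: exprn_continuous.
by apply: rV_continuous_comp => //; exact: norm_continuous.
Qed.

Lemma gradn_support phi (K : R) x : (forall x, K < `|x| -> phi x = 0) ->
  K < `|x| -> gradn phi x = 0.
Proof.
move=> p0 xK; rewrite /gradn big1 ?sqrtr0// => i _.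
have -> : pd i phi x = 0 by exact: (@pds_cube0 _ _ phi [:: i] K p0).
by rewrite normr0 expr0n.
Qed.

Lemma chart_holder phi (t Ga : R) : csmooth phi -> 0 < Ga ->
  (\int[nu]_y (gradn phi (chart b t y) ^+ n)%:E <= (Ga ^+ n)%:E)%E ->
  forall y y' rho, 0 < rho -> `|y - y'| <= rho ^+ n ->
  `|phi (chart b t y) - phi (chart b t y')| <=
     n%:R * ((1 + m%:R * `|b|) * n%:R) * 8 * (rho * Ga).
Proof.
move=> sp Ga0 hN.
have cpd i : continuous (pd i phi) by have [] := sp [:: i].
apply: (@morrey R m (fun y => phi (chart b t y)) (fun y => gradn phi (chart b t y))
  (fun y v => \sum_i dchart b v ord0 i * pd i phi (chart b t y))
  ((1 + m%:R * `|b|) * n%:R) m0 _ _ _ _ _ _ _ Ga Ga0 hN) => //.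
- move=> y; apply: (@continuous_comp _ _ _ (chart b t) phi); first exact: chart_continuous.
  exact: csmooth_continuous.
- move=> y v; apply: line_is_derive.
  under eq_fun do rewrite chart_line.
  apply: is_derive_line; rewrite scale0r add0r.
  by apply: is_derive_gradient => // i x; have [_] := sp [::].
- move=> v; apply: rV_continuous_sum => i; apply: rV_continuousM; first exact: cst_continuous.
  by move=> y; apply: (@continuous_comp _ _ _ (chart b t) (pd i phi)); [exact: chart_continuous|exact: cpd].
- move=> y v; rewrite (le_trans (ler_norm_sum _ _ _))//.
  apply: (@le_trans _ _ (\sum_(i < n) ((1 + m%:R * `|b|) * `|v|) * gradn phi (chart b t y))).
    apply: ler_sum => i _; rewrite normrM ler_pM ?pd_le_gradn//.
    exact: le_trans (rV_coord_le _ _) (dchart_bound _ _).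
  by rewrite sumr_const card_ord -[leLHS]mulr_natr le_eqVlt; apply/orP; left; apply/eqP; ring.
- move=> y; apply: (@continuous_comp _ _ _ (chart b t) (gradn phi)); first exact: chart_continuous.
  exact: gradn_continuous.
- by move=> y; exact: gradn_ge0.
Qed.

Lemma exists_root (x : R) : 0 < x -> exists2 y : R, 0 < y & y ^+ n = x.
Proof.
move=> x0; exists (x `^ (n%:R^-1)); first by rewrite powR_gt0.
by rewrite -powR_mulrn ?powR_ge0// -powRrM mulVf ?powRr1 ?pnatr_eq0// ltW.
Qed.

Definition slice_energy (phi : 'rV[R]_n -> R) t :=
  (\int[nu]_y (gradn phi (chart b t y) ^+ n)%:E)%E.

Variables (phi : 'rV[R]_n -> R) (K : R).
Hypothesis sphi : csmooth phi.
Hypothesis K0 : 0 <= K.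
Hypothesis phi0 : forall x, K < `|x| -> phi x = 0.

(** Uniformity in [t] is what lets a single kernel width [de] serve all slices. *)
Lemma slice_energy_bounded : exists2 Gm : R, 0 <= Gm & forall t, (slice_energy phi t <= Gm%:E)%E.
Proof.
have [C C0 hC] := bounded_cube_support (gradn_continuous sphi) (fun x => gradn_support phi0).
exists (C ^+ n * (K *+ 2) ^+ m) => [|t].
  by rewrite mulr_ge0 ?exprn_ge0// mulrn_wge0.
apply: (@le_trans _ _ (\int[nu]_(y in cube K) (C ^+ n)%:E)%E); last first.
  rewrite integral_cst//; last exact: measurable_cube.
  by rewrite [X in (_ * X)%E](lebesgue_rV_cube m K0).
rewrite [leRHS]integral_mkcond; apply: ge0_le_integral => //.
- by move=> y _; rewrite lee_fin exprn_ge0// gradn_ge0.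
- apply/measurable_EFinP; apply: measurable_funX; apply: rV_continuous_measurable.
  move=> y; apply: (@continuous_comp _ _ _ (chart b t) (gradn phi)); first exact: chart_continuous.
  exact: gradn_continuous.
- apply/measurable_restrict => //; first exact: measurable_cube.
- move=> y _; rewrite patchE; case: ifPn => yK.
    rewrite lee_fin lerXn2r ?nnegrE ?gradn_ge0//.
    by have := hC (chart b t y); rewrite ger0_norm ?gradn_ge0.
  rewrite (gradn_support phi0) ?expr0n//.
  rewrite ltNge rV_norm_cons// negb_and -ltNge; apply/orP; right.
  by rewrite -ltNge; move: yK; rewrite notin_setE/= => /negP; rewrite -ltNge.
Qed.

End scalar_estimate.

Section scalar_estimate_main.
Context (R : realType) (m k : nat) (b : 'rV[R]_m.+1).
Hypothesis m0 : (0 < m)%N.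
Hypothesis b0 : b ord0 ord0 = 1.
Local Notation n := m.+1.
Local Notation leb := (@lebesgue_measure R).
Local Notation mu := (@lebesgue_rV R n).
Local Notation nu := (@lebesgue_rV R m).

Definition kernel_mass (P : nat -> R -> R) (h : 'rV[R]_n -> R) t :=
  (\int[mu]_x (h x * `|P k.+1 (lam b x - t)|)%:E)%E.

(** Uses [slice_estimate] with [r = ka / Ga], where [Ga ^+ n] is essentially the energy of the
    slice. The bound becomes linear in [kernel_mass] and [slice_energy], whose integrals in [t] are
    under control; the condition on [de] ensures [de <= r ^+ n]. *)
Lemma slice_bound : exists2 A : R, 0 < A &
  forall P g h (phi : 'rV[R]_n -> R) (M K Gm t de ka : R),
  kernel_jet k P de -> @pde_solution R m k g h M ->
  csmooth phi -> 0 <= K -> (forall x, K < `|x| -> phi x = 0) ->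
  0 <= Gm -> (slice_energy b phi t <= Gm%:E)%E -> 0 < ka -> 0 < de ->
  de * (Gm + 1) <= ka ^+ n ->
  (`|\int[mu]_x (dirsymb b g x * (P k.+1 (lam b x - t) * phi (chart b t (tail x))))%:E|
    <= A%:E * (ka%:E * kernel_mass P h t + (M * ka ^- m)%:E * slice_energy b phi t))%E.
Proof.
have [C C0 hS] := @slice_estimate R m k b m0 b0.
pose c1 : R := n%:R * ((1 + m%:R * `|b|) * n%:R) * 8.
have c10 : 0 < c1.
  by rewrite !mulr_gt0// ltr_wpDr// mulr_ge0.
exists (C * c1); first exact: mulr_gt0.
move=> P g h phi M K Gm t de ka hP hg sp K0 p0 Gm0 GtGm ka0 de0 dek.
have [jP P0 Pb Pde] := hP; have [sg_ g0 [ch h0] gh hM] := hg.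
have M0 : 0 <= M by rewrite -lee_fin -hM; apply: integral_ge0 => x _; rewrite lee_fin.
have Gt0 : (0 <= slice_energy b phi t)%E by apply: integral_ge0 => y _; rewrite lee_fin exprn_ge0// gradn_ge0.
have Gtf : slice_energy b phi t \is a fin_num.
  by rewrite ge0_fin_numE// (le_lt_trans GtGm)// ltry.
have cP : continuous (P k.+1) by exact: jet_continuous.
have [CP CP0 hCP] := continuous_bounded_itv 0 de cP.
have PB z : `|P k.+1 z| <= CP.
  have [z0|z0] := leP z 0; first by rewrite P0// normr0.
  have [z1|z1] := leP z de; first by rewrite hCP// (ltW z0).
  by rewrite Pde ?normr0// ltW.
have mh : measurable_fun setT h by exact: rV_continuous_measurable.
have cPl : continuous (fun x => P k.+1 (lam b x - t)).
  apply: rV_continuous_comp => //.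
  by apply: rV_continuousD; [exact: lam_continuous|exact: cst_continuous].
have mPl : measurable_fun setT (fun x => `|P k.+1 (lam b x - t)|).
  by apply: measurableT_comp => //; exact: rV_continuous_measurable.
have Ft0 : (0 <= kernel_mass P h t)%E by apply: integral_ge0 => x _; rewrite lee_fin mulr_ge0.
have Ftf : kernel_mass P h t \is a fin_num.
  rewrite ge0_fin_numE//.
  have := @integral_dominated R n (fun x => h x * `|P k.+1 (lam b x - t)|) h CP M CP0 _ mh _ hM h0.
  rewrite gee0_abs// => /(_ _ _)/le_lt_trans; apply; last exact: ltry.
    exact: measurable_funM.
  by move=> x; rewrite ger0_norm ?mulr_ge0// mulrC ler_wpM2r.
rewrite -(fineK Gtf) -(fineK Ftf) -!EFinM.
set G := fine (slice_energy b phi t); set F := fine (kernel_mass P h t).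
have G0 : 0 <= G by exact: fine_ge0.
have GGm : G <= Gm by rewrite -lee_fin fineK.
have [Phi Phi0 hPhi] := bounded_cube_support (csmooth_continuous sp) p0.
pose Cst := C * c1 * (M * ka ^- m).
have Cst0 : 0 <= Cst.
  by rewrite mulr_ge0 ?mulr_ge0 ?(ltW C0) ?(ltW c10)// invr_ge0 exprn_ge0// ltW.
(* [eta] keeps [Ga] positive on slices of zero energy and is sent to [0] afterwards; [eta <= 1]
   matches the [Gm + 1] in the condition on [de]. *)
suff step eta : 0 < eta -> eta <= 1 ->
    (`|\int[mu]_x (dirsymb b g x * (P k.+1 (lam b x - t) * phi (chart b t (tail x))))%:E|
      <= (C * c1 * (ka * F + M * ka ^- m * (G + eta)))%:E)%E.
  set X := (`|_|)%E in step *.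
  have Xf : X \is a fin_num.
    by rewrite ge0_fin_numE ?abse_ge0// (le_lt_trans (step 1 _ _))// ltry.
  rewrite -(fineK Xf) lee_fin; apply/ler_addgt0Pr => e e0.
  pose eta := Num.min 1 (e / (Cst + 1)).
  have C1 : 0 < Cst + 1 by rewrite ltr_wpDl.
  have eta0 : 0 < eta by rewrite lt_min ltr01 divr_gt0.
  have eta1 : eta <= 1 by rewrite ge_min lexx.
  have eta2 : Cst * eta <= e.
    apply: (@le_trans _ _ ((Cst + 1) * eta)); first by rewrite ler_wpM2r ?(ltW eta0)// lerDl.
    by rewrite mulrC -ler_pdivlMr// ge_min lexx orbT.
  have := step _ eta0 eta1; rewrite -(fineK Xf) lee_fin => /le_trans; apply.
  have -> : C * c1 * (ka * F + M * ka ^- m * (G + eta)) =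
     C * c1 * (ka * F + M * ka ^- m * G) + Cst * eta by rewrite /Cst; ring.
  by rewrite lerD2l.
move=> eta0 eta1.
have Geta : 0 < G + eta by rewrite ltr_wpDl.
have [Ga Ga0 GaE] := @exists_root R m _ Geta.
have hN : (\int[nu]_y (gradn phi (chart b t y) ^+ n)%:E <= (Ga ^+ n)%:E)%E.
  by rewrite GaE -/(slice_energy b phi t) -(fineK Gtf) lee_fin lerDl ltW.
have hol := chart_holder m0 sp Ga0 hN; rewrite -/c1 in hol.
pose r := ka / Ga; have r0 : 0 < r by rewrite divr_gt0.
have der : de <= r ^+ n.
  rewrite /r expr_div_n GaE ler_pdivlMr// (le_trans _ dek)// ler_wpM2l ?(ltW de0)//.
  by rewrite lerD.
have FtE : (\int[mu]_x (h x * `|P k.+1 (lam b x - t)|)%:E = F%:E)%E by rewrite fineK.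
have cpsi : continuous (fun y => phi (chart b t y)).
  move=> y; apply: (@continuous_comp _ _ _ (chart b t) phi); first exact: chart_continuous.
  exact: csmooth_continuous.
have psi0 y : K < `|y| -> phi (chart b t y) = 0.
  move=> yK; apply: p0; rewrite ltNge rV_norm_cons// negb_and -!ltNge.
  by rewrite yK orbT.
have := hS P g h (fun y => phi (chart b t y)) M K Phi (c1 * Ga) t de r F hP hg cpsi K0 psi0
  (fun y => hPhi _) (ltW (mulr_gt0 c10 Ga0)) _ de0 r0 der FtE.
move=> /(_ _)/le_trans; apply.
  move=> y y' rho rho0 yy; apply: le_trans (hol y y' rho rho0 yy) _.
  by rewrite le_eqVlt; apply/orP; left; apply/eqP; ring.
rewrite lee_fin le_eqVlt; apply/orP; left; apply/eqP.
rewrite -GaE /r exprMn exprVn invfM invrK exprS; field.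
by rewrite !expf_neq0 ?gt_eqF.
Qed.

Lemma dirsymb_bound (g : multiindex n k.+1 -> 'rV[R]_n -> R) h M x :
  @pde_solution R m k g h M ->
  `|dirsymb b g x| <=
    (\sum_(a : multiindex n k.+1) `|\prod_(i <- mlist a) b ord0 i|) * h x.
Proof.
move=> [_ _ [_ h0] gh _]; rewrite (le_trans (ler_norm_sum _ _ _))// mulr_suml.
by apply: ler_sum => a _; rewrite normrM ler_wpM2l.
Qed.

End scalar_estimate_main.

Section scalar_main.
Context (R : realType) (m k : nat) (b : 'rV[R]_m.+1).
Hypothesis m0 : (0 < m)%N.
Hypothesis b0 : b ord0 ord0 = 1.
Local Notation n := m.+1.
Local Notation leb := (@lebesgue_measure R).
Local Notation mu := (@lebesgue_rV R n).
Local Notation nu := (@lebesgue_rV R m).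

Lemma shift_lipschitz (phi : 'rV[R]_n -> R) (L : R) : csmooth phi ->
  (forall x, `|pd ord0 phi x| <= L) ->
  forall x (s : R), `|phi (s *: delta_mx ord0 ord0 + x) - phi x| <= L * `|s|.
Proof.
move=> sp hL.
have pos x (s : R) : 0 < s -> `|phi (s *: delta_mx ord0 ord0 + x) - phi x| <= L * s.
  move=> s0.
  have dl (u : R) : is_derive u (1 : R) (fun u : R => phi (u *: delta_mx ord0 ord0 + x))
      (pd ord0 phi (u *: delta_mx ord0 ord0 + x)).
    by apply: is_derive_line; exact: csmooth_is_derive.
  have [c [_ _]] := MVT_jet dl s0; rewrite scale0r add0r subr0 => ->.
  by rewrite normrM (gtr0_norm s0) ler_wpM2r// ltW.
move=> x s; have [s0|s0|->] := ltgtP s 0.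
- have := pos (s *: delta_mx ord0 ord0 + x) (- s); rewrite oppr_gt0 => /(_ s0).
  by rewrite addrA -scalerDl addNr scale0r add0r distrC (ltr0_norm s0).
- by rewrite (gtr0_norm s0); exact: pos.
- by rewrite scale0r add0r subrr !normr0 mulr0.
Qed.

Lemma measurable_shift_pair (f : 'rV[R]_n -> R) : continuous f ->
  measurable_fun [set: measurableTypeR R * 'rV[R]_n] (fun p => f (chart b p.1 (tail p.2))).
Proof.
move=> cf; apply: (measurableT_comp (rV_continuous_measurable cf)).
apply: measurable_fun_rVP => i.
have m1 : measurable_fun [set: measurableTypeR R * 'rV[R]_n] (fun p => lam b p.2).
  exact: (measurableT_comp (rV_continuous_measurable (@lam_continuous _ _ b)) measurable_snd).
have m2 : measurable_fun [set: measurableTypeR R * 'rV[R]_n] (fun p => p.2 ord0 i).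
  exact: (measurableT_comp (@measurable_rV_coord R n i) measurable_snd).
under eq_fun do rewrite chart_tail// mxE [X in X + _]mxE.
apply: measurable_funD => //; apply: measurable_funM => //.
by apply: measurable_funB => //; exact: measurable_fst.
Qed.

(* Averaging the slice estimates over [t] against the kernel [P k.+1] of width
   [de], and then letting [de] tend to [0]. *)
Lemma scalar_estimate : exists2 C : R, 0 < C &
  forall g h (phi : 'rV[R]_n -> R) (M K De ka : R),
  @pde_solution R m k g h M ->
  csmooth phi -> 0 <= K -> (forall x, K < `|x| -> phi x = 0) ->
  (\int[mu]_x (gradn phi x ^+ n)%:E = De%:E)%E -> 0 < ka ->
  (`|\int[mu]_x (dirsymb b g x * phi x)%:E| <= (C * M * (ka + ka ^- m * De))%:E)%E.
Proof.
have [A A0 hA] := @slice_bound R m k b m0 b0.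
have [C C0 hK] := @exists_kernel R k.
pose Lc := \sum_(a : multiindex n k.+1) `|\prod_(i <- mlist a) b ord0 i|.
have Lc0 : 0 <= Lc by exact: sumr_ge0.
exists (A * (C + 1)); first by rewrite mulr_gt0// addr_gt0.
move=> g h phi M K De ka hg sp K0 p0 hDe ka0.
have [sg_ g0 [ch h0] gh hM] := hg.
have M0 : 0 <= M by rewrite -lee_fin -hM; apply: integral_ge0 => x _; rewrite lee_fin.
have De0 : 0 <= De.
  by rewrite -lee_fin -hDe; apply: integral_ge0 => x _; rewrite lee_fin exprn_ge0// gradn_ge0.
have [Gm Gm0 hGm] := slice_energy_bounded b sp K0 p0.
have cphi := csmooth_continuous sp.
have [Phi Phi0 hPhi] := bounded_cube_support cphi p0.
have cpd : continuous (pd ord0 phi) by have [] := sp [:: ord0].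
have [L L0 hL] := bounded_cube_support cpd (fun x => @pds_cube0 _ _ phi [:: ord0] K p0 x).
have lip := shift_lipschitz sp hL.
have mh : measurable_fun setT h by exact: rV_continuous_measurable.
have cLam : continuous (dirsymb b g).
  apply: rV_continuous_sum => a; apply: rV_continuousM; first exact: cst_continuous.
  exact: csmooth_continuous (sg_ a).
have LamB x : `|dirsymb b g x| <= Lc * h x by exact: dirsymb_bound hg.
pose X := (`|\int[mu]_x (dirsymb b g x * phi x)%:E|)%E.
pose Y := A * (ka * (C * M) + M * ka ^- m * De).
suff step e : 0 < e -> (X <= (Y + e)%:E)%E.
  have Xf : X \is a fin_num.
    by rewrite ge0_fin_numE ?abse_ge0// (le_lt_trans (step 1 ltr01))// ltry.
  apply: (@le_trans _ _ Y%:E).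
    rewrite -/X -(fineK Xf) lee_fin; apply/ler_addgt0Pr => e e0.
    by rewrite -lee_fin (fineK Xf) step.
  rewrite lee_fin /Y -!mulrA ler_wpM2l ?(ltW A0)//.
  have a1 : 0 <= M * ka by rewrite mulr_ge0// ltW.
  have a2 : 0 <= M * (ka ^- m * De) by rewrite !mulr_ge0// invr_ge0 exprn_ge0// ltW.
  have -> : (C + 1) * (M * (ka + ka ^- m * De)) =
    ka * (C * M) + M * (ka ^- m * De) + (M * ka + C * (M * (ka ^- m * De))) by ring.
  by rewrite lerDl addr_ge0// mulr_ge0// ltW.
move=> e0.
pose Ec := Lc * L * C * M.
have Ec0 : 0 <= Ec by rewrite !mulr_ge0// ltW.
(* The first term is the condition of [slice_bound], valid for all slices at once; the second makes
   the error of replacing [phi] by its slice values at most [e]. *)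
pose de := Num.min (ka ^+ n / (Gm + 1)) (e / (Ec + 1)).
have Gm1 : 0 < Gm + 1 by rewrite ltr_wpDl.
have Ec1 : 0 < Ec + 1 by rewrite ltr_wpDl.
have de0 : 0 < de by rewrite lt_min !divr_gt0// exprn_gt0.
have dek : de * (Gm + 1) <= ka ^+ n by rewrite -ler_pdivlMr// ge_min lexx.
have deE : Ec * de <= e.
  apply: (@le_trans _ _ ((Ec + 1) * de)); first by rewrite ler_wpM2r ?(ltW de0)// lerDl.
  by rewrite mulrC -ler_pdivlMr// ge_min lexx orbT.
have [P [hP P1 PC]] := hK de de0.
have [jP P0 Pb Pde] := hP.
have cP : continuous (P k.+1) by exact: jet_continuous.
pose TT := (measurableTypeR R * 'rV[R]_n)%type.
pose rho (p : TT) := P k.+1 (lam b p.2 - p.1).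
have mrho : measurable_fun [set: TT] rho.
  apply: measurableT_comp; first exact: continuous_measurable_fun.
  apply: measurable_funB; last exact: measurable_fst.
  exact: (measurableT_comp (rV_continuous_measurable (@lam_continuous _ _ b)) measurable_snd).
have mhs : measurable_fun [set: TT] (fun p => h p.2).
  exact: (measurableT_comp mh measurable_snd).
(* Domination by [h] times the kernel gives integrability on the product, since the kernel has
   absolute mass at most [C] in [t]. *)
have dom (q : TT -> R) (c : R) : 0 <= c -> measurable_fun [set: TT] q ->
    (forall p, `|q p| <= c * (h p.2 * `|rho p|)) ->
    (leb \x mu)%E.-integrable setT (EFin \o q) /\
    (\int[leb \x mu]_p `|q p|%:E <= (c * C * M)%:E)%E.
  move=> c0 mq hq.
  have le1 : (\int[leb \x mu]_p `|q p|%:E <= (c * C * M)%:E)%E.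
    rewrite (@fubini_tonelli2 _ _ (measurableTypeR R) _ _ leb mu (fun p => `|q p|%:E))//; last first.
      by apply/measurable_EFinP; apply: measurableT_comp.
    apply: (@le_trans _ _ (\int[mu]_x ((c * C)%:E * (h x)%:E))%E).
      apply: ge0_le_integral => //.
      + by move=> x _; apply: integral_ge0.
      + apply: (@measurable_fun_fubini_tonelli_G _ _ (measurableTypeR R) _ _ leb (fun p => `|q p|%:E)) => //.
        by apply/measurable_EFinP; apply: measurableT_comp.
      + by apply: emeasurable_funM => //; exact/measurable_EFinP.
      move=> x _.
      apply: (@le_trans _ _ (\int[leb]_t ((c * h x)%:E * `|P k.+1 (lam b x - t)|%:E))%E).
        apply: ge0_le_integral => //.
        * apply/measurable_EFinP; apply: measurableT_comp => //.
          exact: (measurableT_comp mq (pair2_measurable _)).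
        * apply: emeasurable_funM => //; apply/measurable_EFinP; apply: measurableT_comp => //.
          exact: (measurableT_comp mrho (pair2_measurable _)).
        * by move=> t _; rewrite -EFinM lee_fin -mulrA; exact: (hq (t, x)).
      rewrite ge0_integralZl//; last 2 first.
      - apply/measurable_EFinP; apply: measurableT_comp => //.
        exact: (measurableT_comp mrho (pair2_measurable _)).
      - by rewrite lee_fin mulr_ge0.
      rewrite -EFinM mulrAC [leRHS]EFinM lee_wpmul2l ?lee_fin ?mulr_ge0//.
    rewrite ge0_integralZl//; last 3 first.
    - exact/measurable_EFinP.
    - by move=> x _; rewrite lee_fin.
    - by rewrite lee_fin mulr_ge0// ltW.
    by rewrite hM -EFinM.
  split=> //; apply/integrableP; split; first exact/measurable_EFinP.
  by rewrite (le_lt_trans le1)// ltry.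
pose psi (p : TT) := phi (chart b p.1 (tail p.2)).
have mpsi : measurable_fun [set: TT] psi by exact: measurable_shift_pair.
pose Lam (p : TT) := dirsymb b g p.2.
have mLam : measurable_fun [set: TT] Lam.
  exact: (measurableT_comp (rV_continuous_measurable cLam) measurable_snd).
have mphi : measurable_fun [set: TT] (fun p => phi p.2).
  exact: (measurableT_comp (rV_continuous_measurable cphi) measurable_snd).
(* [f0 = f + f2]: [f] involves only slice values of [phi], [f2] is the error, and [f0] integrates in
   [t] to [dirsymb b g x * phi x] because the kernel has mass [1]. *)
pose f p := Lam p * (rho p * psi p).
pose f0 p := Lam p * (rho p * phi p.2).
pose f2 p := Lam p * (rho p * (phi p.2 - psi p)).
have mf : measurable_fun [set: TT] f by do 2 apply: measurable_funM => //.
have mf0 : measurable_fun [set: TT] f0 by do 2 apply: measurable_funM => //.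
have mf2 : measurable_fun [set: TT] f2.
  by apply: measurable_funM => //; apply: measurable_funM => //; exact: measurable_funB.
have dompt (a p : TT) (v c : R) : `|v| <= c ->
    `|Lam p * (rho p * v)| <= Lc * c * (h p.2 * `|rho p|).
  move=> vc; rewrite !normrM.
  have -> : Lc * c * (h p.2 * `|rho p|) = (Lc * h p.2) * (`|rho p| * c) by ring.
  by apply: ler_pM => //; [exact: LamB|rewrite ler_wpM2l].
have [if_ _] := dom f (Lc * Phi) (mulr_ge0 Lc0 Phi0) mf (fun p => dompt p p _ _ (hPhi _)).
have [if0 _] := dom f0 (Lc * Phi) (mulr_ge0 Lc0 Phi0) mf0 (fun p => dompt p p _ _ (hPhi _)).
have f2B p : `|f2 p| <= Lc * (L * de) * (h p.2 * `|rho p|).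
  have [z0|z0] := leP (lam b p.2 - p.1) 0.
    by rewrite /f2 /rho P0// normr0 mul0r !mulr0 normr0.
  have [z1|z1] := leP (lam b p.2 - p.1) de; last first.
    by rewrite /f2 /rho Pde ?(ltW z1)// normr0 mul0r !mulr0 normr0.
  apply: dompt => //; rewrite /psi chart_tail// distrC (le_trans (lip _ _))//.
  by rewrite ler_wpM2l// distrC ger0_norm// ltW.
have [if2 hf2] := dom f2 (Lc * (L * de)) (mulr_ge0 Lc0 (mulr_ge0 L0 (ltW de0))) mf2 f2B.
have E0 : (\int[leb \x mu]_p (f0 p)%:E = \int[mu]_x (dirsymb b g x * phi x)%:E)%E.
  rewrite -(integral21_prod_meas1 if0); apply: eq_integral => x _.
  rewrite /fubini_G /f0 /Lam /rho /=.
  under eq_integral => t _.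
    rewrite (_ : _ * _ = (dirsymb b g x * phi x) * P k.+1 (lam b x - t)); last by ring.
    rewrite EFinM; over.
  rewrite integralZl// ?P1 ?mule1//.
  apply/integrableP; split.
    apply/measurable_EFinP; exact: (measurableT_comp mrho (pair2_measurable _)).
  by apply: le_lt_trans (PC _) _; rewrite ltry.
have E : (\int[leb \x mu]_p (f0 p)%:E =
    \int[leb \x mu]_p (f p)%:E + \int[leb \x mu]_p (f2 p)%:E)%E.
  rewrite -integralD//; apply: eq_integral => p _; rewrite -EFinD; congr EFin.
  by rewrite /f0 /f /f2; ring.
rewrite /X -E0 E; apply: (le_trans (lee_abs_add _ _)).
rewrite EFinD; apply: leeD; last first.
  apply: (le_trans (le_abse_integral _ _ _)) => //; first exact/measurable_EFinP.
  apply: (le_trans hf2); rewrite lee_fin (le_trans _ deE)// /Ec le_eqVlt.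
  by apply/orP; left; apply/eqP; ring.
rewrite -(integral12_prod_meas1 if_).
apply: (le_trans (le_abse_integral _ _ _)) => //.
  exact: (measurable_fubini_F if_).
have mF : measurable_fun [set: measurableTypeR R] (kernel_mass k b P h).
  apply: (@measurable_fun_fubini_tonelli_F _ _ (measurableTypeR R) _ _ mu
    (fun p => (h p.2 * `|rho p|)%:E)) => [|p]; last by rewrite lee_fin mulr_ge0.
  by apply/measurable_EFinP; apply: measurable_funM => //; apply: measurableT_comp.
have mGr : measurable_fun setT (fun x => (gradn phi x ^+ n)%:E).
  by apply/measurable_EFinP; apply: measurable_funX; apply: rV_continuous_measurable; exact: gradn_continuous.
have Gr0 x : (0 <= (gradn phi x ^+ n)%:E)%E by rewrite lee_fin exprn_ge0// gradn_ge0.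
have mG : measurable_fun [set: measurableTypeR R] (slice_energy b phi).
  apply: (@measurable_fun_fubini_tonelli_F _ _ (measurableTypeR R) _ _ nu
    (fun p => (gradn phi (chart b p.1 p.2) ^+ n)%:E)) => [|p]; last exact: Gr0.
  exact: (measurableT_comp mGr (measurable_chart b)).
have F0 t : (0 <= kernel_mass k b P h t)%E.
  by apply: integral_ge0 => x _; rewrite lee_fin mulr_ge0.
have G0 t : (0 <= slice_energy b phi t)%E by apply: integral_ge0 => y _; exact: Gr0.
have kam : 0 <= M * ka ^- m by rewrite mulr_ge0// invr_ge0 exprn_ge0// ltW.
have IF : (\int[leb]_t kernel_mass k b P h t <= (C * M)%:E)%E.
  have mq : measurable_fun [set: TT] (fun p => h p.2 * `|rho p|).
    by apply: measurable_funM => //; apply: measurableT_comp.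
  have [_] := dom (fun p => h p.2 * `|rho p|) 1 ler01 mq
    (fun p => eq_ind_r (fun z => z <= _) (eq_ind_r (fun z => _ <= z) (lexx _) (mul1r _)) (ger0_norm (mulr_ge0 (h0 p.2) (normr_ge0 _)))).
  rewrite mul1r; apply: le_trans.
  rewrite (@fubini_tonelli1 _ _ (measurableTypeR R) _ _ leb mu)//; last first.
    by apply/measurable_EFinP; apply: measurableT_comp.
  apply: ge0_le_integral => //.
  - apply: (@measurable_fun_fubini_tonelli_F _ _ (measurableTypeR R) _ _ mu) => //.
    by apply/measurable_EFinP; apply: measurableT_comp.
  - move=> t _; rewrite /kernel_mass /fubini_F; apply: ge0_le_integral => //.
    + by move=> x _; rewrite lee_fin mulr_ge0.
    + apply/measurable_EFinP; exact: (measurableT_comp mq (pair1_measurable _)).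
    + apply/measurable_EFinP; apply: measurableT_comp => //; exact: (measurableT_comp mq (pair1_measurable _)).
    + by move=> x _; rewrite lee_fin ler_norm.
have IG : (\int[leb]_t slice_energy b phi t = De%:E)%E.
  by rewrite -hDe; exact: (integral_chart b mGr Gr0).
apply: (@le_trans _ _ (\int[leb]_t (A%:E * (ka%:E * kernel_mass k b P h t + (M * ka ^- m)%:E * slice_energy b phi t)))%E).
  apply: ge0_le_integral => //.
  - by apply: measurableT_comp => //; exact: (measurable_fubini_F if_).
  - apply: emeasurable_funM => //; apply: emeasurable_funD; exact: emeasurable_funM.
  - move=> t _; exact: (hA P g h phi M K Gm t de ka hP hg sp K0 p0 Gm0 (hGm t) ka0 de0 dek).
rewrite ge0_integralZl//; last 3 first.
- by apply: emeasurable_funD; exact: emeasurable_funM.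
- by move=> t _; rewrite adde_ge0// mule_ge0// lee_fin ltW.
- by rewrite lee_fin ltW.
rewrite /Y [leRHS]EFinM lee_wpmul2l ?lee_fin ?(ltW A0)// ge0_integralD//; last 4 first.
- by move=> t _; rewrite mule_ge0// lee_fin ltW.
- exact: emeasurable_funM.
- by move=> t _; rewrite mule_ge0// lee_fin.
- exact: emeasurable_funM.
rewrite EFinD; apply: leeD.
  rewrite ge0_integralZl//; last by rewrite lee_fin ltW.
  by rewrite [leRHS]EFinM lee_wpmul2l// lee_fin ltW.
by rewrite ge0_integralZl// IG EFinM.
Qed.

End scalar_main.

(** * Linear algebra in Euclidean spaces and vector-valued smooth functions *)

Section euclidean.
Context (R : realType) (E : euclideanType R).
Implicit Types (x y u e : E).

Lemma dotprodDr x y u : dotprod u (x + y) = dotprod u x + dotprod u y.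
Proof. by rewrite dotprodC dotprodDl ![dotprod _ u]dotprodC. Qed.

Lemma dotprodZr (a : R) x u : dotprod u (a *: x) = a * dotprod u x.
Proof. by rewrite dotprodC dotprodZl dotprodC. Qed.

Lemma dotprod0l u : dotprod 0 u = 0 :> R.
Proof. by rewrite -(scale0r u) dotprodZl mul0r. Qed.

Lemma dotprodBl x y u : dotprod (x - y) u = dotprod x u - dotprod y u.
Proof. by rewrite dotprodDl -scaleN1r dotprodZl mulN1r. Qed.

Lemma dotprod_suml (I : Type) (r : seq I) (F : I -> E) u :
  dotprod (\sum_(i <- r) F i) u = \sum_(i <- r) dotprod (F i) u.
Proof.
elim: r => [|i r IHr]; first by rewrite !big_nil dotprod0l.
by rewrite !big_cons dotprodDl IHr.
Qed.

Lemma dotprod_sumr (I : Type) (r : seq I) (F : I -> E) u :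
  dotprod u (\sum_(i <- r) F i) = \sum_(i <- r) dotprod u (F i).
Proof. by rewrite dotprodC dotprod_suml; apply: eq_bigr => i _; rewrite dotprodC. Qed.

Lemma dotprod_eq0 x : dotprod x x = 0 -> x = 0.
Proof. by rewrite dotprod_norm => /eqP; rewrite expf_eq0/= normr_eq0 => /eqP. Qed.

Lemma cauchy_schwarz x y : `|dotprod x y| <= `|x| * `|y|.
Proof.
have [->|y0] := eqVneq y 0.
  by rewrite dotprodC dotprod0l !normr0 mulr0.
have ny : 0 < `|y| by rewrite normr_gt0.
have h : 0 <= dotprod (`|y| ^+ 2 *: x - dotprod x y *: y) (`|y| ^+ 2 *: x - dotprod x y *: y).
  by rewrite dotprod_norm exprn_ge0.
have h2 : 0 <= `|y| ^+ 2 * (`|y| ^+ 2 * `|x| ^+ 2 - dotprod x y ^+ 2).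
  move: h; rewrite dotprodBl !dotprodZl ![dotprod _ (_ - _)]dotprodC !dotprodBl !dotprodZl.
  rewrite !dotprod_norm (dotprodC y x).
  by congr (0 <= _); ring.
rewrite pmulr_rge0 ?exprn_gt0// subr_ge0 in h2.
rewrite -(@ler_pXn2r _ 2) ?nnegrE ?mulr_ge0//.
by rewrite real_normK ?num_real// exprMn mulrC.
Qed.

Lemma dotprod_continuous e : continuous (fun x : E => dotprod x e : R).
Proof.
move=> x; apply/cvgrPdist_le => eps eps0; near=> y.
rewrite -dotprodBl (le_trans (cauchy_schwarz _ _))//.
have e1 : 0 < `|e| + 1 by rewrite ltr_wpDl.
apply: (@le_trans _ _ (`|x - y| * (`|e| + 1))); first by rewrite ler_wpM2l// lerDl.
rewrite -ler_pdivlMr//; near: y; apply: cvgr_dist_le => //.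
by rewrite divr_gt0.
Unshelve. all: by end_near. Qed.

Lemma is_derive_dotprod (V : normedModType R) (f : V -> E) (a v : V) (df e : E) :
  is_derive a v f df -> is_derive a v (fun y : V => dotprod (f y) e : R) (dotprod df e).
Proof.
move=> [fd fE].
have lim0 : (h^-1 *: (dotprod (f (h *: v + a)) e - dotprod (f a) e)) @[h --> (0 : R)^'] --> dotprod df e.
  have -> : (fun h : R => h^-1 *: (dotprod (f (h *: v + a)) e - dotprod (f a) e)) =
      (fun u => dotprod u e) \o (fun h : R => h^-1 *: (f (h *: v + a) - f a)).
    by apply/funext => h /=; rewrite dotprodZl dotprodBl.
  rewrite -fE; apply: (cvg_comp _ (fun u => dotprod u e)); first exact: fd.
  exact: dotprod_continuous.
apply: DeriveDef; first by apply/cvg_ex; exists (dotprod df e).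
exact/cvg_lim.
Qed.

(** Rank-nullity for the map sending [x] to its products with a basis of [U]: the target has
    dimension less than that of [E], so the kernel is nonzero. *)
Lemma ortho_exists (U : {vspace E}) : U != fullv ->
  exists2 e : E, e != 0 & forall u, u \in U -> dotprod u e = 0 :> R.
Proof.
move=> Uf.
pose T (x : E) : 'rV[R]_(\dim U) := \row_i dotprod (vbasis U)`_i x.
have linT : linear T.
  by move=> a x y; apply/rowP => i; rewrite !mxE dotprodDr dotprodZr.
pose TL := GRing.isLinear.Build _ _ _ _ T linT.
pose Tl : {linear E -> 'rV[R]_(\dim U)} := HB.pack T TL.
have dimT := limg_ker_dim (linfun Tl) fullv.
have : (\dim (lker (linfun Tl)) > 0)%N.
  rewrite lt0n; apply/eqP => k0; move: dimT; rewrite capfv k0 add0n => dimT.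
  have : (\dim (linfun Tl @: fullv) <= \dim U)%N.
    by rewrite (leq_trans (dimvS (subvf _)))// dimvf/= /dim/= mul1n.
  by rewrite dimT -ltnS => h; move: Uf; rewrite eqEdim subvf/= -ltnS h.
rewrite lt0n dimv_eq0 => k0.
exists (vpick (lker (linfun Tl))); first by rewrite vpick0.
set e := vpick _.
have : linfun Tl e = 0 by apply/eqP; rewrite -memv_ker memv_pick.
rewrite lfunE /= => Te0 u uU.
rewrite (coord_vbasis uU) dotprod_suml big1// => i _.
rewrite dotprodZl; have /rowP/(_ i) := Te0; rewrite !mxE => ->.
by rewrite mulr0.
Qed.

(** A vector [e0] orthogonal to the kernel of [l], rescaled: subtracting [(l x / l e0) *: e0] from
    [x] lands in that kernel. *)
Lemma riesz (l : E -> R) : (forall (a : R) x y, l (a *: x + y) = a * l x + l y) ->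
  exists e, forall x, l x = dotprod x e.
Proof.
move=> linl.
pose LL := GRing.isLinear.Build _ _ _ _ (l : E -> R^o) linl.
pose Ll : {linear E -> R^o} := HB.pack (l : E -> R^o) LL.
have [full|] := eqVneq (lker (linfun Ll)) fullv.
  exists 0 => x; rewrite dotprodC dotprod0l.
  have : x \in lker (linfun Ll) by rewrite full memvf.
  by rewrite memv_ker lfunE => /eqP.
move=> /ortho_exists[e0 e0n e0o].
have le0 : l e0 != 0.
  apply: contra_neq e0n => le0; apply: dotprod_eq0; apply: e0o.
  by rewrite memv_ker lfunE; apply/eqP.
have n0 : dotprod e0 e0 != 0 :> R by apply: contra_neq e0n => /dotprod_eq0.
exists ((l e0 / dotprod e0 e0) *: e0) => x.
have : (- (l x / l e0)) *: e0 + x \in lker (linfun Ll).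
  by rewrite memv_ker lfunE /= linl mulNr divfK// addNr.
move=> /e0o; rewrite dotprodDl dotprodZl => /eqP; rewrite addrC mulNr subr_eq0 => /eqP h.
by rewrite dotprodZr h; field; apply/andP.
Qed.

End euclidean.

Section smooth_vector_valued.
Context (R : realType) (n : nat) (E F : euclideanType R).
Implicit Types (f : 'rV[R]_n -> E) (e : E).

Lemma smooth_dotprod f e : smooth f ->
  csmooth (fun x => dotprod (f x) e : R) /\
  forall s, pds s (fun x => dotprod (f x) e : R) =
    fun x => dotprod (foldr (@partial R n E) f s x) e.
Proof.
move=> sf.
have [] := @csmooth_family R n (seq 'I_n)
  (fun s x => dotprod (foldr (@partial R n E) f s x) e : R) cons _ _ [::].
- move=> s x; have [cf _] := sf s.
  exact: (@continuous_comp _ _ _ (foldr (@partial R n E) f s) (fun y => dotprod y e : R) x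
    (cf x) (@dotprod_continuous R E e _)).
- move=> s i x; have [_ df] := sf s.
  by apply: is_derive_dotprod; exact/derivableP/df.
move=> ? h; split=> // s; rewrite h.
by congr (fun t x => dotprod (foldr (@partial R n E) f t x) e : R); elim: s => //= i s ->.
Qed.

Lemma partial_multi_mlist k (a : multiindex n k) f :
  partial_multi a f = foldr (@partial R n E) f (mlist a).
Proof. exact: (@foldr_mlist n _ (@partial R n E)). Qed.

Lemma smooth_continuous f : smooth f -> continuous f.
Proof. by move=> /(_ [::])[]. Qed.

Lemma smooth_scale (g : 'rV[R]_n -> R) e : csmooth g ->
  smooth (fun x => g x *: e) /\
  forall s, foldr (@partial R n E) (fun x => g x *: e) s = fun x => pds s g x *: e.
Proof.
move=> sg.
have dE s i x : is_derive x (delta_mx ord0 i) (fun x => pds s g x *: e) (pds (i :: s) g x *: e).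
  have [fd fE] := csmooth_is_derive i x (csmooth_pds s sg).
  have lim0 : (h^-1 *: (pds s g (h *: delta_mx ord0 i + x) *: e - pds s g x *: e)) @[h --> (0 : R)^']
      --> pds (i :: s) g x *: e.
    have -> : (fun h : R => h^-1 *: (pds s g (h *: delta_mx ord0 i + x) *: e - pds s g x *: e)) =
        (fun h : R => (h^-1 *: (pds s g (h *: delta_mx ord0 i + x) - pds s g x)) *: e).
      by apply/funext => h; rewrite -scalerBl scalerA.
    by apply: cvgZr_tmp; rewrite /= -fE; exact: fd.
  apply: DeriveDef; first by apply/cvg_ex; exists (pds (i :: s) g x *: e).
  exact/cvg_lim.
have h s : foldr (@partial R n E) (fun x => g x *: e) s = fun x => pds s g x *: e.
  elim: s => //= i s ->; apply/funext => x.
  exact: (@derive_val _ _ _ _ _ _ _ (dE s i x)).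
split=> // s; rewrite h; split=> [x|i x].
  have cs : continuous (pds s g) by have [] := sg s.
  exact: (cvgZr_tmp (cs x)).
exact: (@ex_derive _ _ _ _ _ _ _ (dE s i x)).
Qed.

Lemma test_function_cube f : test_function f ->
  exists2 K : R, 0 <= K & forall x, K < `|x| -> f x = 0.
Proof.
move=> [_ /compact_bounded[N [_ hN]]].
exists (`|N| + 1); first exact: addr_ge0.
move=> x Nx; apply/eqP/negPn/negP => fx.
have N1 : N < `|N| + 1 by rewrite (le_lt_trans (ler_norm _))// ltrDl.
have := hN _ N1 x (@subset_closure _ [set x | f x != 0] x fx).
by rewrite /= leNgt Nx.
Qed.

End smooth_vector_valued.

(** * Sufficiency: from components to the vector estimate *)

Section cocancelling_estimate.
Context (R : realType) (m k : nat) (E F : euclideanType R).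
Hypothesis m0 : (0 < m)%N.
Local Notation n := m.+1.
Local Notation mu := (@lebesgue_rV R n).
Variable L : multiindex n k.+1 -> 'Hom(E, F).

(* The components [dotprod (f x) e] for which the duality estimate holds. *)
Definition component_bound (e : E) (C : R) : Prop := 0 <= C /\
  forall (f : 'rV[R]_n -> E) (phi : 'rV[R]_n -> R) (M K De ka : R),
  smooth f -> (forall x, diffop L f x = 0) ->
  (\int[mu]_x (`|f x|)%:E = M%:E)%E ->
  csmooth phi -> 0 <= K -> (forall x, K < `|x| -> phi x = 0) ->
  (\int[mu]_x (gradn phi x ^+ n)%:E = De%:E)%E -> 0 < ka ->
  (`|\int[mu]_x (dotprod (f x) e * phi x)%:E| <= (C * M * (ka + ka ^- m * De))%:E)%E.

Definition good (e : E) : Prop := exists C, component_bound e C.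

Lemma good_lin (a : R) e1 e2 : good e1 -> good e2 -> good (a *: e1 + e2).
Proof.
move=> [C1 [C10 h1]] [C2 [C20 h2]]; exists (`|a| * C1 + C2); split.
  by rewrite addr_ge0// mulr_ge0.
move=> f phi M K De ka sf Lf hM sp K0 p0 hDe ka0.
have i e : mu.-integrable setT (fun x => (dotprod (f x) e * phi x)%:E).
  apply: (@integrable_continuous_cube _ _ (fun x => dotprod (f x) e * phi x) _ K0).
    apply: rV_continuousM; last exact: csmooth_continuous.
    exact: (csmooth_continuous (smooth_dotprod e sf).1).
  by move=> x /p0 ->; rewrite mulr0.
have -> : (\int[mu]_x (dotprod (f x) (a *: e1 + e2) * phi x)%:E =
    a%:E * \int[mu]_x (dotprod (f x) e1 * phi x)%:E + \int[mu]_x (dotprod (f x) e2 * phi x)%:E)%E.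
  rewrite -integralZl// -integralD//; last exact: integrableZl.
  apply: eq_integral => x _; rewrite -EFinM -EFinD; congr EFin.
  by rewrite dotprodDr dotprodZr; ring.
apply: (le_trans (lee_abs_add _ _)); rewrite abseM.
have -> : (`|a| * C1 + C2) * M * (ka + ka ^- m * De) =
  `|a| * (C1 * M * (ka + ka ^- m * De)) + C2 * M * (ka + ka ^- m * De) by ring.
rewrite EFinD EFinM; apply: leeD; last exact: (h2 f phi M K De ka sf Lf hM sp K0 p0 hDe ka0).
by rewrite lee_wpmul2l//; exact: (h1 f phi M K De ka sf Lf hM sp K0 p0 hDe ka0).
Qed.

(** [e] is the adjoint of [symbol L b] applied to [v]. Pairing the equation with [v] gives a scalar
    equation for the functions [dotprod (f x) (ea a)], with [ea a] the adjoint of [L a] applied to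
    [v], and the associated [dirsymb] is [dotprod (f x) e]. *)
Lemma good_symbol (b : 'rV[R]_n) (v : F) (e : E) : b ord0 ord0 = 1 ->
  (forall x, dotprod (symbol L b x) v = dotprod x e) -> good e.
Proof.
move=> b0 hw; have [C C0 hC] := @scalar_estimate R m k b m0 b0.
have rz (a : multiindex n k.+1) : exists ea : E, forall x, dotprod (L a x) v = dotprod x ea.
  by apply: (riesz (l := fun x => dotprod (L a x) v)) => c x y; rewrite linearP dotprodDl dotprodZl.
have [ea eaE] := choice rz.
pose c : R := \sum_(a : multiindex n k.+1) `|ea a|.
have c0 : 0 <= c by exact: sumr_ge0.
exists (C * c); split; first by rewrite mulr_ge0// ltW.
move=> f phi M K De ka sf Lf hM sp K0 p0 hDe ka0.
pose g (a : multiindex n k.+1) x : R := dotprod (f x) (ea a).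
pose h x : R := c * `|f x|.
have cf := smooth_continuous sf.
have cnf : continuous (fun x => `|f x|).
  by move=> x; exact: (cvg_norm (cf x)).
have hg : @pde_solution R m k g h (c * M).
  split.
  - by move=> a; exact: (smooth_dotprod (ea a) sf).1.
  - move=> x; transitivity (dotprod (diffop L f x) v : R); last by rewrite Lf dotprod0l.
    rewrite /diffop dotprod_suml; apply: eq_bigr => a _.
    by rewrite (smooth_dotprod (ea a) sf).2 eaE partial_multi_mlist.
  - split; last by move=> x; rewrite mulr_ge0.
    by apply: rV_continuousM => //; exact: cst_continuous.
  - move=> a x; rewrite (le_trans (cauchy_schwarz _ _))// mulrC ler_wpM2r//.
    by rewrite /c (bigD1 a)//= lerDl sumr_ge0.
  - under eq_integral do rewrite EFinM.
    rewrite ge0_integralZl// ?hM ?EFinM//.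
    by apply/measurable_EFinP; exact: rV_continuous_measurable.
have := hC g h phi (c * M) K De ka hg sp K0 p0 hDe ka0.
have -> : C * (c * M) * (ka + ka ^- m * De) = C * c * M * (ka + ka ^- m * De) by ring.
congr (`|_| <= _)%E; apply: eq_integral => x _; congr (_ * _)%:E.
rewrite -hw /symbol sum_lfunE dotprod_suml; apply: eq_bigr => a _.
by rewrite scale_lfunE dotprodZl eaE prod_mlist.
Qed.

(** Good vectors form a subspace. A vector [e0] orthogonal to it is orthogonal to the image of the
    adjoint of [symbol L b] for every normalised [b], hence killed by these symbols; homogeneity,
    then continuity, extend this to all [xi], and cocancellation forces [e0 = 0]. *)
Lemma good_all : cocancelling L -> forall e, good e.
Proof.
move=> coL.
have good0 : good 0.
  exists 0; split=> // f phi M K De ka _ _ _ _ _ _ _ _.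
  rewrite integral0_eq ?abse0 ?mul0r ?mul0r// => x _.
  by rewrite dotprodC dotprod0l mul0r.
(* A subspace of good vectors of maximal dimension contains every good vector, since adding the line
   of one more would enlarge it. *)
pose p d := `[< exists U : {vspace E}, (forall u, u \in U -> good u) /\ \dim U = d >].
have p0 : exists d, p d.
  exists 0%N; apply/asboolP; exists 0%VS; split; last exact: dimv0.
  by move=> u; rewrite memv0 => /eqP ->.
have pub d : p d -> (d <= \dim (fullv : {vspace E}))%N.
  by move=> /asboolP[U [_ <-]]; exact: dimvS (subvf _).
case: (ex_maxnP p0 pub) => d /asboolP[U [gU dU]] dmax.
have inU w : good w -> w \in U.
  move=> gw; have : (\dim (U + <[w]>) <= \dim U)%N.
    rewrite dU; apply: dmax; apply/asboolP; exists (U + <[w]>)%VS; split=> //.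
    move=> u /memv_addP[u1 u1U [u2 /vlineP[a ->] ->]].
    by rewrite addrC; apply: good_lin => //; exact: gU.
  move=> dle; have /eqP -> : U == (U + <[w]>)%VS.
    by rewrite eqEdim addvSl.
  by apply: (subvP (addvSr U <[w]>)); exact: memv_line.
suff UT : U == fullv by move=> e; apply: gU; rewrite (eqP UT) memvf.
apply/negPn/negP => /ortho_exists[e0 e0n e0o].
have k1 (b : 'rV[R]_n) : b ord0 ord0 = 1 -> symbol L b e0 = 0.
  move=> b0; apply: dotprod_eq0; set v := symbol L b e0.
  have [w wE] := @riesz R E (fun x => dotprod (symbol L b x) v)
    (fun c x y => etrans (congr1 (dotprod^~ v) (linearP _ _ _ _))
       (etrans (dotprodDl _ _ _) (congr1 (+%R^~ _) (dotprodZl _ _ _)))).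
  by rewrite wE dotprodC e0o//; apply: inU; exact: good_symbol wE.
have symE (xi : 'rV[R]_n) x : symbol L xi x =
    \sum_(a : multiindex n k.+1) (\prod_(i <- mlist a) xi ord0 i) *: L a x.
  by rewrite /symbol sum_lfunE; apply: eq_bigr => a _; rewrite scale_lfunE prod_mlist.
have k2 (xi : 'rV[R]_n) : xi ord0 ord0 != 0 -> symbol L xi e0 = 0.
  move=> xi0; have := k1 ((xi ord0 ord0)^-1 *: xi); rewrite mxE mulVf// => /(_ erefl).
  rewrite !symE.
  have -> : \sum_(a : multiindex n k.+1)
       (\prod_(i <- mlist a) ((xi ord0 ord0)^-1 *: xi) ord0 i) *: L a e0 =
     (xi ord0 ord0)^-1 ^+ k.+1 *: \sum_(a : multiindex n k.+1) (\prod_(i <- mlist a) xi ord0 i) *: L a e0.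
    rewrite scaler_sumr; apply: eq_bigr => a _; rewrite scalerA; congr (_ *: _).
    under eq_bigr do rewrite mxE.
    by rewrite big_split/= big_const_seq count_predT iter_mulr_1 size_mlist.
  by move=> /eqP; rewrite scaler_eq0 expf_eq0/= invr_eq0 (negbTE xi0)/= => /eqP.
(* A vector with zero first coordinate is a limit of vectors covered by [k2]; pairing with [v] turns
   this into a limit of real polynomial functions. *)
have k3 (xi : 'rV[R]_n) : symbol L xi e0 = 0.
  have [xi0|] := eqVneq (xi ord0 ord0) 0; last exact: k2.
  apply: dotprod_eq0; set v := symbol L xi e0.
  pose q (s : R) : R := \sum_(a : multiindex n k.+1)
    (\prod_(i <- mlist a) (xi + s *: delta_mx ord0 ord0) ord0 i) * dotprod (L a e0) v.
  have qE s : q s = dotprod (symbol L (xi + s *: delta_mx ord0 ord0) e0) v.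
    by rewrite symE dotprod_suml; apply: eq_bigr => a _; rewrite dotprodZl.
  have cq : continuous q.
    have cs : continuous (fun s : R => xi + s *: delta_mx ord0 ord0).
      by move=> s; exact: (cvgD (cvg_cst _) (cvgZr_tmp cvg_id)).
    have cQ : continuous (fun z : 'rV[R]_n => \sum_(a : multiindex n k.+1)
        (\prod_(i <- mlist a) z ord0 i) * (dotprod (L a e0) v : R)).
      apply: rV_continuous_sum => a; apply: rV_continuousM; last exact: cst_continuous.
      by apply: rV_continuous_prod => i; exact: coord_continuous.
    by move=> s; exact: (@continuous_comp _ _ _ (fun s : R => xi + s *: delta_mx ord0 ord0) _ s (cs s) (cQ _)).
  have : q 0 = 0.
    apply: (continuous_eq_left cq) => s s0; rewrite qE k2 ?dotprod0l//.
    by rewrite mxE xi0 add0r !mxE !eqxx mulr1 lt_eqF.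
  by rewrite qE scale0r addr0.
have : (\bigcap_(xi in [set xi : 'rV[R]_n | xi != 0])
    [set e : E | e \in lker (symbol L xi)]) e0.
  by move=> xi _ /=; rewrite memv_ker k3.
by rewrite coL /= => e00; rewrite e00 eqxx in e0n.
Qed.

Lemma norm_deriv_gradn (phi : 'rV[R]_n -> E) (u : E) x : smooth phi ->
  gradn (fun x => dotprod (phi x) u) x <= `|u| * norm_deriv phi x.
Proof.
move=> sp; rewrite /gradn /norm_deriv.
have -> : `|u| = Num.sqrt (`|u| ^+ 2) by rewrite sqrtr_sqr normr_id.
rewrite -sqrtrM ?sqr_ge0// ler_wsqrtr// mulr_sumr.
apply: ler_sum => i _.
have -> : pd i (fun x => dotprod (phi x) u : R) x = dotprod (partial i phi x) u.
  by have /(congr1 (@^~ x)) := (smooth_dotprod u sp).2 [:: i].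
rewrite -exprMn ?normr_id lerXn2r ?nnegrE ?mulr_ge0//.
by rewrite mulrC cauchy_schwarz.
Qed.

Lemma norm_deriv_continuous (phi : 'rV[R]_n -> E) : smooth phi -> continuous (norm_deriv phi).
Proof.
move=> sp; apply: rV_continuous_comp; first exact: sqrt_continuous.
apply: rV_continuous_sum => i.
have ci : continuous (partial i phi) by have [] := sp [:: i].
apply: (@rV_continuous_comp _ _ (fun z => z ^+ 2) (fun x => `|partial i phi x|)).
  exact: exprn_continuous.
by move=> x; exact: (cvg_norm (ci x)).
Qed.

End cocancelling_estimate.

Section sufficiency.
Context (R : realType) (m k : nat) (E F : euclideanType R).
Hypothesis m0 : (0 < m)%N.
Local Notation n := m.+1.
Local Notation mu := (@lebesgue_rV R n).
Variable L : multiindex n k.+1 -> 'Hom(E, F).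

Lemma norm_deriv_support (phi : 'rV[R]_n -> E) (K : R) x : smooth phi ->
  (forall x, K < `|x| -> phi x = 0) -> K < `|x| -> norm_deriv phi x = 0.
Proof.
move=> sp p0 Kx; rewrite /norm_deriv big1 ?sqrtr0// => i _.
rewrite (_ : partial i phi x = 0) ?normr0 ?expr0n//; apply: dotprod_eq0.
have /(congr1 (@^~ x)) /= <- := (smooth_dotprod (partial i phi x) sp).2 [:: i].
by apply: (@pds_cube0 _ _ _ [:: i] K) => // y /p0 ->; rewrite dotprod0l.
Qed.

Lemma integral_gradn_dotprod (phi : 'rV[R]_n -> E) (u : E) (K D : R) : smooth phi ->
  0 <= K -> (forall x, K < `|x| -> phi x = 0) ->
  (\int[mu]_x (norm_deriv phi x ^+ n)%:E = D%:E)%E ->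
  exists2 De, (\int[mu]_x (gradn (fun x => dotprod (phi x) u : R) x ^+ n)%:E = De%:E)%E
    & De <= `|u| ^+ n * D.
Proof.
move=> sp K0 p0 hD; pose g x : R := gradn (fun x => dotprod (phi x) u : R) x ^+ n.
have cg : continuous g.
  apply: (@rV_continuous_comp _ _ (fun z => z ^+ n)); first exact: exprn_continuous.
  exact/gradn_continuous/(smooth_dotprod u sp).1.
have ig : mu.-integrable setT (fun x => (g x)%:E).
  apply: (@integrable_continuous_cube _ _ g _ K0 cg) => x Kx.
  rewrite /g (@gradn_support _ _ _ K) ?expr0n// => y /p0 ->; exact: dotprod0l.
have nd0 x : 0 <= norm_deriv phi x by exact: sqrtr_ge0.
exists (fine (\int[mu]_x (g x)%:E)%E); first by rewrite fineK// integrable_fin_num.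
rewrite -lee_fin fineK ?integrable_fin_num// [leRHS]EFinM -hD.
have cn := norm_deriv_continuous sp.
have mn : measurable_fun setT (fun x => (norm_deriv phi x ^+ n)%:E).
  apply/measurable_EFinP; apply: rV_continuous_measurable.
  by apply: (@rV_continuous_comp _ _ (fun z => z ^+ n)) => //; exact: exprn_continuous.
rewrite -ge0_integralZl//; first last.
- by move=> x _; rewrite lee_fin exprn_ge0.
apply: ge0_le_integral => //.
- by move=> x _; rewrite lee_fin exprn_ge0// gradn_ge0.
- by apply/measurable_EFinP; exact: rV_continuous_measurable.
- exact: measurable_funeM.
move=> x _; rewrite -EFinM lee_fin /g -exprMn lerXn2r ?nnegrE ?gradn_ge0 ?mulr_ge0//.
exact: norm_deriv_gradn.
Qed.

(** By Riesz the coordinates of [phi] in a basis are [dotprod (phi x) (u i)], so the integral is a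
    sum of scalar ones to which [component_bound] applies. The factor [1 + |u i| ^+ n] absorbs the
    comparison of the energies of the coordinates with that of [phi]. *)
Lemma dotprod_estimate : cocancelling L -> exists2 C : R, 0 <= C &
  forall (f phi : 'rV[R]_n -> E) (M K D ka : R),
  smooth f -> (forall x, diffop L f x = 0) ->
  (\int[mu]_x (`|f x|)%:E = M%:E)%E ->
  smooth phi -> 0 <= K -> (forall x, K < `|x| -> phi x = 0) ->
  (\int[mu]_x (norm_deriv phi x ^+ n)%:E = D%:E)%E -> 0 < ka ->
  (`|\int[mu]_x (dotprod (f x) (phi x))%:E| <= (C * M * (ka + ka ^- m * D))%:E)%E.
Proof.
move=> coL.
pose d := \dim (fullv : {vspace E}); pose e (i : 'I_d) : E := (vbasis fullv)`_i.
have [C hC] := choice (fun i => good_all m0 coL (e i) : exists c, component_bound L (e i) c).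
have rz (i : 'I_d) : exists u : E, forall x : E, coord (vbasis fullv) i x = dotprod x u.
  by apply: riesz => a x y; rewrite linearP.
have [u uE] := choice rz.
exists (\sum_i C i * (1 + `|u i| ^+ n)).
  by apply: sumr_ge0 => i _; rewrite mulr_ge0 ?(hC i).1// addr_ge0// exprn_ge0.
move=> f phi M K D ka sf Lf hM sp K0 p0 hD ka0.
have M0 : 0 <= M by rewrite -lee_fin -hM; apply: integral_ge0 => x _; rewrite lee_fin.
have D0 : 0 <= D.
  by rewrite -lee_fin -hD; apply: integral_ge0 => x _; rewrite lee_fin exprn_ge0// sqrtr_ge0.
pose c (i : 'I_d) x : R := dotprod (phi x) (u i).
have sc i : csmooth (c i) := (smooth_dotprod (u i) sp).1.
have c0 i x : K < `|x| -> c i x = 0 by move=> /p0 cx; rewrite /c cx dotprod0l.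
have int i : mu.-integrable setT (fun x => (dotprod (f x) (e i) * c i x)%:E).
  apply: (@integrable_continuous_cube _ _ (fun x => dotprod (f x) (e i) * c i x) _ K0).
    apply: rV_continuousM; last exact: csmooth_continuous.
    exact: (csmooth_continuous (smooth_dotprod (e i) sf).1).
  by move=> x /c0 ->; rewrite mulr0.
have -> : (\int[mu]_x (dotprod (f x) (phi x))%:E =
    \sum_i \int[mu]_x (dotprod (f x) (e i) * c i x)%:E)%E.
  rewrite -(@integral_sum _ _ _ mu _ _ _ (fun i x => (dotprod (f x) (e i) * c i x)%:E))//.
  apply: eq_integral => x _; rewrite sumEFin; congr EFin.
  rewrite [in LHS](coord_vbasis (memvf (phi x))) dotprod_sumr.
  by apply: eq_bigr => i _; rewrite dotprodZr uE mulrC.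
apply: (le_trans (lee_abs_sum _ _ _)).
have kam : 0 <= ka ^- m by rewrite invr_ge0 exprn_ge0// ltW.
rewrite mulr_suml mulr_suml -sumEFin; apply: lee_sum => i _.
have [De hDe DeD] := integral_gradn_dotprod (u i) sp K0 p0 hD.
apply: (le_trans ((hC i).2 f (c i) M K De ka sf Lf hM (sc i) K0 (c0 i) hDe ka0)).
rewrite lee_fin -!mulrA ler_wpM2l ?(hC i).1// mulrCA ler_wpM2l//.
apply: (@le_trans _ _ (ka + ka ^- m * (`|u i| ^+ n * D))).
  by rewrite lerD2l ler_wpM2l.
have un : 0 <= `|u i| ^+ n by exact: exprn_ge0.
rewrite -subr_ge0.
have -> : (1 + `|u i| ^+ n) * (ka + ka ^- m * D) - (ka + ka ^- m * (`|u i| ^+ n * D)) =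
  `|u i| ^+ n * ka + ka ^- m * D by ring.
by rewrite addr_ge0// mulr_ge0// ltW.
Qed.

(** The two terms balance at [ka] equal to the [n]-th root of [D]; a small [eta] is added because
    this root may be [0]. *)
Lemma optimise_scale (I : \bar R) (C D : R) : 0 <= C -> 0 <= D ->
  (forall ka : R, 0 < ka -> (I <= (C * (ka + ka ^- m * D))%:E)%E) ->
  (I <= (2 * C * D `^ n%:R^-1)%:E)%E.
Proof.
move=> C0 D0 h; set De := D `^ n%:R^-1.
have De0 : 0 <= De := powR_ge0 _ _.
have DE : D = De ^+ n by rewrite -powR_mulrn// -powRrM mulVf// powRr1.
apply/lee_addgt0Pr => eps eps0; pose eta := eps / (C + 1).
have C1 : 0 < C + 1 by rewrite ltr_wpDl.
have eta0 : 0 < eta by rewrite divr_gt0.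
have ka0 : 0 < De + eta by rewrite ltr_wpDl.
apply: (le_trans (h _ ka0)); rewrite -EFinD lee_fin.
have h1 : (De + eta) ^- m * D <= De.
  rewrite mulrC ler_pdivrMr ?exprn_gt0// DE exprS ler_wpM2l//.
  by rewrite lerXn2r ?nnegrE ?(ltW ka0)// lerDl ltW.
have h2 : C * eta <= eps.
  by rewrite mulrC -mulrA -[leRHS]mulr1 ler_wpM2l ?(ltW eps0)// ler_pdivrMl// mulr1 lerDl.
apply: (@le_trans _ _ (C * (De + eta + De))); first by rewrite ler_wpM2l// lerD2l.
have -> : C * (De + eta + De) = 2 * C * De + C * eta by ring.
by rewrite lerD2l.
Qed.

Lemma cocancelling_estimate : cocancelling L -> exists C : R, 0 < C /\
  forall f : 'rV[R]_n -> E, smooth f -> L1 f -> (forall x, diffop L f x = 0) ->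
  forall phi : 'rV[R]_n -> E, test_function phi ->
  (`| \int[mu]_x (dotprod (f x) (phi x))%:E |
   <= C%:E * (\int[mu]_x (`|f x|)%:E)
      * (\int[mu]_x (norm_deriv phi x ^+ n)%:E) `^ (n%:R^-1))%E.
Proof.
move=> /dotprod_estimate[C C0 hC]; exists (2 * C + 1); split.
  by rewrite ltr_wpDl// mulr_ge0.
move=> f sf [_ fL] Lf phi tphi.
have [K K0 p0] := test_function_cube tphi.
have sp := tphi.1.
have Mfin : (\int[mu]_x (`|f x|)%:E)%E \is a fin_num.
  by rewrite ge0_fin_numE//; apply: integral_ge0 => x _; rewrite lee_fin.
have Dfin : (\int[mu]_x (norm_deriv phi x ^+ n)%:E)%E \is a fin_num.
  apply: integrable_fin_num => //.
  apply: (@integrable_continuous_cube _ _ (fun x => norm_deriv phi x ^+ n) _ K0).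
    apply: (@rV_continuous_comp _ _ (fun z => z ^+ n)); first exact: exprn_continuous.
    exact: norm_deriv_continuous.
  by move=> x Kx; rewrite (norm_deriv_support sp p0 Kx) expr0n.
set M := fine (\int[mu]_x (`|f x|)%:E)%E.
set D := fine (\int[mu]_x (norm_deriv phi x ^+ n)%:E)%E.
have hM : (\int[mu]_x (`|f x|)%:E = M%:E)%E by rewrite fineK.
have hD : (\int[mu]_x (norm_deriv phi x ^+ n)%:E = D%:E)%E by rewrite fineK.
have M0 : 0 <= M by rewrite -lee_fin -hM; apply: integral_ge0 => x _; rewrite lee_fin.
have D0 : 0 <= D.
  by rewrite -lee_fin -hD; apply: integral_ge0 => x _; rewrite lee_fin exprn_ge0// sqrtr_ge0.
have := @optimise_scale _ (C * M) D (mulr_ge0 C0 M0) D0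
  (fun ka ka0 => hC f phi M K D ka sf Lf hM sp K0 p0 hD ka0).
move=> /le_trans; apply; rewrite hM hD poweR_EFin -!EFinM lee_fin.
rewrite ler_wpM2r ?powR_ge0// mulrA ler_wpM2r// lerDl//.
Qed.

End sufficiency.

(** * Necessity: averaged dilated bumps of small energy *)

Section plateau.
Context (R : realType).

Definition plateauj j (z : R) : R := sstepj j (z + 2) - sstepj j (z - 1).

Lemma plateauj_jet : is_jet plateauj.
Proof.
have shift c : is_jet (fun j z => @sstepj R j (z + c)).
  move=> j x; have := jet_affine 1 c (@sstepj_jet R) j x; rewrite !expr1n !mul1r.
  suff -> : (fun x => 1 * sstepj j (1 * x + c)) = (fun x => sstepj j (x + c)) by [].
  by apply/funext => y; rewrite !mul1r.
by move=> j x; apply: is_deriveB; exact: shift.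
Qed.

Lemma plateauj_mid j (z : R) : `|z| <= 1 -> plateauj j z = (j == 0%N)%:R.
Proof.
rewrite ler_norml => /andP[z0 z1]; rewrite /plateauj sstepj_right; last lra.
by rewrite sstepj_left ?subr0//; lra.
Qed.

Lemma plateauj_out j (z : R) : 2 <= `|z| -> plateauj j z = 0.
Proof.
rewrite /plateauj ler_normr => /orP[z1|z1].
  by rewrite !sstepj_right ?subrr//; lra.
by rewrite !sstepj_left ?subrr//; lra.
Qed.

Lemma plateauj0_itv (z : R) : 0 <= plateauj 0 z <= 1.
Proof.
have j0 x : @sstepj R 0 x = sstep x by rewrite /sstepj /jet derive1n0.
rewrite /plateauj !j0; have [z1|z1] := leP 1 z.
  by rewrite [X in X - _]sstep1 ?subr_ge0 ?sstep_le1 ?gerBl ?sstep_ge0//; lra.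
by rewrite [X in _ - X]sstep0 ?subr0 ?sstep_ge0 ?sstep_le1//; lra.
Qed.

Lemma plateauj1_bounded : exists2 C : R, 0 <= C & forall z, `|plateauj 1 z| <= C.
Proof.
have [C C1 hC] := @sstepj_bounded R 1; exists (C + C); first lra.
by move=> z; rewrite (le_trans (ler_normB _ _))// lerD.
Qed.

Variable n : nat.
Implicit Types (s : R) (x : 'rV[R]_n).

Definition plateau_factor s (i : 'I_n) j (z : R) := s ^+ j * plateauj j (s * z + 0).

Definition plateau s : 'rV[R]_n -> R := tens (plateau_factor s) (fun=> 0%N).

Lemma plateau_smooth s : csmooth (plateau s) /\
  forall t, pds t (plateau s) = tens (plateau_factor s) (fun i => count_mem i t).
Proof. by apply: csmooth_tens => i; exact: jet_affine plateauj_jet. Qed.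

Lemma plateauE s x : plateau s x = \prod_i plateauj 0 (s * x ord0 i).
Proof.
by apply: eq_bigr => i _; rewrite /plateau_factor expr0 mul1r addr0.
Qed.

Lemma plateau_ge0 s x : 0 <= plateau s x.
Proof. by rewrite plateauE prodr_ge0// => i _; have /andP[] := plateauj0_itv (s * x ord0 i). Qed.

Lemma scaled_coord_le s x (r : R) i : 0 < s -> `|x| <= r / s -> `|s * x ord0 i| <= r.
Proof.
move=> s0 xr; rewrite normrM gtr0_norm// mulrC -ler_pdivlMr//.
exact: le_trans (rV_coord_le x i) xr.
Qed.

Lemma plateau_mid s x : 0 < s -> `|x| <= s^-1 -> plateau s x = 1.
Proof.
move=> s0 xs; rewrite plateauE big1// => i _.
by rewrite plateauj_mid//; apply: scaled_coord_le; rewrite ?mul1r.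
Qed.

Lemma plateau_out s x : 0 < s -> 2 / s < `|x| -> plateau s x = 0.
Proof.
move=> s0; rewrite ltNge rV_norm_le ?divr_ge0 ?(ltW s0)//.
move=> /forallPn[i]; rewrite -ltNge => si.
rewrite plateauE (bigD1 i)//= plateauj_out ?mul0r//.
by rewrite normrM gtr0_norm// mulrC -ler_pdivrMr// ltW.
Qed.

(** The bound is of size [s] on an annulus of volume of order [s ^- n]: its [L^n] norm does not
    depend on [s], the scale invariance that averaging exploits. *)
Lemma pd_plateau_bound : exists2 A : R, 0 <= A & forall s i x, 0 < s ->
  `|pd i (plateau s) x| <= A * (if s^-1 <= `|x| <= 2 / s then s else 0).
Proof.
have [C C0 hC] := plateauj1_bounded; exists C => // s i x s0.
have -> : pd i (plateau s) x = tens (plateau_factor s) (fun l => count_mem l [:: i]) x.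
  by have /(congr1 (@^~ x)) := (plateau_smooth s).2 [:: i].
case: ifPn => [_|].
  rewrite /tens (bigD1 i)//= eqxx /plateau_factor expr1 addr0 normrM.
  rewrite -[leRHS]mulr1 ler_pM//.
    by rewrite normrM gtr0_norm// mulrC ler_wpM2r// ltW.
  rewrite normr_prod; apply: prodr_ile1 => j ji.
  rewrite normr_ge0/= eq_sym (negbTE ji) expr0 mul1r addr0.
  by have /andP[p0 p1] := plateauj0_itv (s * x ord0 j); rewrite ger0_norm.
rewrite negb_and -!ltNge mulr0 normr_le0 => /orP[xs|xs].
  rewrite /tens (bigD1 i)//= eqxx /plateau_factor expr1 addr0 plateauj_mid ?mulr0 ?mul0r//.
  by apply: scaled_coord_le; rewrite ?mul1r// ltW.
have <- : pds [:: i] (plateau s) x = tens (plateau_factor s) (fun l => count_mem l [:: i]) x.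
  by rewrite (plateau_smooth s).2.
by apply/eqP; apply: (@pds_cube0 _ _ _ [:: i] (2 / s)) => // y; exact: plateau_out.
Qed.

(** Powers of [4], rather than [2], keep disjoint the annuli [4 ^- j <= |x| <= 2 * 4 ^- j] that
    carry the gradients. *)
Definition average (N : nat) x : R := N%:R^-1 * \sum_(j < N) plateau (4 ^+ j) x.

Lemma average_smooth N : csmooth (average N) /\
  forall i x, pd i (average N) x = N%:R^-1 * \sum_(j < N) pd i (plateau (4 ^+ j)) x.
Proof.
have [s1 s2] := csmooth_sum (index_enum 'I_N) (fun j : 'I_N => (plateau_smooth (4 ^+ j)).1).
have [z1 z2] := csmoothZ N%:R^-1 s1; split=> // i x.
by have /(congr1 (@^~ x)) := z2 [:: i]; rewrite s2.
Qed.

Lemma average_mid N x : (0 < N)%N -> `|x| <= (4 ^+ N)^-1 -> average N x = 1.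
Proof.
move=> N0 xN; rewrite /average (eq_bigr (fun=> 1)); last first.
  move=> j _; rewrite plateau_mid ?exprn_gt0// (le_trans xN)//.
  by rewrite lef_pV2 ?posrE ?exprn_gt0// ler_eXn2l ?ltr1n// ltnW.
by rewrite sumr_const card_ord mulVf// pnatr_eq0 -lt0n.
Qed.

Lemma average_out N x : 2 < `|x| -> average N x = 0.
Proof.
move=> x2; rewrite /average big1 ?mulr0// => j _.
rewrite plateau_out ?exprn_gt0// (le_lt_trans _ x2)// ler_pdivrMr ?exprn_gt0//.
by rewrite -[leLHS]mulr1 ler_wpM2l// exprn_ege1// ler1n.
Qed.

End plateau.

Lemma expr_sum_disjoint (R : comNzRingType) (I : finType) (u : I -> R) p :
  (forall i j, u i != 0 -> u j != 0 -> i = j) ->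
  (\sum_i u i) ^+ p.+1 = \sum_i u i ^+ p.+1.
Proof.
move=> dis; case: (pickP (fun i => u i != 0)) => [i ui|u0]; last first.
  by rewrite !big1 ?expr0n// => i _; move/negbFE/eqP: (u0 i) => ->; rewrite ?expr0n.
have uj j : j != i -> u j = 0.
  by move=> ji; apply/eqP; apply: contraNT ji => uj0; apply/eqP; exact: dis.
rewrite (bigD1 i)//= [RHS](bigD1 i)//= !big1 ?addr0// => j /uj ->//.
by rewrite expr0n.
Qed.

Section average_energy.
Context (R : realType) (m : nat) (E : euclideanType R).
Local Notation n := m.+1.
Local Notation mu := (@lebesgue_rV R n).

(* The gradients of the [N] averaged bumps live on disjoint annuli and contribute
   equally to the energy, hence the factor [N / N ^ n]. *)
Lemma average_energy (e : E) : exists2 A : R, 0 <= A & forall N, (0 < N)%N ->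
  exists2 D : R, (\int[mu]_x (norm_deriv (fun x => average N x *: e) x ^+ n)%:E = D%:E)%E
    & D * N%:R ^+ m <= A ^+ n.
Proof.
have [A A0 hA] := @pd_plateau_bound R n.
pose c : R := n%:R * (`|e| * A); have c0 : 0 <= c by rewrite !mulr_ge0.
exists (c * 4); first by rewrite mulr_ge0.
move=> N N0; have NR : 0 < N%:R :> R by rewrite ltr0n.
have [sa pda] := @average_smooth R n N.
have [sp pE] := smooth_scale e sa.
set phi := fun x => average N x *: e.
pose u (j : 'I_N) (x : 'rV[R]_n) : R :=
  if (4 ^+ j)^-1 <= `|x| <= 2 / 4 ^+ j then 4 ^+ j else 0.
have u0 j x : 0 <= u j x by rewrite /u; case: ifP => // _; rewrite exprn_ge0.
have ud x i j : u i x != 0 -> u j x != 0 -> i = j.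
  wlog : i j / (i <= j)%N => [hw ui uj|].
    by have [/hw|/ltnW/hw h] := leqP i j; [exact|rewrite (h uj ui)].
  rewrite leq_eqVlt => /predU1P[/val_inj//|ij].
  rewrite /u; case: ifP; last by rewrite eqxx.
  move=> /andP[ix _] _; case: ifP; last by rewrite eqxx.
  move=> /andP[_ xj] _; have := le_trans ix xj.
  rewrite ler_pdivlMr ?exprn_gt0// mulrC ler_pdivrMr ?exprn_gt0// leNgt => /negP[].
  apply: (@lt_le_trans _ _ (4 ^+ i.+1)); first by rewrite exprS ltr_pM2r ?exprn_gt0// ltr_nat.
  by rewrite ler_eXn2l// ltr1n.
have ndb x : norm_deriv phi x <= c * N%:R^-1 * \sum_j u j x.
  have S0 : 0 <= \sum_j u j x by exact: sumr_ge0.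
  pose B : R := `|e| * A * N%:R^-1 * \sum_j u j x.
  have B0 : 0 <= B by rewrite !mulr_ge0// invr_ge0 ltW.
  have pb i : `|partial i phi x| <= B.
    have -> : partial i phi x = pd i (average N) x *: e.
      by have /(congr1 (@^~ x)) := pE [:: i].
    rewrite normrZ pda normrM gtr0_norm ?invr_gt0//.
    have -> : B = N%:R^-1 * (A * \sum_j u j x) * `|e| by rewrite /B; ring.
    rewrite ler_wpM2r// ler_wpM2l ?invr_ge0 ?(ltW NR)//.
    rewrite mulr_sumr (le_trans (ler_norm_sum _ _ _))//.
    by apply: ler_sum => j _; exact: hA (exprn_gt0 _ _).
  rewrite /norm_deriv (_ : c * _ * _ = n%:R * B); last by rewrite /c /B; ring.
  have -> : n%:R * B = Num.sqrt ((n%:R * B) ^+ 2) by rewrite sqrtr_sqr ger0_norm ?mulr_ge0.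
  rewrite ler_wsqrtr//.
  apply: (@le_trans _ _ (\sum_(i < n) B ^+ 2)).
    by apply: ler_sum => i _; rewrite lerXn2r ?nnegrE.
  rewrite sumr_const card_ord -[leLHS]mulr_natl [leRHS]exprMn ler_wpM2r ?exprn_ge0//.
  by rewrite expr2 ler_peMr ?ler1n.
have cn : continuous (fun x => norm_deriv phi x ^+ n).
  apply: (@rV_continuous_comp _ _ (fun z => z ^+ n)); first exact: exprn_continuous.
  exact: norm_deriv_continuous.
have nd0 x : 0 <= norm_deriv phi x by exact: sqrtr_ge0.
have phi0 x : 2 < `|x| -> phi x = 0 by move=> x2; rewrite /phi average_out// scale0r.
have int : mu.-integrable setT (fun x => (norm_deriv phi x ^+ n)%:E).
  apply: (@integrable_continuous_cube _ _ _ 2 _ cn) => // x x2.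
  by rewrite (norm_deriv_support sp phi0 x2) expr0n.
exists (fine (\int[mu]_x (norm_deriv phi x ^+ n)%:E)%E); first by rewrite fineK// integrable_fin_num.
have mi (j : 'I_N) : measurable_fun setT (fun x : 'rV[R]_n => (\1_(cube (2 / 4 ^+ j)) x)%:E).
  by apply/measurable_EFinP; apply: measurable_indic; exact: measurable_cube.
pose b (j : 'I_N) : R := (c * N%:R^-1) ^+ n * (4 ^+ j) ^+ n.
have b0 j : 0 <= b j by rewrite mulr_ge0// exprn_ge0// ?exprn_ge0// mulr_ge0// invr_ge0 ltW.
have le1 : (\int[mu]_x (norm_deriv phi x ^+ n)%:E <=
    \int[mu]_x (\sum_(j < N) (b j)%:E * (\1_(cube (2 / 4 ^+ j)) x)%:E))%E.
  apply: ge0_le_integral => //.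
  - by move=> x _; rewrite lee_fin exprn_ge0.
  - by apply/measurable_EFinP; exact: rV_continuous_measurable.
  - by apply: emeasurable_sum => j; exact: measurable_funeM.
  move=> x _; under eq_bigr do rewrite -EFinM.
  rewrite sumEFin lee_fin (le_trans (lerXn2r n (nd0 x) _ (ndb x)))//.
    by rewrite nnegrE mulr_ge0 ?sumr_ge0// mulr_ge0// invr_ge0 ltW.
  rewrite exprMn expr_sum_disjoint; last exact: ud.
  rewrite mulr_sumr; apply: ler_sum => j _; rewrite /b -[leRHS]mulrA ler_wpM2l//.
    by rewrite exprn_ge0// mulr_ge0// invr_ge0 ltW.
  rewrite /u; case: ifP => [/andP[_ xj]|_]; last by rewrite expr0n mulr_ge0// exprn_ge0// exprn_ge0.
  by rewrite indicE mem_set// mulr1.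
have e2 : (\int[mu]_x (\sum_(j < N) (b j)%:E * (\1_(cube (2 / 4 ^+ j)) x)%:E) =
    (N%:R * (c * N%:R^-1 * 4) ^+ n)%:E)%E.
  rewrite ge0_integral_sum//; last 2 first.
  - by move=> j; exact: measurable_funeM.
  - by move=> j x _; rewrite mule_ge0// lee_fin.
  transitivity (\sum_(j < N) ((c * N%:R^-1 * 4) ^+ n)%:E)%E; last first.
    by rewrite sumEFin sumr_const card_ord; congr EFin; rewrite -[LHS]mulr_natl.
  apply: eq_bigr => j _; rewrite ge0_integralZl ?lee_fin//.
  rewrite integral_indic// ?setIT; last exact: measurable_cube.
  rewrite [X in (_ * X)%E](@lebesgue_rV_cube _ _ (2 / 4 ^+ j)) ?divr_ge0 ?exprn_ge0// -EFinM /b -exprMn -exprMn.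
  congr (_ ^+ _)%:E.
  by field; rewrite !gt_eqF// exprn_gt0.
set D := fine _; have DN : D <= N%:R * (c * N%:R^-1 * 4) ^+ n.
  by rewrite -lee_fin -e2 fineK// integrable_fin_num.
have -> : (c * 4) ^+ n = N%:R * (c * N%:R^-1 * 4) ^+ n * N%:R ^+ m.
  rewrite [RHS]mulrAC -[N%:R * N%:R ^+ m]exprS -[RHS]exprMn; congr (_ ^+ _); field.
  by rewrite gt_eqF.
by rewrite ler_wpM2r// exprn_ge0// ltW.
Qed.

End average_energy.

(** * Necessity: from the estimate to cocancellation *)

Lemma digits_inj B n (a b : 'I_n -> nat) : (forall i, a i < B)%N -> (forall i, b i < B)%N ->
  (\sum_(i < n) a i * B ^ i = \sum_(i < n) b i * B ^ i)%N -> a =1 b.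
Proof.
elim: n a b => [|n IHn] a b aB bB; first by move=> _ [].
rewrite !big_ord_recl !expn0 !muln1.
have shift (c : 'I_n.+1 -> nat) : (\sum_(i < n) c (lift ord0 i) * B ^ lift ord0 i =
    (\sum_(i < n) c (lift ord0 i) * B ^ i) * B)%N.
  by rewrite big_distrl; apply: eq_bigr => i _; rewrite /= /bump add1n expnSr mulnA.
rewrite !shift => e.
have B0 : (0 < B)%N by apply: leq_ltn_trans (aB ord0).
have e0 : a ord0 = b ord0.
  by have := congr1 (modn^~ B) e; rewrite /= ![(_ + _ * B)%N]addnC !modnMDl !modn_small.
have e1 : a \o lift ord0 =1 b \o lift ord0.
  apply: IHn => [i|i|]; [exact: aB|exact: bB|].
  by have := congr1 (divn^~ B) e; rewrite /= ![(_ + _ * B)%N]addnC !divnMDl// !divn_small// !addn0.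
move=> i; case: (unliftP ord0 i) => [j ->|->//]; exact: e1.
Qed.

Lemma poly_nat_roots (R : numDomainType) (p : {poly R}) :
  (forall j : nat, p.[j.+1%:R] = 0) -> p = 0.
Proof.
move=> p0; apply/eqP/negPn/negP => pn0.
have /negP[] := negbT (ltnn (size p)).
rewrite -{1}(size_iota 0 (size p)) -(size_map (fun j => j.+1%:R : R)).
apply: max_poly_roots => //.
  by apply/allP => _ /mapP[j _ ->]; apply/eqP/p0.
by rewrite map_inj_uniq ?iota_uniq// => i j /eqP; rewrite eqr_nat => /eqP[].
Qed.

Section necessity.
Context (R : realType) (m k : nat) (E F : euclideanType R).
Local Notation n := m.+1.
Local Notation mu := (@lebesgue_rV R n).
Variable L : multiindex n k -> 'Hom(E, F).

(* Kronecker substitution: along [xi_i = z ^ (k+1)^i] distinct multi-indices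
   give distinct powers of [z]. *)
Lemma coef_kernel (e : E) : (forall xi : 'rV[R]_n, xi != 0 -> symbol L xi e = 0) ->
  forall a, L a e = 0.
Proof.
move=> h a; apply: dotprod_eq0; set v := L a e.
pose B := k.+1.
pose d (b : multiindex n k) : nat := (\sum_(i < n) val b i * B ^ i)%N.
have dinj : injective d.
  move=> b c /digits_inj bc; apply/val_inj/ffunP => i; apply/val_inj.
  by apply: bc => j; exact: ltn_ord.
pose c (b : multiindex n k) : R := dotprod (L b e) v.
pose p : {poly R} := \sum_(b : multiindex n k) c b *: 'X^(d b).
have : p = 0.
  apply: poly_nat_roots => j; set z : R := j.+1%:R.
  have z0 : z != 0 by rewrite pnatr_eq0.
  pose xi : 'rV[R]_n := \row_i z ^+ (B ^ i).
  have xi0 : xi != 0.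
    apply/eqP => /rowP/(_ ord0); rewrite !mxE => /eqP; apply/negP.
    by rewrite expf_eq0 (negbTE z0) andbF.
  have := congr1 (fun w => dotprod w v : R) (h _ xi0).
  rewrite dotprod0l /symbol sum_lfunE dotprod_suml /p => <-.
  rewrite horner_sum; apply: eq_bigr => b _.
  rewrite hornerZ hornerXn scale_lfunE dotprodZl mulrC; congr (_ * _).
  rewrite /d -prodrXr; apply: eq_bigr => i _.
  by rewrite mxE -exprM mulnC.
move=> /(congr1 (fun q : {poly R} => q`_(d a))).
rewrite coef0 coef_sum (bigD1 a)//= coefZ coefXn eqxx mulr1 big1 ?addr0// => b ba.
rewrite coefZ coefXn (_ : (d a == d b) = false) ?mulr0//.
by apply: contra_neqF ba => /eqP/dinj.
Qed.

Lemma test_function_scale (g : 'rV[R]_n -> R) (e : E) (K : R) : csmooth g ->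
  (forall x, K < `|x| -> g x = 0) -> test_function (fun x => g x *: e).
Proof.
move=> sg g0; split; first exact: (smooth_scale e sg).1.
apply: (subclosed_compact _ (@cube_compact R n K)); first exact: closed_closure.
have /closure_id -> : closed (@cube R n K).
  by apply: compact_closed; [exact: norm_hausdorff|exact: cube_compact].
apply: closureS => x /= gx; rewrite /cube/= leNgt; apply/negP => /g0 gx0.
by move: gx; rewrite gx0 scale0r eqxx.
Qed.

(** The solution [plateau s x *: e] is concentrated where the averaged bump equals [1]. The mass [I]
    of [plateau s] occurs on both sides and cancels, leaving a bound of the norm of [e] by [C] times
    the [n]-th root of the energy [D], which is false for large [N]. *)
Lemma estimate_cocancelling : (0 < m)%N ->
  (exists C : R, 0 < C /\
  forall f : 'rV[R]_n -> E, smooth f -> L1 f -> (forall x, diffop L f x = 0) ->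
  forall phi : 'rV[R]_n -> E, test_function phi ->
  (`| \int[mu]_x (dotprod (f x) (phi x))%:E |
   <= C%:E * (\int[mu]_x (`|f x|)%:E)
      * (\int[mu]_x (norm_deriv phi x ^+ n)%:E) `^ (n%:R^-1))%E) -> cocancelling L.
Proof.
move=> m0 [C [C0 hC]]; apply/seteqP; split=> [e he|_ -> xi _ /=]; last first.
  by rewrite memv_ker linear0.
have Le a : L a e = 0.
  by apply: coef_kernel => xi xi0; have := he xi xi0; rewrite /= memv_ker => /eqP.
apply/eqP/negPn/negP => e0; have ne : 0 < `|e| by rewrite normr_gt0.
have [A A0 hA] := @average_energy R m E e.
(* The final inequality reads [N.+1 <= X]: it combines the bound on [D * N.+1 ^+ m] with
   [N.+1 <= N.+1 ^+ m], true as [m >= 1]. *)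
pose X : R := (C * A) ^+ n / `|e| ^+ n.
have X0 : 0 <= X by rewrite divr_ge0// exprn_ge0// mulr_ge0// ltW.
have [N XN] : exists N : nat, X < N.+1%:R.
  by exists (Num.truncn X); exact: truncnS_gt.
have [D hD DN] := hA N.+1 isT.
(* One power of [4] beyond [average N.+1], so that the support of [f], where [|x| <= 2 / s], lies in
   the region where the average is [1]. *)
pose s : R := 4 ^+ N.+2; have s0 : 0 < s by rewrite exprn_gt0.
have [sg _] := @plateau_smooth R n s.
pose f (x : 'rV[R]_n) : E := plateau s x *: e.
have [sf pf] := smooth_scale e sg.
have cg := csmooth_continuous sg.
have K0 : 0 <= 2 / s by rewrite divr_ge0// ltW.
have ig : mu.-integrable setT (fun x => (plateau s x)%:E).
  by apply: (@integrable_continuous_cube _ _ (plateau s) _ K0 cg) => x; exact: plateau_out.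
pose I := fine (\int[mu]_x (plateau s x)%:E)%E.
have hI : (\int[mu]_x (plateau s x)%:E = I%:E)%E by rewrite fineK// integrable_fin_num.
have I0 : 0 < I.
  apply: (@lt_le_trans _ _ ((s^-1 *+ 2) ^+ n)); first by rewrite exprn_gt0// pmulrn_lgt0// invr_gt0.
  have si0 : 0 <= s^-1 by rewrite invr_ge0 ltW.
  rewrite -lee_fin -hI -(lebesgue_rV_cube n si0).
  rewrite -[X in mu X]setIT -integral_indic//; last exact: measurable_cube.
  apply: ge0_le_integral => //.
  - by apply/measurable_EFinP; apply: measurable_indic; exact: measurable_cube.
  - by apply/measurable_EFinP; exact: rV_continuous_measurable.
  move=> x _; rewrite lee_fin indicE; case: (boolP (x \in cube _)) => [/set_mem xs|_].
    by rewrite plateau_mid.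
  exact: plateau_ge0.
have nf : (\int[mu]_x (`|f x|)%:E = (I * `|e|)%:E)%E.
  under eq_integral do rewrite /f normrZ ger0_norm ?plateau_ge0// EFinM.
  by rewrite integralZr// hI.
have L1f : L1 f.
  split; last by rewrite nf ltry.
  move=> u; apply: rV_continuous_measurable.
  exact: (csmooth_continuous (smooth_dotprod u sf).1).
have Lf x : diffop L f x = 0.
  rewrite /diffop big1// => a _; rewrite partial_multi_mlist pf.
  by rewrite linearZ/= Le scaler0.
have sa := (@average_smooth R n N.+1).1.
have tphi : test_function (fun x : 'rV[R]_n => average N.+1 x *: e).
  by apply: (@test_function_scale (average N.+1) e 2) => // x; exact: average_out.
have := hC f sf L1f Lf _ tphi.
have -> : (\int[mu]_x (dotprod (f x) (average N.+1 x *: e))%:E = (I * `|e| ^+ 2)%:E)%E.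
  rewrite EFinM -hI -integralZr//; apply: eq_integral => x _.
  rewrite -EFinM; congr EFin; rewrite /f dotprodZl dotprodZr dotprod_norm.
  have [xs|xs] := leP `|x| (2 / s); last by rewrite plateau_out// !mul0r.
  rewrite average_mid ?mul1r// (le_trans xs)// ler_pdivrMr// /s mulrC exprS.
  by rewrite mulfK ?gt_eqF ?exprn_gt0// ler_nat.
rewrite nf hD poweR_EFin -!EFinM lee_fin.
have D0 : 0 <= D.
  by rewrite -lee_fin -hD; apply: integral_ge0 => x _; rewrite lee_fin exprn_ge0// sqrtr_ge0.
set r := D `^ n%:R^-1; have r0 : 0 <= r := powR_ge0 _ _.
have DE : D = r ^+ n by rewrite -powR_mulrn// -powRrM mulVf// powRr1.
rewrite ger0_norm ?mulr_ge0 ?(ltW I0)//.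
have -> : I * `|e| ^+ 2 = I * `|e| * `|e| by ring.
have -> : C * (I * `|e|) * r = I * `|e| * (C * r) by ring.
rewrite ler_pM2l ?mulr_gt0// => er.
have : `|e| ^+ n * N.+1%:R <= (C * A) ^+ n.
  apply: (@le_trans _ _ ((C * r) ^+ n * N.+1%:R ^+ m)).
    apply: ler_pM => //.
      by rewrite lerXn2r ?nnegrE// mulr_ge0// ltW.
    by rewrite -[leLHS]expr1 ler_weXn2l// ler1n.
  by rewrite exprMn -DE -mulrA exprMn ler_wpM2l// exprn_ge0// ltW.
rewrite -ler_pdivlMl ?exprn_gt0// mulrC -/X leNgt => /negP; exact.
Qed.

End necessity.

Theorem theorem0p10 (R : realType) (n : nat) (hn : (1 < n)%N)
    (E F : euclideanType R) (k : nat) (hk : (0 < k)%N)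
    (L : multiindex n k -> 'Hom(E, F)) :
  (exists C : R, 0 < C /\
     forall f : 'rV[R]_n -> E, smooth f -> L1 f ->
       (forall x, diffop L f x = 0) ->
     forall phi : 'rV[R]_n -> E, test_function phi ->
       (`| \int[@lebesgue_rV R n]_x (dotprod (f x) (phi x))%:E |
        <= C%:E * (\int[@lebesgue_rV R n]_x (`|f x|)%:E)
           * (\int[@lebesgue_rV R n]_x (norm_deriv phi x ^+ n)%:E)
               `^ (n%:R^-1))%E)
  <-> cocancelling L.
Proof.
case: n hn L => [//|m] m0 L; case: k hk L => [//|k] _ L.
by split; [exact: estimate_cocancelling|exact: cocancelling_estimate].
Qed.
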